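(* There is an absolute constant $c>0$ such that for every finite set $A\subset\mathbb{H}$ of quaternions, \[ |A+A| + |AA| \gg |A|^{4/3+c}. \]
   Context: $\mathbb{H}$ denotes the real quaternions. For finite $A,B\subset\mathbb{H}$: $A+B=\{a+b: a\in A, b\in B\}$ and $AB=\{ab: a\in A, b\in B\}$ (quaternion multiplication, which is not commutative). $X\gg Y$ means $X\ge C\,Y$ for some absolute constant $C>0$. *)

(* Defs.v *)
From Stdlib Require Import Reals List.
Import ListNotations.
Open Scope R_scope.

Record quat : Type := Quat { qre : R; qi : R; qj : R; qk : R }.

Definition qadd (x y : quat) : quat :=
  Quat (qre x + qre y) (qi x + qi y) (qj x + qj y) (qk x + qk y).

(* Hamilton product (i^2 = j^2 = k^2 = ijk = -1); not commutative. *)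
Definition qmul (x y : quat) : quat :=
  Quat (qre x * qre y - qi x * qi y - qj x * qj y - qk x * qk y)
       (qre x * qi y + qi x * qre y + qj x * qk y - qk x * qj y)
       (qre x * qj y - qi x * qk y + qj x * qre y + qk x * qi y)
       (qre x * qk y + qi x * qj y - qj x * qi y + qk x * qre y).

Definition quat_eq_dec (x y : quat) : {x = y} + {x <> y}.
Proof.
  destruct x as [a b c d], y as [a' b' c' d'].
  destruct (Req_EM_T a a'); [|right; congruence].
  destruct (Req_EM_T b b'); [|right; congruence].
  destruct (Req_EM_T c c'); [|right; congruence].
  destruct (Req_EM_T d d'); [|right; congruence].
  left; subst; reflexivity.
Defined.

Definition qcard (l : list quat) : nat := length (nodup quat_eq_dec l).

Definition sumset (A B : list quat) : list quat :=
  flat_map (fun a => map (fun b => qadd a b) B) A.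
Definition prodset (A B : list quat) : list quat :=
  flat_map (fun a => map (fun b => qmul a b) B) A.

(* Main.v *)
(* Write n = |A| = q^3 and suppose |A+A| and |AA| are at most K q^4 with K a small
   power of q; "nearly" means up to powers of K, and all exponents are compared
   through logarithms. Passing to one orthant, inner products in A may be assumed
   nonnegative, so |d| <= |c + d| and (c + d)^-1 (c x + d y) is no farther from x
   than y is.
   For a slope x let A_x be the set of c in A with c x in A. Following Solymosi and
   Wong, take x among popular slopes, y among the M slopes nearest to x, c in A_x and
   d in A_y, and consider the vectors (c + d, c x + d y) in (A+A)^2. By the kissing
   number bound only boundedly many pairs (x, y) that are not M-neighbours of each
   other produce the same vector, so if there are few collisions one gains a factor M
   over Solymosi's bound, which is impossible. The collisions are therefore numerous,
   which forces the A_x to have nearly maximal additive energy, and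
   Balog-Szemeredi-Gowers gives large B_x in A_x with |B_x + B_x| nearly |B_x|.
   Since A B_x lies in P and A B_x x lies in P, where P = AA (Katz-Koester), the set P
   has nearly maximal multiplicative energy. A multiplicative Balog-Szemeredi-Gowers
   argument yields Y and C of size about q^4, with |YC| nearly |Y|, such that Y is
   rich in dilates B r of a single B = B_x; hence the additive energy of Y is nearly
   |Y|^(5/2) at least. On the other hand |YC| being small turns popular differences of
   Y into rich lines of a Cartesian product, and there is a Szemeredi-Trotter bound
   for those, by the kissing argument again. Counting the triangles x, y, w, each
   side weighted by the number of representations in Y - Y, from below because this
   matrix is positive semidefinite and from above by Szemeredi-Trotter, bounds q by a
   power of K. *)

Require Import Defs.
From Stdlib Require Import Reals List.
From HB Require Import structures.
From mathcomp Require Import all_boot all_order all_algebra.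
From mathcomp Require Import boolp reals Rstruct.
From mathcomp Require Import ring lra zify.

Set Implicit Arguments.
Unset Strict Implicit.
Unset Printing Implicit Defensive.
Import Order.TTheory GRing.Theory Num.Theory.
Local Open Scope nat_scope.
Local Open Scope ring_scope.
Bind Scope ring_scope with Rdefinitions.R.

(** * Finite sums *)

(** The numerology is that of the case in which Solymosi's bound is sharp: about [q^4] slopes, with
    fibres of about [q^2] elements. There [Y] would have additive energy [q^10], hence at least
    [q^18] weighted triangles, whereas the Szemeredi-Trotter bounds allow only [q^(160/9)]; this
    small margin is the source of the gain. As every loss is a power of [K], no exponent of [K] has
    to be good: [1300] is the loss in finding structured fibres, [108] in building [Y], [200] in the
    triangle count, and [eta] is a sixth of the reciprocal of their product. The hypothesis
    [10 ^+ 6 <= K] absorbs absolute constants, and [L%:R <= K] the number of dyadic classes.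
    Quaternions bring two difficulties. Slopes have no order, so adjacency is replaced by distance,
    compared by means of the multiplicative norm. And left and right quotients differ: slopes are
    right factors, as in [c x], every argument keeps track of the side, and two multiplicative
    energies occur, one for [c^-1 c'] and one for [c' c^-1]. *)

Section Sums.
Variable T : eqType.
Implicit Types (s : seq T) (f g : T -> R).

Lemma sumr_ge0s s (P : pred T) f : (forall x, x \in s -> 0 <= f x) ->
  0 <= \sum_(x <- s | P x) f x.
Proof. by move=> f0; rewrite big_seq_cond sumr_ge0 // => x /andP[/f0]. Qed.

Lemma ler_sums s f g : (forall x, x \in s -> f x <= g x) ->
  \sum_(x <- s) f x <= \sum_(x <- s) g x.
Proof. by move=> fg; rewrite big_seq [leRHS]big_seq ler_sum. Qed.

Lemma eq_sums s f g : (forall x, x \in s -> f x = g x) ->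
  \sum_(x <- s) f x = \sum_(x <- s) g x.
Proof. by move=> fg; rewrite big_seq [RHS]big_seq; apply: eq_bigr. Qed.

Lemma sum_const s (c : R) : \sum_(x <- s) c = (size s)%:R * c.
Proof. by rewrite big_const_seq count_predT iter_addr_0 mulr_natl. Qed.

Lemma sum_leC s f (c : R) : (forall x, x \in s -> f x <= c) ->
  \sum_(x <- s) f x <= (size s)%:R * c.
Proof. by move=> fc; rewrite -sum_const; apply: ler_sums. Qed.

Lemma sum_geC s f (c : R) : (forall x, x \in s -> c <= f x) ->
  (size s)%:R * c <= \sum_(x <- s) f x.
Proof. by move=> fc; rewrite -sum_const; apply: ler_sums. Qed.

Lemma count_sum s (P : pred T) : (count P s)%:R = \sum_(x <- s) (P x)%:R :> R.
Proof. by rewrite -sum1_count big_mkcond natr_sum; apply: eq_bigr => x _; case: (P x). Qed.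

Lemma cauchy_schwarz s f g :
  (\sum_(x <- s) f x * g x) ^+ 2 <=
  (\sum_(x <- s) f x ^+ 2) * (\sum_(x <- s) g x ^+ 2).
Proof.
have : 0 <= \sum_(x <- s) \sum_(y <- s) (f x * g y - f y * g x) ^+ 2.
  by apply: sumr_ge0s => x _; apply: sumr_ge0s => y _; exact: sqr_ge0.
suff -> : \sum_(x <- s) \sum_(y <- s) (f x * g y - f y * g x) ^+ 2 =
   2 * ((\sum_(x <- s) f x ^+ 2) * (\sum_(x <- s) g x ^+ 2))
   - 2 * (\sum_(x <- s) f x * g x) ^+ 2 by lra.
have e1 : (\sum_(x <- s) f x ^+ 2) * (\sum_(x <- s) g x ^+ 2) =
  \sum_(x <- s) \sum_(y <- s) f x ^+ 2 * g y ^+ 2 by rewrite big_distrlr.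
have e2 : (\sum_(x <- s) f x ^+ 2) * (\sum_(x <- s) g x ^+ 2) =
  \sum_(x <- s) \sum_(y <- s) f y ^+ 2 * g x ^+ 2 by rewrite e1 exchange_big.
have e3 : (\sum_(x <- s) f x * g x) ^+ 2 =
  \sum_(x <- s) \sum_(y <- s) (f x * g x) * (f y * g y) by rewrite expr2 big_distrlr.
rewrite [2 * (_ * _)]mulr_natl mulr2n {1}e1 e2 e3 mulr_sumr -sumrN -!big_split /=.
apply: eq_bigr => x _; rewrite mulr_sumr -sumrN -!big_split /=.
by apply: eq_bigr => y _; ring.
Qed.

Lemma sqr_sum_le s f :
  (\sum_(x <- s) f x) ^+ 2 <= (size s)%:R * \sum_(x <- s) f x ^+ 2.
Proof.
have := cauchy_schwarz s f (fun=> 1).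
rewrite (eq_bigr f) => [|x _]; last by rewrite mulr1.
by rewrite mulrC sum_const expr1n mulr1.
Qed.

Lemma sum_delta (I : seq T) (z : T) (F : T -> R) : uniq I ->
  \sum_(x <- I) (z == x)%:R * F x = (z \in I)%:R * F z.
Proof.
elim: I => [|a I IH] /=; first by rewrite big_nil mul0r.
move=> /andP[aI uI]; rewrite big_cons IH // inE.
have [->|za] := eqVneq z a; first by rewrite (negPf aI) mul0r addr0.
by rewrite mul0r add0r.
Qed.

Lemma sum_delta1 (I : seq T) (z : T) : uniq I -> z \in I ->
  \sum_(x <- I) (z == x)%:R = 1 :> R.
Proof.
move=> uI zI; transitivity (\sum_(x <- I) (z == x)%:R * (1 : R)).
  by apply: eq_bigr => x _; rewrite mulr1.
by rewrite (sum_delta z (fun=> 1)) // zI mulr1.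
Qed.

End Sums.

Section Reindexing.
Variables (T U : eqType).

Lemma sum_fiber (s : seq T) (I : seq U) (h : T -> U) (F : T -> R) :
  uniq I -> (forall x, x \in s -> h x \in I) ->
  \sum_(x <- s) F x = \sum_(z <- I) \sum_(x <- s) (h x == z)%:R * F x.
Proof.
move=> uI hI; rewrite exchange_big /=; apply: eq_sums => x xs.
by rewrite -mulr_suml sum_delta1 ?mul1r //; apply: hI.
Qed.

(** [I] has to contain [h x] only where [F] does not vanish. So a sum over an arbitrary family of
    differences or quotients can be compared with an energy, which is summed over the realised ones
    only. *)
Lemma sum_inj (s : seq T) (I : seq U) (h : T -> U) (F : U -> R) :
  uniq s -> uniq I -> {in s &, injective h} ->
  (forall z, z \in I -> 0 <= F z) ->
  (forall x, x \in s -> F (h x) != 0 -> h x \in I) ->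
  \sum_(x <- s) F (h x) <= \sum_(z <- I) F z.
Proof.
move=> us uI hinj F0 hI.
have -> : \sum_(x <- s) F (h x) = \sum_(z <- [seq z <- map h s | z \in I]) F z.
  rewrite big_filter big_map [RHS]big_mkcond /=; apply: eq_sums => x xs.
  case: ifPn => // hx; apply: contraNeq hx; exact: hI.
have : perm_eq [seq z <- map h s | z \in I] [seq z <- I | z \in map h s].
  apply: uniq_perm; rewrite ?filter_uniq ?map_inj_in_uniq //.
  by move=> z; rewrite !mem_filter andbC.
move=> /(perm_big _) -> /=; rewrite big_filter.
rewrite [leRHS](bigID (fun z => z \in map h s)) /= lerDl.
by apply: sumr_ge0s.
Qed.

Lemma count_inj (s : seq T) (I : seq U) (P : pred T) (Q : pred U) (h : T -> U) :
  uniq s -> uniq I -> {in [pred x in s | P x] &, injective h} ->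
  (forall x, x \in s -> P x -> h x \in I /\ Q (h x)) ->
  (count P s <= count Q I)%N.
Proof.
move=> us uI hinj hQ; rewrite -!size_filter -(size_map h).
apply: uniq_leq_size.
  rewrite map_inj_in_uniq ?filter_uniq // => x y.
  rewrite !mem_filter => /andP[Px xs] /andP[Py ys]; apply: hinj; by rewrite inE ?xs ?ys.
move=> z /mapP[x]; rewrite mem_filter => /andP[Px xs] ->.
by rewrite mem_filter; have [-> ->] := hQ x xs Px.
Qed.

Lemma exists_ge_mean (s : seq T) (f g : T -> R) :
  \sum_(x <- s) f x < \sum_(x <- s) g x -> exists2 x, x \in s & f x < g x.
Proof.
move=> fg; have : has (fun x => f x < g x) s.
  apply: contraTT fg => /hasPn H; rewrite -leNgt; apply: ler_sums => x /H.
  by rewrite -leNgt.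
by move=> /hasP.
Qed.

Lemma pigeonhole (J : finType) (s : seq T) (key : T -> J) (F : T -> R) :
  (0 < #|J|)%N ->
  exists j, \sum_(x <- s) F x <= #|J|%:R * \sum_(x <- s | key x == j) F x.
Proof.
move=> J0; apply: contrapT => /forallNP H.
have j0 : J by case: (pickP (mem J)) => [j _|/eq_card0 e]; [exact: j | rewrite e in J0].
have : \sum_(j : J) (#|J|%:R * \sum_(x <- s | key x == j) F x) < \sum_(j : J) \sum_(x <- s) F x.
  apply: ltr_sum => [|j _]; last by have /negP := H j; rewrite -ltNge.
  by apply/hasP; exists j0 => //; rewrite mem_index_enum.
rewrite -mulr_sumr sumr_const mulr_natl.
rewrite (exchange_big_dep xpredT) //= (eq_bigr F) ?ltxx // => x _.
by rewrite (big_pred1 (key x)) // => j; rewrite eq_sym.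
Qed.

End Reindexing.

Section Dyadic.
Variable T : eqType.

Lemma trunc_log_lt (n L : nat) : (0 < n)%N -> (n < 2 ^ L)%N -> (trunc_log 2 n < L)%N.
Proof.
move=> n0 nL; have /andP[h _] := trunc_log_bounds (isT : (1 < 2)%N) n0.
by rewrite -(ltn_exp2l _ _ (isT : (1 < 2)%N)); apply: leq_ltn_trans nL.
Qed.

(** Sort [x] by the binary logarithm of [f x] and keep the class that contributes most; in it [f x]
    is known up to a factor 2, which costs [2 ^+ p]. *)
Lemma dyadic (s : seq T) (f : T -> nat) (L p : nat) :
  (0 < p)%N -> (0 < L)%N -> (forall x, x \in s -> (f x < 2 ^ L)%N) ->
  exists2 j : nat, (j < L)%N & \sum_(x <- s) (f x)%:R ^+ p <=
    L%:R * (2 ^+ p * (2 ^+ j) ^+ p *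
            (count (fun x => (2 ^ j <= f x < 2 ^ j.+1)%N) s)%:R) :> R.
Proof.
move=> p0; case: L => // L _ fL.
have [|j Hj] := @pigeonhole T 'I_L.+1 s (fun x => inord (trunc_log 2 (f x)))
  (fun x => (f x)%:R ^+ p); first by rewrite card_ord.
exists j => //; apply: le_trans Hj _; rewrite card_ord ler_wpM2l //.
rewrite count_sum mulr_sumr big_mkcond /=; apply: ler_sums => x xs.
case: ifPn => [/eqP e|_]; last by rewrite mulr_ge0 // mulr_ge0 // !exprn_ge0.
(* Zero lies in no dyadic interval, but its key is harmless: it contributes nothing because
   [0 < p]. *)
have [->|fx0] := posnP (f x).
  rewrite expr0n (gtn_eqF p0) /= mulr_ge0 // mulr_ge0 // !exprn_ge0 //.
have e' : trunc_log 2 (f x) = j by rewrite -e inordK // trunc_log_lt // fL.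
have /andP[h1 h2] := trunc_log_bounds (isT : (1 < 2)%N) fx0.
rewrite e' in h1 h2; rewrite h1 h2 mulr1 -exprMn ler_pXn2r ?nnegrE //.
  by rewrite -exprS -natrX ler_nat ltnW.
by rewrite mulr_ge0 // exprn_ge0.
Qed.

End Dyadic.

(** * The quaternion ring *)

Arguments Quat (_ _ _ _)%_ring_scope.

Lemma quat_eq (x y : quat) : qre x = qre y -> qi x = qi y -> qj x = qj y ->
  qk x = qk y -> x = y.
Proof. by case: x y => a b c d [a' b' c' d'] /= -> -> -> ->. Qed.

Definition qopp (x : quat) : quat := Quat (- qre x) (- qi x) (- qj x) (- qk x).
Definition qzero : quat := Quat 0 0 0 0.
Definition qone : quat := Quat 1 0 0 0.

(* Locked, so that boolean rewriting never looks inside an equality test. *)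
Definition quat_eqb : rel quat := locked (fun x y => is_left (quat_eq_dec x y)).

Lemma quat_eqP : Equality.axiom quat_eqb.
Proof. by move=> x y; rewrite /quat_eqb -lock; case: quat_eq_dec => h; constructor. Qed.

HB.instance Definition _ := hasDecEq.Build quat quat_eqP.
HB.instance Definition _ := gen_choiceMixin quat.

Lemma qaddA : associative qadd.
Proof. by move=> x y z; apply: quat_eq; rewrite /= !RealsE addrA. Qed.
Lemma qaddC : commutative qadd.
Proof. by move=> x y; apply: quat_eq; rewrite /= !RealsE addrC. Qed.
Lemma qadd0 : left_id qzero qadd.
Proof. by move=> x; apply: quat_eq; rewrite /= !RealsE add0r. Qed.
Lemma qaddN : left_inverse qzero qopp qadd.
Proof. by move=> x; apply: quat_eq; rewrite /= !RealsE addNr. Qed.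

HB.instance Definition _ := GRing.isZmodule.Build quat qaddA qaddC qadd0 qaddN.

Lemma qmulA : associative qmul.
Proof. by move=> x y z; apply: quat_eq; rewrite /= !RealsE; ring. Qed.
Lemma qmul1 : left_id qone qmul.
Proof. by move=> x; apply: quat_eq; rewrite /= !RealsE; ring. Qed.
Lemma qmulr1 : right_id qone qmul.
Proof. by move=> x; apply: quat_eq; rewrite /= !RealsE; ring. Qed.
Lemma qmulDl : left_distributive qmul qadd.
Proof. by move=> x y z; apply: quat_eq; rewrite /= !RealsE; ring. Qed.
Lemma qmulDr : right_distributive qmul qadd.
Proof. by move=> x y z; apply: quat_eq; rewrite /= !RealsE; ring. Qed.
Lemma qone_neq0 : qone != 0.
Proof. by apply/eqP => -[] /eqP; rewrite oner_eq0. Qed.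

HB.instance Definition _ := GRing.Zmodule_isNzRing.Build quat
  qmulA qmul1 qmulr1 qmulDl qmulDr qone_neq0.

Definition qnorm (x : quat) : R := qre x ^+ 2 + qi x ^+ 2 + qj x ^+ 2 + qk x ^+ 2.
Definition qdot (x y : quat) : R :=
  qre x * qre y + qi x * qi y + qj x * qj y + qk x * qk y.

Lemma qreD (x y : quat) : qre (x + y) = qre x + qre y. Proof. by []. Qed.
Lemma qiD (x y : quat) : qi (x + y) = qi x + qi y. Proof. by []. Qed.
Lemma qjD (x y : quat) : qj (x + y) = qj x + qj y. Proof. by []. Qed.
Lemma qkD (x y : quat) : qk (x + y) = qk x + qk y. Proof. by []. Qed.
Lemma qreN (x : quat) : qre (- x) = - qre x. Proof. by []. Qed.
Lemma qiN (x : quat) : qi (- x) = - qi x. Proof. by []. Qed.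
Lemma qjN (x : quat) : qj (- x) = - qj x. Proof. by []. Qed.
Lemma qkN (x : quat) : qk (- x) = - qk x. Proof. by []. Qed.
Definition qDN := (qreD, qiD, qjD, qkD, qreN, qiN, qjN, qkN).

Lemma qnorm_ge0 x : 0 <= qnorm x.
Proof. by rewrite !addr_ge0 // sqr_ge0. Qed.

Lemma qnorm_eq0 x : (qnorm x == 0) = (x == 0).
Proof.
apply/eqP/eqP => [|->]; last by rewrite /qnorm /= !expr2 !mul0r !addr0.
rewrite /qnorm => /eqP; rewrite !paddr_eq0 ?addr_ge0 ?sqr_ge0 // !sqrf_eq0.
by case/andP => /andP[/andP[/eqP ? /eqP ?] /eqP ?] /eqP ?; apply: quat_eq.
Qed.

Lemma qnorm_gt0 x : (0 < qnorm x) = (x != 0).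
Proof. by rewrite lt_neqAle qnorm_ge0 andbT eq_sym qnorm_eq0. Qed.

Lemma qnormM (x y : quat) : qnorm (x * y) = qnorm x * qnorm y.
Proof. by rewrite /qnorm /= !RealsE; ring. Qed.

Lemma qnormN (x : quat) : qnorm (- x) = qnorm x.
Proof. by rewrite /qnorm !qDN !sqrrN. Qed.

Lemma qnormB (x y : quat) : qnorm (x - y) = qnorm (y - x).
Proof. by rewrite -qnormN opprB. Qed.

Lemma qnormD (x y : quat) : qnorm (x + y) = qnorm x + qnorm y + 2 * qdot x y.
Proof. by rewrite /qnorm /qdot !qDN; ring. Qed.

Definition qinv (x : quat) : quat :=
  Quat (qre x / qnorm x) (- qi x / qnorm x) (- qj x / qnorm x) (- qk x / qnorm x).

Lemma qmulVx (x : quat) : x != 0 -> qinv x * x = 1.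
Proof.
rewrite -qnorm_eq0 => h; have e : 1 = qnorm x / qnorm x by rewrite divff.
apply: quat_eq; rewrite /= !RealsE ?[RHS]e /qnorm; field.
all: exact: h.
Qed.
Lemma qmulxV (x : quat) : x != 0 -> x * qinv x = 1.
Proof.
rewrite -qnorm_eq0 => h; have e : 1 = qnorm x / qnorm x by rewrite divff.
apply: quat_eq; rewrite /= !RealsE ?[RHS]e /qnorm; field.
all: exact: h.
Qed.

Definition qunit : pred quat := fun x => x != 0.
Lemma qmulVr : {in qunit, left_inverse 1 qinv *%R}.
Proof. by move=> x; exact: qmulVx. Qed.
Lemma qmulrV : {in qunit, right_inverse 1 qinv *%R}.
Proof. by move=> x; exact: qmulxV. Qed.
Lemma qunitP (x y : quat) : y * x = 1 /\ x * y = 1 -> qunit x.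
Proof.
move=> [e _]; apply/eqP => x0; move: e; rewrite x0 mulr0 => /esym/eqP.
by rewrite oner_eq0.
Qed.
Lemma qinv_out : {in [predC qunit], qinv =1 id}.
Proof.
move=> x; rewrite inE negbK => /eqP ->.
by apply: quat_eq; rewrite /= ?oppr0 mul0r.
Qed.

HB.instance Definition _ := GRing.NzRing_hasMulInverse.Build quat
  qmulVr qmulrV qunitP qinv_out.

Lemma qunitE (x : quat) : (x \is a GRing.unit) = (x != 0).
Proof. by []. Qed.

Lemma qmulf_eq0 (x y : quat) : (x * y == 0) = (x == 0) || (y == 0).
Proof. by rewrite -!qnorm_eq0 qnormM mulf_eq0. Qed.

(** * Kissing and rich lines *)

(** Half-open intervals of length 1/2 on [-1, 1]; the fifth one is there for the endpoint 1
    alone. *)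
Definition cell (a : R) : 'I_5 := inord (Num.truncn ((a + 1) * 2)).

Lemma cell_close (a b : R) : a ^+ 2 <= 1 -> b ^+ 2 <= 1 -> cell a = cell b ->
  (a - b) ^+ 2 < 1 / 4.
Proof.
have aux (x : R) : x ^+ 2 <= 1 -> [/\ 0 <= (x + 1) * 2,
    (Num.truncn ((x + 1) * 2))%:R <= (x + 1) * 2,
    (x + 1) * 2 < (Num.truncn ((x + 1) * 2)).+1%:R & (Num.truncn ((x + 1) * 2) < 5)%N].
  move=> x1; have x0 : 0 <= (x + 1) * 2 by nra.
  have /andP[h1 h2] := truncn_itv x0; split => //.
  by rewrite -(ltr_nat R); apply: le_lt_trans h1 _; nra.
move=> /aux[a0 a1 a2 a3] /aux[b0 b1 b2 b3] /(congr1 (@nat_of_ord 5)).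
rewrite !inordK // => e; rewrite e in a1 a2.
rewrite -addn1 natrD in a2; rewrite -addn1 natrD in b2; nra.
Qed.

Definition dir (v : quat) : 'I_5 * 'I_5 * 'I_5 * 'I_5 :=
  let s := Num.sqrt (qnorm v) in
  (cell (qre v / s), cell (qi v / s), cell (qj v / s), cell (qk v / s)).

(** The coordinates of the two unit vectors differ by less than 1/2, so the unit vectors are at
    distance less than 1 and their inner product [p] exceeds 1/2. With lengths [s <= t] this gives
    [s^2 + t^2 - 2 s t p < s^2 + t^2 - s t <= t^2]. *)
Lemma dir_close (u v : quat) : u != 0 -> v != 0 -> dir u = dir v ->
  qnorm u <= qnorm v -> qnorm (u - v) < qnorm v.
Proof.
have aux (w : quat) : w != 0 -> exists2 s : R, 0 < s &
    let: (a, b, c, d) := (qre w / s, qi w / s, qj w / s, qk w / s) in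
    [/\ a ^+ 2 + b ^+ 2 + c ^+ 2 + d ^+ 2 = 1,
        qre w = s * a /\ qi w = s * b, qj w = s * c /\ qk w = s * d,
        qnorm w = s ^+ 2 & dir w = (cell a, cell b, cell c, cell d)].
  rewrite -qnorm_gt0 => w0; exists (Num.sqrt (qnorm w)); first by rewrite sqrtr_gt0.
  have s0 : Num.sqrt (qnorm w) != 0 by rewrite sqrtr_eq0 -ltNge.
  have e : Num.sqrt (qnorm w) ^+ 2 = qnorm w by rewrite sqr_sqrtr // qnorm_ge0.
  split; rewrite ?e //; last 2 first.
  - by split; rewrite mulrC divfK.
  - by split; rewrite mulrC divfK.
  rewrite !expr_div_n e -!mulrDl -/(qnorm w) divff //; exact: lt0r_neq0.
move=> /aux[s s0 [h1 [h2 h3] [h4 h5] h6 ->]] /aux[t t0 [g1 [g2 g3] [g4 g5] g6 ->]].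
move: h1 h2 h3 h4 h5 g1 g2 g3 g4 g5.
set a := qre u / s; set b := qi u / s; set c := qj u / s; set d := qk u / s.
set a' := qre v / t; set b' := qi v / t; set c' := qj v / t; set d' := qk v / t.
move=> h1 h2 h3 h4 h5 g1 g2 g3 g4 g5 [].
move=> /cell_close ca /cell_close cb /cell_close cc /cell_close cd.
have st : qnorm u <= qnorm v -> s <= t.
  by rewrite h6 g6 ler_pXn2r // nnegrE ltW.
move=> /st {}st.
have {}ca := ca ltac:(nra) ltac:(nra); have {}cb := cb ltac:(nra) ltac:(nra).
have {}cc := cc ltac:(nra) ltac:(nra); have {}cd := cd ltac:(nra) ltac:(nra).
pose p := a * a' + b * b' + c * c' + d * d'.
have p1 : 1 < 2 * p by rewrite /p; nra.
rewrite g6 qnormD h6 qnormN g6.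
have -> : qdot u (- v) = - (s * t * p).
  by rewrite /qdot !qDN h2 h3 h4 h5 g2 g3 g4 g5 /p; ring.
have : s * t * 1 < s * t * (2 * p) by rewrite ltr_pM2l // mulr_gt0.
have : s * s <= s * t by rewrite ler_pM2l.
by rewrite !expr2; lra.
Qed.

Lemma card_dir : #|{: 'I_5 * 'I_5 * 'I_5 * 'I_5}| = 625%N.
Proof. by rewrite !card_prod !card_ord. Qed.

(* Two points in the same direction cell are closer to each other than the farther
   of them is to the origin, so there is at most one point in each of the 5^4 cells. *)
Lemma kissing (T : eqType) (s : seq T) (v : T -> quat) : uniq s ->
  (forall x, x \in s -> v x != 0) ->
  (forall x y, x \in s -> y \in s -> x != y -> qnorm (v x) <= qnorm (v y) ->
     qnorm (v y) <= qnorm (v x - v y)) ->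
  (size s <= 625)%N.
Proof.
move=> us v0 vP.
have inj : {in s &, injective (dir \o v)}.
  move=> x y xs ys /= e; apply/eqP; apply: contraT => xy.
  wlog le : x y xs ys e xy / qnorm (v x) <= qnorm (v y).
    move=> W; have [|/ltW] := leP (qnorm (v x)) (qnorm (v y)); first exact: W.
    by apply: (W y x) => //; rewrite eq_sym.
  have := vP _ _ xs ys xy le; rewrite leNgt dir_close //; exact: v0.
rewrite -card_dir cardT -(size_map (dir \o v)).
apply: uniq_leq_size; first by rewrite map_inj_in_uniq.
by move=> z _; rewrite mem_enum.
Qed.

Section Counting.
Variables (T U V : eqType).

Lemma size_pairs (s : seq T) (t : T -> seq U) :
  size [seq (x, y) | x <- s, y <- t x] = \sum_(x <- s) size (t x).
Proof. by rewrite size_allpairs_dep sumnE big_map. Qed.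

Lemma mem_pairs (s : seq T) (t : T -> seq U) x y :
  ((x, y) \in [seq (x, y) | x <- s, y <- t x]) = (x \in s) && (y \in t x).
Proof.
apply/allpairsPdep/andP => [[a [b [? ? [-> ->]]]] // | [? ?]]; by exists x, y.
Qed.

Lemma uniq_pairs (s : seq T) (t : T -> seq U) : uniq s ->
  (forall x, x \in s -> uniq (t x)) -> uniq [seq (x, y) | x <- s, y <- t x].
Proof.
move=> us ut; apply: allpairs_uniq_dep => //.
move=> [x y] [x' y'] _ _ /= [e1 e2]; move: e1 e2 => -> ->; done.
Qed.

Lemma seq_argmin (s : seq T) (f : T -> R) : s != [::] ->
  exists2 x, x \in s & forall y, y \in s -> f x <= f y.
Proof.
elim: s => // a s IH _; have [->|/IH[x xs xP]] := eqVneq s [::].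
  by exists a; rewrite ?mem_head // => y; rewrite inE => /eqP ->.
have [ax|xa] := leP (f a) (f x).
  exists a; rewrite ?mem_head // => y; rewrite inE => /orP[/eqP -> //|/xP].
  exact: le_trans.
exists x; rewrite ?inE ?xs ?orbT // => y; rewrite inE => /orP[/eqP ->|/xP //].
exact: ltW.
Qed.

End Counting.

Lemma seq_argmax (T : eqType) (s : seq T) (f : T -> R) : s != [::] ->
  exists2 x, x \in s & forall y, y \in s -> f y <= f x.
Proof.
move=> /(seq_argmin (fun x => - f x))[x xs xP]; exists x => // y /xP.
by rewrite lerN2.
Qed.

Definition nearer (X : seq quat) (x w : quat) : nat :=
  count (fun a => qnorm (a - x) <= qnorm (w - x)) X.

(** [nearer] is a rank by distance from [x]. Take the farthest among the points of rank at most
    [M / k]: all the others count in its rank. *)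
Lemma few_near (X : seq quat) (x : quat) (k M : nat) : uniq X ->
  (k * count (fun w => k * nearer X x w <= M)%N X <= M)%N.
Proof.
move=> uX; rewrite -size_filter; set W := filter _ _.
have [->|/(seq_argmax (fun w => qnorm (w - x)))[w wW wP]] := eqVneq W [::].
  by rewrite muln0.
have := wW; rewrite mem_filter => /andP[h _]; apply: leq_trans h.
rewrite leq_mul2l; apply/orP; right.
rewrite /nearer -size_filter; apply: uniq_leq_size; first by rewrite filter_uniq.
move=> a aW; rewrite mem_filter wP //=.
by move: aW; rewrite mem_filter => /andP[].
Qed.

Lemma sum_nat_leC (T : eqType) (s : seq T) (f : T -> nat) (c : nat) :
  (forall x, x \in s -> f x <= c)%N -> (\sum_(x <- s) f x <= size s * c)%N.
Proof.
move=> fc; apply: (@leq_trans (\sum_(x <- s) c)).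
  by rewrite big_seq [leqRHS]big_seq; apply: leq_sum.
by rewrite big_const_seq count_predT iter_addn_0 mulnC.
Qed.

(** Exchange the sums. A point [a] counts for at most one [x] with [p x = a]; for the other [x] the
    vectors [a - p x] satisfy the hypothesis of [kissing], since [a] is no farther from [p x] than
    the nearest other [p w] is. Hence [626 = 1 + 625]. *)
Lemma sum_near (T : eqType) (I : seq T) (p : T -> quat) (nn : T -> T) (X : seq quat) :
  uniq I -> uniq X -> {in I &, injective p} ->
  (forall x w, x \in I -> w \in I -> w != x ->
     qnorm (p (nn x) - p x) <= qnorm (p w - p x)) ->
  (\sum_(x <- I) nearer X (p x) (p (nn x)) <= 626 * size X)%N.
Proof.
move=> uI uX pinj nnP; rewrite /nearer.
under eq_bigr => x _ do rewrite -sum1_count big_mkcond.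
rewrite exchange_big /= mulnC; apply: sum_nat_leC => a aX.
rewrite -big_mkcond sum1_count -size_filter; set J := filter _ _.
have uJ : uniq J by rewrite filter_uniq.
rewrite -(count_predC (fun x => p x == a)) -[626%N]/(1 + 625)%N leq_add //.
  rewrite -size_filter.
  have -> : 1%N = size [:: a] by []; rewrite -(size_map p).
  apply: uniq_leq_size => [|z /mapP[x]].
    rewrite map_inj_in_uniq ?filter_uniq // => x y.
    by rewrite !mem_filter => /and3P[_ _ xI] /and3P[_ _ yI]; apply: pinj.
  by rewrite mem_filter => /andP[/eqP <- _] ->; rewrite inE.
rewrite -size_filter; apply: (@kissing _ _ (fun x => a - p x)).
- by rewrite filter_uniq.
- by move=> x; rewrite mem_filter /= subr_eq0 eq_sym => /andP[].
move=> x y; rewrite !mem_filter /= => /and3P[xa hx xI] /and3P[ya hy yI] xy _.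
apply: le_trans hy _; apply: le_trans (nnP y x yI xI xy) _.
have -> : a - p x - (a - p y) = p y - p x by rewrite opprB addrC addrA subrK.
by rewrite qnormB.
Qed.

Lemma choose_on (T : eqType) (L : seq T) (P : T -> T -> Prop) :
  (forall x, x \in L -> exists y, P x y) -> exists f, forall x, x \in L -> P x (f x).
Proof.
move=> H; have [x|f fP] := @choice _ _ (fun x y => x \in L -> P x y); last by exists f.
by have [/H[y Py]|xL] := boolP (x \in L); [exists y | exists x].
Qed.

Lemma nn_exists (L : seq quat) : uniq L -> (2 <= size L)%N ->
  exists nn : quat -> quat, forall x, x \in L ->
    [/\ nn x \in L, nn x != x &
     forall w, w \in L -> w != x -> qnorm (nn x - x) <= qnorm (w - x)].
Proof.
move=> uL L2; apply: (@choose_on _ L (fun x y => [/\ y \in L, y != x &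
  forall w, w \in L -> w != x -> qnorm (y - x) <= qnorm (w - x)])) => x xL.
have : rem x L != [::] by rewrite -size_eq0 size_rem // -lt0n -subn1 subn_gt0.
move=> /(seq_argmin (fun w => qnorm (w - x)))[y]; rewrite mem_rem_uniq // inE /=.
move=> /andP[yx yL] yP; exists y; split => // w wL wx.
by apply: yP; rewrite mem_rem_uniq // inE /= wx.
Qed.

(** Markov's inequality for [f] and for [g]: each excludes at most [k / 4] elements. *)
Lemma good_half (L : seq quat) (f g : quat -> nat) (k N1 N2 : nat) :
  (0 < N1)%N -> (0 < N2)%N -> (k <= size L)%N ->
  (\sum_(x <- L) f x <= N1)%N -> (\sum_(x <- L) g x <= N2)%N ->
  (k <= 2 * count (fun x => (k * f x <= 4 * N1)%N && (k * g x <= 4 * N2)%N) L)%N.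
Proof.
move=> N10 N20 kL.
have aux (h : quat -> nat) (N : nat) : (0 < N)%N -> (\sum_(x <- L) h x <= N)%N ->
   (4 * count (fun x => ~~ (k * h x <= 4 * N)%N) L <= k)%N.
  move=> N0 hN; rewrite -(leq_pmul2r N0); apply: (@leq_trans (k * \sum_(x <- L) h x)).
    rewrite -mulnA [(count _ _ * _)%N]mulnC mulnA -sum1_count big_distrr /= big_mkcond big_distrr /=.
    by apply: leq_sum => x _; case: ifPn => //; rewrite -ltnNge muln1 => /ltnW.
  by rewrite leq_mul2l hN orbT.
move=> /(aux _ _ N10) a1 /(aux _ _ N20) a2.
set G := fun x : quat => _; rewrite -(count_predC G L) in kL.
have : (count (predC G) L <= count (fun x => ~~ (k * f x <= 4 * N1)%N) L +
    count (fun x => ~~ (k * g x <= 4 * N2)%N) L)%N.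
  rewrite -count_predUI; apply: (@leq_trans (count (predU (fun x => ~~ (k * f x <= 4 * N1)%N) (fun x => ~~ (k * g x <= 4 * N2)%N)) L)); last by rewrite leq_addr.
  by apply: sub_count => x; rewrite /= /G negb_and.
by lia.
Qed.

Lemma addrDBr (V : zmodType) (x w t : V) : (x + t) - (w + t) = x - w.
Proof. by rewrite opprD addrACA subrr addr0. Qed.

Lemma affine_inj (x w u c x' w' u' c' : quat) :
  c != 0 -> x != w -> x = x' -> w = w' ->
  (x + u) * c = (x' + u') * c' -> (w + u) * c = (w' + u') * c' -> (u, c) = (u', c').
Proof.
move=> c0 xw <- <- e1 e2.
have ec : c = c'.
  have : (x - w) * c = (x - w) * c'.
    have e (t d : quat) : (x - w) * d = (x + t) * d - (w + t) * d.
      by rewrite -mulrBl addrDBr.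
    by rewrite (e u c) (e u' c') e1 e2.
  by apply: (@mulrI quat); rewrite qunitE subr_eq0.
rewrite -ec in e1 *; congr (_, _).
by move/(@mulIr quat c): e1 => /(_ c0) /addrI.
Qed.

(* Szemeredi-Trotter for Cartesian products: pair each point of a line with its
   nearest neighbour on the line. By kissing, for most points of a k-rich line the
   neighbour is, in each coordinate, among the O(|X_i|/k) nearest ones, and a line is
   determined by two of its points. *)
Lemma rich_lines (X1 X2 : seq quat) (Lam : seq (quat * quat)) (k : nat) :
  uniq X1 -> uniq X2 -> uniq Lam -> (2 <= k)%N ->
  (forall l, l \in Lam -> l.2 != 0 /\
     (k <= count (fun x => ((x + l.1) * l.2)%R \in X2) X1)%N) ->
  (size Lam * k ^ 3 <= 2 * (2504 * size X1) ^ 2 * (2504 * size X2) ^ 2)%N.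
Proof.
move=> u1 u2 uL k2 LamP.
(* By [sum_near] the ranks of the neighbours on a line sum to at most [626 |X1|]; the further factor
   4 is the Markov threshold of [good_half], whence [2504 = 4 * 626]. *)
pose G1 x w := (k * nearer X1 x w <= 4 * (626 * size X1))%N.
pose G2 x w := (k * nearer X2 x w <= 4 * (626 * size X2))%N.
pose on (l : quat * quat) := [seq x <- X1 | (x + l.1) * l.2 \in X2].
have onP l x : x \in on l = ((x + l.1) * l.2 \in X2) && (x \in X1).
  by rewrite mem_filter.
have uon l : uniq (on l) by rewrite filter_uniq.
have [nn nnP] : exists nn : quat * quat -> quat -> quat, forall l, l \in Lam ->
  forall x, x \in on l -> [/\ nn l x \in on l, nn l x != x &
     forall w, w \in on l -> w != x -> qnorm (nn l x - x) <= qnorm (w - x)].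
  have [l|nn nnP] := @choice _ _ (fun l f => l \in Lam -> forall x, x \in on l ->
     [/\ f x \in on l, f x != x & forall w, w \in on l -> w != x ->
        qnorm (f x - x) <= qnorm (w - x)]); last by exists nn.
  have [/LamP[_ lk]|lL] := boolP (l \in Lam); last by exists id.
  have [|f fP] := @nn_exists (on l) (uon l); last by exists f.
  by rewrite size_filter; apply: leq_trans lk.
pose good (l : quat * quat) x := G1 x (nn l x) && G2 ((x + l.1) * l.2) ((nn l x + l.1) * l.2).
pose P1 := [seq (x, w) | x <- X1, w <- [seq w <- X1 | G1 x w]].
pose P2 := [seq (x, w) | x <- X2, w <- [seq w <- X2 | G2 x w]].
have sP (X : seq quat) : uniq X -> (k * size [seq (x, w) | x <- X, w <- [seq w <- X |
     (k * nearer X x w <= 4 * (626 * size X))%N]] <= size X * (2504 * size X))%N.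
  move=> uX; rewrite size_pairs big_distrr /=; apply: sum_nat_leC => x _.
  by rewrite size_filter; have := few_near x k (4 * (626 * size X)) uX; rewrite mulnA.
pose In := [seq (l, x) | l <- Lam, x <- [seq x <- on l | good l x]].
have uIn : uniq In by apply: uniq_pairs => // l _; rewrite !filter_uniq.
have h1 : (size Lam * k <= 2 * size In)%N.
  rewrite size_pairs big_distrr /=.
  have -> : (size Lam * k = \sum_(l <- Lam) k)%N.
    by rewrite big_const_seq count_predT iter_addn_0 mulnC.
  rewrite big_seq [leqRHS]big_seq; apply: leq_sum => l lL.
  have [l20 lk] := LamP l lL; rewrite size_filter /good /G1 /G2.
  have : (0 < size (on l))%N by rewrite size_filter; apply: leq_trans lk; exact: ltnW.
  case eL: (on l) => [//|x0 L0] _; have /andP[y0 x0X] : ((x0 + l.1) * l.2 \in X2) && (x0 \in X1).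
    by rewrite -onP eL mem_head.
  rewrite -{}eL; apply: good_half.
  - by rewrite muln_gt0 /=; case: (X1) x0X.
  - by rewrite muln_gt0 /=; case: (X2) y0.
  - by rewrite size_filter.
  - apply: (@sum_near _ (on l) id (nn l)) => // x w xl wl wx.
    by have [_ _ H] := nnP l lL x xl; exact: H.
  - apply: (@sum_near _ (on l) (fun x => (x + l.1) * l.2) (nn l)) => //.
      by move=> x y _ _ /(@mulIr quat l.2 l20) /addIr.
    move=> x w xl wl wx; rewrite -!mulrBl !addrDBr !qnormM ler_wpM2r ?qnorm_ge0 //.
    by have [_ _ H] := nnP l lL x xl; exact: H.
have h2 : (size In <= size P1 * size P2)%N.
  rewrite -(size_allpairs (fun a b => (a, b))).
  pose h (lx : quat * quat * quat) := ((lx.2, nn lx.1 lx.2),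
     ((lx.2 + lx.1.1) * lx.1.2, (nn lx.1 lx.2 + lx.1.1) * lx.1.2)).
  rewrite -(size_map h); apply: uniq_leq_size.
    rewrite map_inj_in_uniq // => -[l x] [l' x']; rewrite !mem_pairs => /andP[lL].
    rewrite mem_filter => /andP[_ xl] _ e.
    have e1 := congr1 (fun t => t.1.1) e; have e2 := congr1 (fun t => t.1.2) e.
    have e3 := congr1 (fun t => t.2.1) e; have e4 := congr1 (fun t => t.2.2) e.
    rewrite /h /= in e1 e2 e3 e4.
    have [_ nx _] := nnP l lL x xl; have [l20 _] := LamP l lL.
    have := @affine_inj x (nn l x) l.1 l.2 x' (nn l' x') l'.1 l'.2 l20 _ e1 e2 e3 e4.
    by rewrite eq_sym nx => /(_ isT); rewrite -!surjective_pairing => ->; rewrite e1.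
  move=> z /mapP[[l x]]; rewrite !mem_pairs mem_filter => /and3P[lL /andP[g1 g2] xl] ->.
  have [nl _ _] := nnP l lL x xl.
  rewrite /h /= allpairs_f // mem_pairs mem_filter; move: xl nl; rewrite !onP.
    by move=> /andP[_ ->] /andP[_ ->]; rewrite g1.
  by move=> /andP[-> _] /andP[-> _]; rewrite g2.
have := leq_mul (sP X1 u1) (sP X2 u2); rewrite -/P1 -/P2 => h3.
move: h1 h2 h3; move: (size In) (size P1) (size P2) (size Lam) (size X1) (size X2).
move=> a b c d e f h1 h2 h3.
apply: (@leq_trans (2 * (k * b * (k * c)))); last by nia.
apply: (@leq_trans (2 * a * k ^ 2)); first by rewrite (expnD k 1 2) mulnA leq_mul2r h1 orbT.
by rewrite mulnACA -mulnA leq_mul2l /= mulnC leq_mul2l h2 orbT.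
Qed.

Ltac qring := apply: quat_eq; rewrite /= ?RealsE; ring.

Lemma k_smallest (T : eqType) (S : seq T) (f : T -> R) (M : nat) :
  uniq S -> (M <= size S)%N ->
  exists N : seq T, [/\ uniq N, {subset N <= S}, size N = M &
    forall y w, y \in N -> w \in S -> f w < f y -> w \in N].
Proof.
move=> uS; elim: M => [|M IH] MS; first by exists [::].
have [N [uN NS sN NP]] := IH (ltnW MS).
have : [seq x <- S | x \notin N] != [::].
  apply: contraTneq MS => e; rewrite -leqNgt -sN; apply: uniq_leq_size => // x xS.
  apply: contraT => xN; have : x \in [seq x <- S | x \notin N] by rewrite mem_filter xN.
  by rewrite e.
move=> /(seq_argmin f)[y]; rewrite mem_filter => /andP[yN yS] yP.
exists (y :: N); split => /=.
- by rewrite yN.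
- by move=> x; rewrite inE => /orP[/eqP ->|/NS].
- by rewrite sN.
move=> z w zN wS fw; rewrite inE; have [//|wy /=] := eqVneq w y.
apply: contraT => wN; move: zN; rewrite inE => /orP[/eqP ez|zN].
  by move: fw; rewrite ez ltNge yP // mem_filter wN.
by rewrite (NP z w) in wN.
Qed.

(** * Collisions of slope vectors *)

Definition acute (U : seq quat) : Prop :=
  0 \notin U /\ forall u v, u \in U -> v \in U -> 0 <= qdot u v.

Lemma acute_norm U c d : acute U -> c \in U -> d \in U -> qnorm d <= qnorm (c + d).
Proof.
move=> [_ UP] cU dU; rewrite qnormD; have := UP c d cU dU; have := qnorm_ge0 c; lra.
Qed.

Lemma acute_neq0 U d : acute U -> d \in U -> d != 0.
Proof. by move=> [U0 _] dU; apply: contraNneq U0 => <-. Qed.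

Lemma acute_add U c d : acute U -> c \in U -> d \in U -> c + d != 0.
Proof.
move=> aU cU dU; rewrite -qnorm_gt0; apply: lt_le_trans (acute_norm aU cU dU).
by rewrite qnorm_gt0 (acute_neq0 aU).
Qed.

Lemma qinv_eq0 (u : quat) : (u^-1 == 0) = (u == 0).
Proof. by apply: negb_inj; rewrite -!qunitE unitrV. Qed.

Lemma qnormV u : u != 0 -> qnorm u^-1 = (qnorm u)^-1.
Proof.
move=> u0; apply: (@mulIf _ (qnorm u)); first by rewrite qnorm_eq0.
by rewrite -qnormM mulVr // mulVf ?qnorm_eq0 // /qnorm /= expr1n expr0n /= !addr0.
Qed.

Lemma slope_between U c d x y : acute U -> c \in U -> d \in U -> x != y ->
  let z := (c + d)^-1 * (c * x + d * y) in z - x != 0 /\ qnorm (z - x) <= qnorm (y - x).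
Proof.
move=> aU cU dU xy z; have cd := acute_add aU cU dU.
have -> : z - x = (c + d)^-1 * d * (y - x).
  rewrite -[X in z - X](mulKr (x := c + d)) // /z -mulrBr -mulrA; congr (_ * _); qring.
split; first by rewrite !qmulf_eq0 !negb_or qinv_eq0 cd (acute_neq0 aU) //= subr_eq0 eq_sym.
rewrite !qnormM qnormV //; apply: ler_piMl; first exact: qnorm_ge0.
by rewrite mulrC ler_pdivrMr ?qnorm_gt0 // mul1r (acute_norm aU).
Qed.

Lemma two_slopes (c d c' d' x y : quat) : x != y ->
  c + d = c' + d' -> c * x + d * y = c' * x + d' * y -> c = c' /\ d = d'.
Proof.
move=> xy e1 e2.
have : (d - d') * (y - x) = 0.
  transitivity ((c * x + d * y) - (c' * x + d' * y) - ((c + d) - (c' + d')) * x); first qring.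
  by rewrite e1 e2 !subrr mul0r subrr.
move/eqP; rewrite qmulf_eq0 !subr_eq0 [y == x]eq_sym (negPf xy) orbF => /eqP e.
by move: e1; rewrite e => /addIr.
Qed.

Lemma sum_fiber_nat (T U : eqType) (s : seq T) (I : seq U) (h : T -> U) (F : T -> nat) :
  uniq I -> (forall x, x \in s -> h x \in I) ->
  (\sum_(x <- s) F x = \sum_(z <- I) \sum_(x <- s | h x == z) F x)%N.
Proof.
move=> uI hI; rewrite (exchange_big_dep xpredT) //= big_seq [RHS]big_seq.
apply: eq_bigr => x /hI xI; under eq_bigl do rewrite eq_sym.
by rewrite -big_filter filter_pred1_uniq // big_seq1.
Qed.

Lemma count_fiber (T U : eqType) (s : seq T) (I : seq U) (h : T -> U) :
  uniq I -> (forall x, x \in s -> h x \in I) ->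
  (size s = \sum_(z <- I) count (fun x => h x == z) s)%N.
Proof.
move=> uI hI; rewrite -sum1_size (sum_fiber_nat _ uI hI).
by apply: eq_bigr => z _; rewrite sum1_count.
Qed.

Lemma leq_sums (T : eqType) (s : seq T) (f g : T -> nat) :
  (forall x, x \in s -> f x <= g x)%N -> (\sum_(x <- s) f x <= \sum_(x <- s) g x)%N.
Proof. by move=> fg; rewrite big_seq [leqRHS]big_seq; apply: leq_sum. Qed.

Section Cluster.
Variables (U S Sg1 Sg2 : seq quat) (Bf Nb : quat -> seq quat) (M : nat).
Hypotheses (aU : acute U) (uS : uniq S) (u1 : uniq Sg1) (u2 : uniq Sg2).
Hypothesis BU : forall x, x \in S -> {subset Bf x <= U}.
Hypothesis uB : forall x, x \in S -> uniq (Bf x).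
Hypothesis uNb : forall x, x \in S -> uniq (Nb x).
Hypothesis NbS : forall x, x \in S -> {subset Nb x <= S}.
Hypothesis Nbx : forall x, x \in S -> x \notin Nb x.
Hypothesis sNb : forall x, x \in S -> size (Nb x) = M.
Hypothesis NbP : forall x y w, x \in S -> y \in Nb x -> w \in S -> w != x ->
  qnorm (w - x) < qnorm (y - x) -> w \in Nb x.
Hypothesis Sg : forall x y c d, x \in S -> y \in S -> c \in Bf x -> d \in Bf y ->
  c + d \in Sg1 /\ c * x + d * y \in Sg2.

Let XY := [seq (x, y) | x <- S, y <- Nb x].
Let EE (p : quat * quat) := [seq (c, d) | c <- Bf p.1, d <- Bf p.2].
Let Om := [seq (p, e) | p <- XY, e <- EE p].
Let zz (o : (quat * quat) * (quat * quat)) :=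
  (o.2.1 + o.2.2, o.2.1 * o.1.1 + o.2.2 * o.1.2).
Let ze o := (zz o).1^-1 * (zz o).2.
(** The key refines the vector [zz o] by the direction in which its slope [ze o] is seen from the
    first slope. This is how the kissing argument enters, at the cost of a factor 625. *)
Let ky o := (zz o, dir (ze o - o.1.1)).
Let near (p' p : quat * quat) := (p.1 == p'.1) || (p.1 \in Nb p'.1).

Let XYP p : p \in XY -> [/\ p.1 \in S, p.2 \in S, p.2 \in Nb p.1 & p.1 != p.2].
Proof.
case: p => x y; rewrite mem_pairs /= => /andP[xS yN]; split => //.
  exact: (NbS xS).
by apply: contraNneq (Nbx xS) => {1}->.
Qed.

Let uXY : uniq XY.
Proof. by apply: uniq_pairs => // x /uNb. Qed.

Let EEP p e : e \in EE p = (e.1 \in Bf p.1) && (e.2 \in Bf p.2).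
Proof. by case: e => c d; rewrite mem_pairs. Qed.

Let OmP o : o \in Om -> [/\ o.1 \in XY, o.2.1 \in Bf o.1.1 & o.2.2 \in Bf o.1.2].
Proof. by case: o => p e; rewrite mem_pairs EEP => /and3P[]. Qed.

Let uOm : uniq Om.
Proof.
apply: uniq_pairs => // p /XYP[xS yS _ _]; apply: uniq_pairs; first exact: uB.
by move=> *; apply: uB.
Qed.

Let I := [seq (z, k) | z <- [seq (a, b) | a <- Sg1, b <- Sg2],
                       k <- enum {: 'I_5 * 'I_5 * 'I_5 * 'I_5}].

Let uI : uniq I.
Proof. by apply: uniq_pairs => [|? _]; [apply: uniq_pairs | exact: enum_uniq]. Qed.

Let sI : size I = (625 * (size Sg1 * size Sg2))%N.
Proof. by rewrite !size_allpairs -cardE card_dir mulnC. Qed.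

Let kyI o : o \in Om -> ky o \in I.
Proof.
move=> /OmP[/XYP[xS yS _ _] cB dB]; rewrite /I /ky !mem_pairs mem_enum andbT /=.
by have [-> ->] := Sg xS yS cB dB.
Qed.

(** With equal keys, [dir_close] puts [x = o.1.1] closer to [x' = o'.1.1] than the common slope is,
    hence closer than [y' = o'.1.2] by [slope_between]. As [y'] is a neighbour of [x'], so is [x],
    unless they coincide. Thus all members of a key class are near the member whose first slope is
    farthest from the common slope. *)
Let star o o' : o \in Om -> o' \in Om -> ky o = ky o' ->
  qnorm (ze o - o.1.1) <= qnorm (ze o' - o'.1.1) -> near o'.1 o.1.
Proof.
move=> /OmP[/XYP[xS yS _ xy] /(BU xS) cU /(BU yS) dU].
move=> /OmP[/XYP[xS' yS' yN' xy'] /(BU xS') cU' /(BU yS') dU'] e le.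
have ezz : zz o = zz o' := congr1 fst e.
have ez : ze o = ze o' by rewrite /ze ezz.
have ed : dir (ze o - o.1.1) = dir (ze o' - o'.1.1) := congr1 snd e.
rewrite /near.
have [//|xx /=] := eqVneq o.1.1 o'.1.1.
have [z0 _] := slope_between aU cU dU xy.
have [z0' lz] := slope_between aU cU' dU' xy'.
apply: (NbP xS' yN' xS xx); rewrite qnormB; apply: lt_le_trans lz.
have : qnorm (ze o - o.1.1 - (ze o' - o'.1.1)) < qnorm (ze o' - o'.1.1) :=
  dir_close z0 z0' ed le.
rewrite -ez; have -> : ze o - o.1.1 - (ze o - o'.1.1) = o'.1.1 - o.1.1.
  by rewrite opprB addrC addrA subrK.
by rewrite ez.
Qed.

Let topP k : has (fun o => ky o == k) Om -> exists o', [/\ o' \in Om, ky o' = k &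
  forall o, o \in Om -> ky o = k -> near o'.1 o.1].
Proof.
rewrite has_filter => /(seq_argmax (fun o => qnorm (ze o - o.1.1)))[o'].
rewrite mem_filter => /andP[/eqP ek oO] oP; exists o'; split => // o oI eo.
by apply: star => //; [rewrite eo ek | apply: oP; rewrite mem_filter eo eqxx].
Qed.

Let zz_inj o o' : o \in Om -> o.1 = o'.1 -> zz o = zz o' -> o = o'.
Proof.
move=> /OmP[/XYP[_ _ _ xy] _ _] e1 e.
have ea := congr1 fst e; have eb := congr1 snd e; rewrite /= -e1 in ea eb.
have [ec ed] := two_slopes xy ea eb.
by rewrite [o]surjective_pairing [o']surjective_pairing e1
  [o.2]surjective_pairing [o'.2]surjective_pairing ec ed.
Qed.

Let count_near p' : p' \in XY -> (count (near p') XY <= M.+1 * M)%N.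
Proof.
move=> /XYP[xS yS yN _]; rewrite -size_filter.
have -> : (M.+1 * M = size [seq (x, y) | x <- p'.1 :: Nb p'.1, y <- Nb x])%N.
  rewrite size_pairs (eq_big_seq (fun=> M)) => [|x].
    by rewrite big_const_seq count_predT iter_addn_0 /= sNb // mulnC.
  by rewrite inE => /orP[/eqP ->|/(NbS xS)]; exact: sNb.
apply: uniq_leq_size; first by rewrite filter_uniq.
move=> [x y]; rewrite mem_filter !mem_pairs inE => /andP[n /andP[_ yx]].
by rewrite yx andbT.
Qed.

(** In a key class the pair of slopes is near that of the top member, which leaves [M.+1] choices
    for [x] and [M] for [y]; the slopes and the vector then determine [(c, d)] by [two_slopes]. *)
Lemma cluster_basic : (size Om <= 625 * (size Sg1 * size Sg2) * (M.+1 * M))%N.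
Proof.
rewrite (count_fiber uI kyI) -sI; apply: sum_nat_leC => k _.
have [hk|] := boolP (has (fun o => ky o == k) Om); last first.
  by rewrite has_count -leqNgt leqn0 => /eqP ->.
have [o' [/OmP[pX _ _] ek oP]] := topP hk; apply: leq_trans (count_near pX).
rewrite -!size_filter -(size_map fst (filter (fun o => ky o == k) Om)); apply: uniq_leq_size.
  rewrite map_inj_in_uniq ?filter_uniq // => o1 o2.
  rewrite !mem_filter => /andP[/eqP k1 o1O] /andP[/eqP k2 _] e.
  by apply: zz_inj => //; have := congr1 fst k1; rewrite -k2.
move=> p /mapP[o]; rewrite !mem_filter => /andP[/eqP ko oO] ->.
by rewrite oP //; have [-> _ _] := OmP oO.
Qed.

(** Exchanging [(x, c)] with [(y, d)] never changes the vector, so this coincidence must not count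
    as a collision. *)
Let nontriv (p p' : quat * quat) := (p != p') && (p != (p'.2, p'.1)).

Variable theta : nat.
Hypothesis coll : forall p p', p.1 \in S -> p.2 \in S -> p'.1 \in S -> p'.2 \in S ->
  p.1 != p.2 -> p'.1 != p'.2 -> nontriv p p' ->
  (\sum_(e <- EE p) count (fun e' => zz (p, e) == zz (p', e')) (EE p') <= theta)%N.

(** A key class contains its top member, possibly the swap of it, and otherwise only nontrivial
    collisions with it between near pairs of slopes. So the factor [M.+1 * M] of [cluster_basic]
    becomes 2 in the main term, and the rest is paid by [theta]. *)
Lemma cluster_coll : (size Om <= 2 * (625 * (size Sg1 * size Sg2)) +
   size S * M * (M.+1 * M * theta))%N.
Proof.
pose C o' o := [&& zz o == zz o', near o'.1 o.1 & nontriv o.1 o'.1].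
have h1 k : (count (fun o => ky o == k) Om <= 2 +
    \sum_(o' <- Om | ky o' == k) count (C o') Om)%N.
  have [hk|] := boolP (has (fun o => ky o == k) Om); last first.
    by rewrite has_count -leqNgt leqn0 => /eqP ->.
  have [o' [oO ek oP]] := topP hk.
  apply: (@leq_trans (2 + count (C o') Om)); last first.
    rewrite leq_add2l (big_rem o') //= ek eqxx leq_addr //.
  pose sw := ((o'.1.2, o'.1.1), (o'.2.2, o'.2.1)) : (quat * quat) * (quat * quat).
  rewrite -!size_filter -[2%N]/(size [:: o'; sw]) -size_cat.
  apply: uniq_leq_size; first by rewrite filter_uniq.
  move=> o; rewrite mem_cat !mem_filter => /andP[/eqP ko oI].
  rewrite oI andbT /C oP // !inE /nontriv.
  have ez : zz o = zz o' by have := congr1 fst ko; rewrite -ek.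
  rewrite ez eqxx /=.
  have [e1|_ /=] := eqVneq o.1 o'.1; first by rewrite (zz_inj oI e1 ez) eqxx.
  have [e1|_] := eqVneq o.1 (o'.1.2, o'.1.1); last by rewrite orbT.
  rewrite orbF; apply/orP; right; apply/eqP; apply: zz_inj => //.
  by rewrite ez /zz /= addrC [X in (_, X)]addrC.
rewrite (count_fiber uI kyI).
apply: leq_trans (leq_sum _ (fun k _ => h1 k)) _.
rewrite big_split /= -(sum_fiber_nat (fun o' => count (C o') Om) uI kyI).
apply: leq_add.
  by rewrite big_const_seq count_predT iter_addn_0 sI.
rewrite big_allpairs_dep /=.
have sXY : size XY = (size S * M)%N.
  rewrite size_pairs (eq_big_seq (fun=> M)) => [|x]; last exact: sNb.
  by rewrite big_const_seq count_predT iter_addn_0 mulnC.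
rewrite -sXY; apply: sum_nat_leC => p' pX.
apply: (@leq_trans (\sum_(p <- XY | near p' p) theta)); last first.
  by rewrite big_const_seq iter_addn_0 mulnC leq_mul2r count_near // orbT.
apply: (@leq_trans (\sum_(e' <- EE p') \sum_(p <- XY | near p' p && nontriv p p')
     count (fun e => zz (p', e') == zz (p, e)) (EE p))).
  apply: leq_sums => e' _; rewrite -sum1_count big_mkcond big_allpairs_dep /=.
  rewrite [leqRHS]big_mkcond /=; apply: leq_sums => p pX'.
  rewrite -big_mkcond sum1_count.
  have CE e : C (p', e') (p, e) =
    (zz (p', e') == zz (p, e)) && (near p' p && nontriv p p') by rewrite /C eq_sym.
  case: ifPn => [h|/negPf h].
    by apply: eq_leq; apply: eq_count => e; rewrite /= CE h andbT.
  by rewrite (eq_count (a2 := pred0)) ?count_pred0 // => e /=; rewrite CE h andbF.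
rewrite exchange_big /= big_mkcond [leqRHS]big_mkcond /=; apply: leq_sums => p pX'.
case: ifPn => // /andP[-> nt].
have [a1 a2 _ a3] := XYP pX'; have [b1 b2 _ b3] := XYP pX.
apply: coll => //; move: nt; rewrite /nontriv; case: (p) (p') => [x y] [x' y'] /=.
rewrite !xpair_eqE /= [x == x']eq_sym [y == y']eq_sym [x == y']eq_sym [y == x']eq_sym.
by rewrite [(y' == x) && _]andbC.
Qed.

Lemma size_Om (tau : nat) : (forall x, x \in S -> (tau <= size (Bf x))%N) ->
  (size S * M * tau ^ 2 <= size Om)%N.
Proof.
move=> tauB; rewrite size_pairs big_allpairs_dep /=.
have -> : (size S * M * tau ^ 2 = \sum_(x <- S) \sum_(y <- Nb x) tau ^ 2)%N.
  rewrite (eq_big_seq (fun=> M * tau ^ 2)%N) => [|x xS].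
    by rewrite big_const_seq count_predT iter_addn_0 -mulnA mulnC.
  by rewrite big_const_seq count_predT iter_addn_0 sNb // mulnC.
apply: leq_sums => x xS; apply: leq_sums => y yN.
by rewrite size_allpairs leq_mul //; apply: tauB => //; apply: NbS yN.
Qed.

End Cluster.

Bind Scope ring_scope with quat.

(** * Additive energy and its control of collisions *)

Definition dset (X Y : seq quat) : seq quat := undup [seq a - b | a <- X, b <- Y].

Definition rep (Y D : seq quat) (w : quat) : nat := count (fun d => d + w \in Y) D.

Definition energy (X : seq quat) : R := \sum_(u <- dset X X) (rep X X u)%:R ^+ 2.

Lemma mem_dset X Y a b : a \in X -> b \in Y -> a - b \in dset X Y.
Proof. by move=> aX bY; rewrite mem_undup; apply: allpairs_f. Qed.

Lemma rep_gt0 Y D w : rep Y D w != 0%N -> w \in dset Y D.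
Proof.
rewrite -lt0n -has_count => /hasP[d dD dY].
by rewrite -[w](addKr d) addrC mem_dset.
Qed.

Lemma sum_rep_le (T : eqType) (s : seq T) (X : seq quat) (g : T -> quat) :
  uniq s -> {in s &, injective g} ->
  \sum_(y <- s) (rep X X (g y))%:R ^+ 2 <= energy X.
Proof.
move=> us gi; apply: (sum_inj (F := fun u => (rep X X u)%:R ^+ 2)) => //.
- exact: undup_uniq.
- by move=> z _; rewrite sqr_ge0.
- by move=> x xs; rewrite sqrf_eq0 pnatr_eq0; exact: rep_gt0.
Qed.

Lemma ler_sqr2 (a b : R) : 0 <= a -> a <= b -> a ^+ 2 <= b ^+ 2.
Proof. by move=> a0 ab; rewrite ler_pXn2r // nnegrE // (le_trans a0). Qed.

(** Two applications of Cauchy-Schwarz. The first, over [z], turns pairs of solutions into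
    [rep X X ((d2 - d1) * ga * al^-1)]; the second, over [(d1, d2)], squares this. For fixed [d1]
    the argument is injective in [d2], so each [d1] contributes at most [energy X]. *)
Lemma mixed_sums_le_energy (X D Z : seq quat) (al ga : quat) :
  uniq X -> uniq D -> uniq Z -> al != 0 -> ga != 0 ->
  ((\sum_(d <- D) count (fun c => (c * al + d * ga)%R \in Z) X)%N%:R) ^+ 4 <=
  (size Z)%:R ^+ 2 * (size D)%:R ^+ 3 * energy X.
Proof.
move=> uX uD uZ al0 ga0; set J := (\sum_(d <- D) _)%N.
pose A z d := (z - d * ga) * al^-1 \in X.
pose K : R := \sum_(d1 <- D) \sum_(d2 <- D) (rep X X ((d2 - d1) * ga * al^-1))%:R.
have K0 : 0 <= K by apply: sumr_ge0 => d1 _; apply: sumr_ge0.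
have h1 : J%:R <= \sum_(z <- Z) \sum_(d <- D) (A z d)%:R :> R.
  rewrite exchange_big natr_sum /=; apply: ler_sums => d dD.
  rewrite -count_sum ler_nat; apply: (count_inj (h := fun c => c * al + d * ga)) => //.
    by move=> x y _ _ /addIr /(@mulIr quat al al0).
  by move=> c cX cZ; split => //; rewrite /A addrK mulrK.
have h2 : J%:R ^+ 2 <= (size Z)%:R * K.
  apply: le_trans (ler_sqr2 (ler0n _ _) h1) _; apply: le_trans (sqr_sum_le _ _) _.
  rewrite ler_wpM2l //.
  under eq_bigr => z _ do rewrite expr2 big_distrlr /=.
  rewrite exchange_big; apply: ler_sums => d1 _.
  rewrite exchange_big; apply: ler_sums => d2 _ /=.
  under eq_bigr => z _ do rewrite -natrM mulnb.
  rewrite -count_sum ler_nat.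
  apply: (count_inj (h := fun z => (z - d2 * ga) * al^-1)) => //.
    by move=> x y _ _ /(@mulIr quat al^-1); rewrite qunitE qinv_eq0 => /(_ al0) /addIr.
  move=> z zZ /andP[zd1 zd2]; split => //.
  have -> : (z - d2 * ga) * al^-1 + (d2 - d1) * ga * al^-1 = (z - d1 * ga) * al^-1; last by [].
  by rewrite -mulrDl; congr (_ * _); qring.
have h3 : K ^+ 2 <= (size D)%:R ^+ 3 * energy X.
  apply: le_trans (sqr_sum_le _ _) _; rewrite exprS -mulrA ler_wpM2l //.
  rewrite expr2 -mulrA; apply: sum_leC => d1 _.
  apply: le_trans (sqr_sum_le _ _) _; rewrite ler_wpM2l //.
  apply: sum_rep_le => // x y _ _.
  have aV : al^-1 != 0 by rewrite qinv_eq0.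
  by move=> /(@mulIr quat al^-1 aV) /(@mulIr quat ga ga0) /addIr.
rewrite -[4%N]/(2 * 2)%N exprM; apply: le_trans (ler_sqr2 (sqr_ge0 _) h2) _.
by rewrite exprMn -mulrA ler_wpM2l // sqr_ge0.
Qed.

Definition neighbours (S : seq quat) (M : nat) (x : quat) (N : seq quat) : Prop :=
  [/\ uniq N, {subset N <= S}, x \notin N, size N = M &
  forall y w, y \in N -> w \in S -> w != x -> qnorm (w - x) < qnorm (y - x) -> w \in N].

Lemma neighbours_exist (S : seq quat) (M : nat) : uniq S -> (M < size S)%N ->
  exists Nb : quat -> seq quat, forall x, x \in S -> neighbours S M x (Nb x).
Proof.
move=> uS MS.
have [x|Nb NbP] := @choice _ _ (fun x N => x \in S -> neighbours S M x N); last by exists Nb.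
have [xS|xS] := boolP (x \in S); last by exists [::].
have [||N [uN NS sN NP]] := @k_smallest _ (rem x S) (fun w => qnorm (w - x)) M.
- exact: rem_uniq.
- by rewrite size_rem // -ltnS prednK //; case: (S) xS.
exists N => _; split => //.
- by move=> y /NS; exact: mem_rem.
- by apply/negP => /NS; rewrite mem_rem_uniqF.
by move=> y w yN wS wx lt; apply: NP yN _ lt; rewrite mem_rem_uniq // inE /= wx.
Qed.

Section ClusterEnergy.
Variables (U S Sg1 Sg2 : seq quat) (Bf : quat -> seq quat) (tau : nat).
Hypotheses (aU : acute U) (uS : uniq S) (u1 : uniq Sg1) (u2 : uniq Sg2).
Hypothesis BU : forall x, x \in S -> {subset Bf x <= U}.
Hypothesis uB : forall x, x \in S -> uniq (Bf x).
Hypothesis Sg : forall x y c d, x \in S -> y \in S -> c \in Bf x -> d \in Bf y ->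
  c + d \in Sg1 /\ c * x + d * y \in Sg2.
Hypothesis tauB : forall x, x \in S -> (tau <= size (Bf x))%N.

(** [cluster_basic] with a single neighbour, whence [1250 = 625 * 2]. *)
Lemma solymosi : (1 < size S)%N -> (size S * tau ^ 2 <= 1250 * (size Sg1 * size Sg2))%N.
Proof.
move=> /(neighbours_exist uS)[Nb NbP].
have := @cluster_basic U S Sg1 Sg2 Bf Nb 1 aU uS u1 u2 BU uB.
have := @size_Om S Bf Nb 1 _ _ tau tauB.
have w1 x : x \in S -> uniq (Nb x) by move=> /NbP[].
have w2 x : x \in S -> {subset Nb x <= S} by move=> /NbP[].
have w3 x : x \in S -> x \notin Nb x by move=> /NbP[].
have w4 x : x \in S -> size (Nb x) = 1%N by move=> /NbP[].
have w5 x y w : x \in S -> y \in Nb x -> w \in S -> w != x ->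
  qnorm (w - x) < qnorm (y - x) -> w \in Nb x by move=> /NbP[_ _ _ _ H]; exact: H.
move=> /(_ w2 w4) h /(_ w1 w2 w3 w4 w5 Sg) h'.
have := leq_trans h h'; by rewrite !muln1; lia.
Qed.

Variables (M : nat) (T Em theta : R).
Hypothesis BT : forall x, x \in S -> (size (Bf x))%:R <= T.
Hypothesis BE : forall x, x \in S -> energy (Bf x) <= Em.
Hypothesis thP : T ^+ 5 * Em <= theta ^+ 4.
Hypothesis th0 : 0 <= theta.

Let coll1 (x y x' y' : quat) : x \in S -> y \in S -> x' \in S -> y' \in S ->
  y != x -> x' != x -> y' != x ->
  (\sum_(d' <- Bf y') count (fun c' => (c' * (x' - x) * (y - x)^-1 +
     d' * (y' - x) * (y - x)^-1)%R \in Bf y) (Bf x'))%N%:R <= theta.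
Proof.
move=> xS yS xS' yS' yx xx' xy'.
set J := (\sum_(d' <- _) _)%N.
have b0 : (y - x)^-1 != 0 by rewrite qinv_eq0 subr_eq0.
have := @mixed_sums_le_energy (Bf x') (Bf y') (Bf y) ((x' - x) * (y - x)^-1)
  ((y' - x) * (y - x)^-1) (uB xS') (uB yS') (uB yS).
rewrite !qmulf_eq0 (negPf b0) !orbF !subr_eq0 => /(_ xx' xy').
under eq_bigr => d _ do under eq_count => c do rewrite !mulrA.
rewrite -/J => h; rewrite -(@ler_pXn2r _ 4) // ?nnegrE //.
apply: le_trans h _; apply: le_trans thP.
have Em0 : 0 <= Em by apply: le_trans (BE xS'); apply: sumr_ge0 => u _; exact: sqr_ge0.
rewrite [T ^+ 5](exprD T 2 3); apply: ler_pM; rewrite ?mulr_ge0 ?exprn_ge0 //.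
- by apply: sumr_ge0 => u _; exact: sqr_ge0.
- apply: ler_pM; rewrite ?exprn_ge0 // ler_pXn2r ?nnegrE ?BT //;
  exact: le_trans (BT xS).
exact: BE.
Qed.

(** If [M ^ 2 * theta] is small against [tau ^ 2], the last term is absorbed on the left, and the
    bound of [solymosi] improves by a factor of order [M]. *)
Lemma cluster_energy : (M < size S)%N ->
  (size S * M * tau ^ 2)%N%:R <= (1250 * (size Sg1 * size Sg2))%N%:R +
    (size S * M * (M.+1 * M))%N%:R * theta :> R.
Proof.
move=> /(neighbours_exist uS)[Nb NbP].
have w1 x : x \in S -> uniq (Nb x) by move=> /NbP[].
have w2 x : x \in S -> {subset Nb x <= S} by move=> /NbP[].
have w3 x : x \in S -> x \notin Nb x by move=> /NbP[].
have w4 x : x \in S -> size (Nb x) = M by move=> /NbP[].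
have w5 x y w : x \in S -> y \in Nb x -> w \in S -> w != x ->
  qnorm (w - x) < qnorm (y - x) -> w \in Nb x by move=> /NbP[_ _ _ _ H]; exact: H.
have h := @size_Om S Bf Nb M w2 w4 tau tauB.
have /andP[t1 _] := truncn_itv th0.
have := @cluster_coll U S Sg1 Sg2 Bf Nb M aU uS u1 u2 BU uB w1 w2 w3 w4 w5 Sg
  (Num.truncn theta).
have H p p' : p.1 \in S -> p.2 \in S -> p'.1 \in S -> p'.2 \in S ->
  p.1 != p.2 -> p'.1 != p'.2 -> (p != p') && (p != (p'.2, p'.1)) ->
  (\sum_(e <- [seq (c, d) | c <- Bf p.1, d <- Bf p.2])
     count (fun e' : quat * quat => (e.1 + e.2, e.1 * p.1 + e.2 * p.2)%R ==
      (e'.1 + e'.2, e'.1 * p'.1 + e'.2 * p'.2)%R)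
      [seq (c, d) | c <- Bf p'.1, d <- Bf p'.2] <= Num.truncn theta)%N.
  case: p p' => [x y] [x' y'] /= xS yS xS' yS' xy xy'; rewrite !xpair_eqE => nt.
  (* A nontrivial collision leaves one slope [s] of [x], [y] outside [x'], [y']. Subtracting the
     first coordinate times [s] from the second eliminates the element of the fibre of [s] and
     leaves an equation with nonzero coefficients, whose solutions [coll1] counts. *)
  have [st stP] : exists st : quat * quat, [/\ st = (x, y) \/ st = (y, x),
      x' != st.1 & y' != st.1].
    have [xx'|xx'] := eqVneq x' x; last have [xy2|xy2] := eqVneq y' x.
    - exists (y, x); split; [by right | by rewrite xx' | ].
      by rewrite eq_sym; move: nt; rewrite xx' eqxx /= => /andP[].
    - exists (y, x); split; [by right | | by rewrite xy2].
      by rewrite eq_sym; move: nt; rewrite xy2 eqxx /= => /andP[].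
    - by exists (x, y); split; first left.
  case: st stP => s t /= [stE xs ys].
  have [sS tS ts] : [/\ s \in S, t \in S & t != s].
    by case: stE => -[-> ->]; split => //; rewrite eq_sym.
  rewrite truncn_ge_nat //; apply: le_trans (coll1 sS tS xS' yS' ts xs ys).
  rewrite ler_nat.
  pose q d' c' := (c' * (x' - s) / (t - s) + d' * (y' - s) / (t - s))%R \in Bf t.
  pose J := [seq (d', c') | d' <- Bf y', c' <- [seq c' <- Bf x' | q d' c']].
  pose z (e : quat * quat) (u v : quat) := (e.1 + e.2, e.1 * u + e.2 * v).
  pose L := [seq (e, e') | e <- [seq (c, d) | c <- Bf x, d <- Bf y],
    e' <- [seq e' <- [seq (c, d) | c <- Bf x', d <- Bf y'] | z e x y == z e' x' y']].
  apply: (@leq_trans (size J)); last first.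
    by rewrite size_pairs; apply: leq_sums => d' _; rewrite size_filter.
  have uE u v : u \in S -> v \in S -> uniq [seq (c, d) | c <- Bf u, d <- Bf v].
    by move=> uS' vS'; apply: uniq_pairs => [|_ _]; exact: uB.
  have uL : uniq L by apply: uniq_pairs => [|e _]; rewrite ?filter_uniq ?uE.
  apply: (@leq_trans (size L)).
    by rewrite size_pairs; apply: leq_sums => e _; rewrite size_filter.
  pose hh (ee : (quat * quat) * (quat * quat)) := (ee.2.2, ee.2.1).
  rewrite -(size_map hh); apply: uniq_leq_size.
    rewrite map_inj_in_uniq // => -[e1 e1'] [e2 e2'].
    rewrite !mem_pairs !mem_filter => /and3P[_ /eqP z1 _] /and3P[_ /eqP z2 _] eh.
    have ee : e1' = e2'.
      have a1 := congr1 fst eh; have a2 := congr1 snd eh; rewrite /hh /= in a1 a2.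
      by rewrite [e1']surjective_pairing [e2']surjective_pairing a1 a2.
    rewrite ee -{}z2 in z1 *.
    have [a1 a2] := two_slopes xy (congr1 fst z1) (congr1 snd z1).
    by rewrite [e1]surjective_pairing [e2]surjective_pairing a1 a2.
  move=> w /mapP[[[c d] [c' d']]]; rewrite mem_pairs mem_filter !mem_pairs /=.
  move=> /andP[/andP[cB dB] /and3P[/eqP ez cB' dB']] ->.
  rewrite /hh /= mem_pairs dB' mem_filter cB' andbT /= /q.
  have e1 : c + d = c' + d' := congr1 fst ez.
  have e2 : c * x + d * y = c' * x' + d' * y' := congr1 snd ez.
  rewrite -mulrDl; have ts0 : t - s \is a GRing.unit by rewrite qunitE subr_eq0.
  have : c' * (x' - s) + d' * (y' - s) = (c * (x - s) + d * (y - s)).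
    transitivity (c' * x' + d' * y' - (c' + d') * s); first qring.
    by rewrite -e1 -e2; qring.
  move=> ->; case: stE ts0 => -[-> ->] ts0; rewrite subrr mulr0 ?add0r ?addr0 mulrK //.
move=> /(_ H) h'.
have := leq_trans h h'; rewrite -(ler_nat R) => /le_trans -> //.
rewrite natrD lerD //; first by rewrite mulnA.
set a := (size S * M)%N.
rewrite mulnA natrM ler_wpM2l //.
Qed.

End ClusterEnergy.

(** * Additive Balog-Szemeredi-Gowers *)

Definition sset (X Y : seq quat) : seq quat := undup [seq a + b | a <- X, b <- Y].

Lemma mem_sset X Y a b : a \in X -> b \in Y -> a + b \in sset X Y.
Proof. by move=> aX bY; rewrite mem_undup; apply: allpairs_f. Qed.

Lemma ssetP X Y w : w \in sset X Y -> exists a b, [/\ a \in X, b \in Y & w = a + b].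
Proof. by rewrite mem_undup => /allpairsP[[a b] /= [aX bY ->]]; exists a, b. Qed.

Lemma sum_diff (X Y : seq quat) (F : quat -> R) : uniq X ->
  \sum_(b <- Y) \sum_(a <- X) F (a - b) = \sum_(u <- dset X Y) (rep X Y u)%:R * F u.
Proof.
move=> uX; under [RHS]eq_bigr => u _ do rewrite count_sum mulr_suml.
rewrite [RHS]exchange_big; apply: eq_sums => b bY /=.
rewrite (sum_fiber (I := dset X Y) (h := fun a => a - b)) ?undup_uniq //; last first.
  by move=> a aX; apply: mem_dset.
apply: eq_sums => u _.
transitivity (\sum_(a <- X) (b + u == a)%:R * F (a - b)).
  by apply: eq_bigr => a _; rewrite subr_eq addrC eq_sym.
by rewrite (sum_delta (b + u) (fun a => F (a - b))) // addrAC subrr add0r.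
Qed.

Lemma energyE (X : seq quat) : uniq X ->
  energy X = \sum_(b <- X) \sum_(a <- X) (rep X X (a - b))%:R.
Proof.
by move=> uX; rewrite (sum_diff _ (fun u => (rep X X u)%:R)) //; apply: eq_bigr => u _; rewrite expr2.
Qed.

Lemma sum_rep (X Y : seq quat) : uniq X ->
  \sum_(u <- dset X Y) (rep X Y u)%:R = (size X)%:R * (size Y)%:R :> R.
Proof.
move=> uX; have := sum_diff Y (fun=> 1) uX; under [RHS]eq_bigr do rewrite mulr1.
by move=> <-; rewrite sum_const sum_const mulr1 mulrC.
Qed.

Lemma popular_size (X Y : seq quat) (t : R) : uniq X ->
  (count (fun u => t <= (rep X Y u)%:R) (dset X Y))%:R * t <= (size X)%:R * (size Y)%:R.
Proof.
move=> uX; rewrite -sum_rep // count_sum mulr_suml; apply: ler_sums => u _.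
by case: (boolP (t <= _)) => h; rewrite ?mul1r // mul0r.
Qed.

Lemma bsg_arith (n c1 c2 c3 b1 b2 : nat) : (c1 <= c2)%N -> (c3 <= b2)%N ->
  (n <= c1 + (b1 + c3))%N -> (4 * b1 <= n)%N -> (4 * b2 <= n)%N -> (n <= 2 * c2)%N.
Proof. by lia. Qed.

Section BSG.
Variable (B : seq quat).
Hypothesis uB : uniq B.
(** Symmetric under the reflection of [a] to [s - a]. This is what makes the argument yield sums
    although popularity concerns differences. *)
Let Bs s := [seq a <- B | s - a \in B].

Let BsC s y : y \in Bs s -> s - y \in Bs s.
Proof. by rewrite !mem_filter subKr andbC. Qed.

Let uBs s : uniq (Bs s). Proof. by rewrite filter_uniq. Qed.

(** Because [s - b = (s - a) + (a - b)], a pair [(a, b)] lies in [Bs s] for exactly as many [s] as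
    [a - b] has representations. *)
Lemma sum_Bs (om : quat -> quat -> R) :
  \sum_(s <- sset B B) \sum_(a <- Bs s) \sum_(b <- Bs s) om a b =
  \sum_(a <- B) \sum_(b <- B) (rep B B (a - b))%:R * om a b.
Proof.
transitivity (\sum_(s <- sset B B) \sum_(a <- B) \sum_(b <- B)
    ((s - a \in B) && (s - b \in B))%:R * om a b).
  apply: eq_bigr => s _; rewrite big_filter big_mkcond; apply: eq_bigr => a _.
  case: ifPn => sa; last by rewrite big1 // => b _; rewrite mul0r.
  rewrite big_filter big_mkcond; apply: eq_bigr => b _.
  by case: ifPn => sb; rewrite ?mul1r ?mul0r.
rewrite exchange_big; apply: eq_sums => a aB; rewrite exchange_big; apply: eq_sums => b bB /=.
rewrite -mulr_suml -count_sum; congr (_%:R * _); apply/eqP; rewrite eqn_leq; apply/andP; split.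
  apply: (count_inj (h := fun s => s - a)); rewrite ?undup_uniq //.
    by move=> x y _ _ /addIr.
  by move=> s _ /andP[sa sb]; split => //; rewrite addrA subrK.
apply: (count_inj (h := fun s => s + a)); rewrite ?undup_uniq //.
  by move=> x y _ _ /addIr.
by move=> c cB cab; rewrite mem_sset //= addrK cB /= -addrA.
Qed.

(** Some [Bs s] is large and has few pairs with unpopular difference; [B'] keeps its elements with
    few unpopular partners. For [a], [c] in [B'], at least half of the [y] in [Bs s] make both terms
    of [a + c - s = (a - y) + (c - (s - y))] popular, and there are at most [64 k n] popular
    differences. *)
Lemma bsg_add (k : R) : B != [::] -> 0 < k -> (size B)%:R ^+ 3 <= k * energy B ->
  exists B' : seq quat, [/\ uniq B', {subset B' <= B}, (size B)%:R <= 4 * k * (size B')%:R &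
    (size (sset B' B'))%:R <= 2 ^+ 14 * k ^+ 3 * (size B)%:R].
Proof.
move=> B0 k0 hE; set n : R := (size B)%:R in hE *.
have n0 : 0 < n by rewrite ltr0n lt0n size_eq0.
(* With this threshold the unpopular pairs weigh at most [n^3 / (4 k)] after the factor 16 below,
   and the term linear in the size of [Bs s] at most [n^3 / (2 k)]; together this is less than
   [n^3 / k], hence less than the energy. *)
pose e := n / (64 * k); have e0 : 0 < e by rewrite divr_gt0 // mulr_gt0.
have ek : e * k = n / 64 by rewrite /e; field; exact: lt0r_neq0.
pose unp a y := (rep B B (a - y))%:R < e.
have [s _ hs] : exists2 s, s \in sset B B &
   16 * (\sum_(a <- Bs s) \sum_(b <- Bs s) (unp a b)%:R) + n / (2 * k) * (size (Bs s))%:R <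
   (size (Bs s))%:R ^+ 2.
  apply: (@exists_ge_mean _ _ (fun s => 16 * (\sum_(a <- Bs s) \sum_(b <- Bs s) (unp a b)%:R) + n / (2 * k) * (size (Bs s))%:R) (fun s => (size (Bs s))%:R ^+ 2)).
  have -> : \sum_(s <- sset B B) (size (Bs s))%:R ^+ 2 = energy B.
    rewrite energyE // exchange_big; under [RHS]eq_bigr do under eq_bigr do rewrite -[_%:R]mulr1.
    by rewrite -sum_Bs; apply: eq_bigr => s _; rewrite !sum_const mulr1 expr2.
  rewrite big_split /= -!mulr_sumr sum_Bs.
  have h1 : \sum_(a <- B) \sum_(b <- B) (rep B B (a - b))%:R * (unp a b)%:R <= n * (n * e).
    apply: sum_leC => a _; apply: sum_leC => b _; rewrite /unp.
    by case: (ltP _ e) => h; rewrite ?mulr1 ?mulr0 ltW.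
  have h2 : \sum_(s <- sset B B) (size (Bs s))%:R <= n * n :> R.
    under eq_bigr do rewrite size_filter count_sum.
    rewrite exchange_big; apply: sum_leC => a aB; rewrite -count_sum ler_nat -(count_predT B).
    apply: (count_inj (h := fun s => s - a)); rewrite ?undup_uniq //.
      by move=> x y _ _ /addIr.
  have nk : 0 <= n / (2 * k) by rewrite divr_ge0 ?mulr_ge0 // ltW.
  have h3 := ler_wpM2l nk h2.
  apply: (@lt_le_trans _ _ (n ^+ 3 / k)); last by rewrite ler_pdivrMr // mulrC.
  have e1 : n * (n * e) * 64 = n ^+ 3 / k by rewrite /e; field; exact: lt0r_neq0.
  have e2 : n / (2 * k) * (n * n) * 2 = n ^+ 3 / k by field; exact: lt0r_neq0.
  have e3 : 0 < n ^+ 3 / k by rewrite divr_gt0 // exprn_gt0.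
  lra.
set b : R := (size (Bs s))%:R in hs.
pose bad a := count (unp a) (Bs s).
pose B' := [seq a <- Bs s | (4 * bad a <= size (Bs s))%N].
have hbad : 16 * (\sum_(a <- Bs s) bad a)%N%:R + n / (2 * k) * b < b ^+ 2.
  rewrite natr_sum; under eq_bigr do rewrite /bad count_sum; exact: hs.
have nk0 : 0 < n / (2 * k) by rewrite divr_gt0 // mulr_gt0.
have b0 : 0 < b.
  rewrite lt0r ler0n andbT; apply: contraTneq hbad => ->; rewrite mulr0 addr0 expr0n /=.
  by rewrite -leNgt mulr_ge0.
have bn : n < 2 * k * b.
  have : n / (2 * k) * b < b * b by apply: le_lt_trans hbad; rewrite lerDr mulr_ge0.
  by rewrite ltr_pM2r // ltr_pdivrMr ?mulr_gt0 // mulrC.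
have sB' : 3 * b <= 4 * (size B')%:R.
  have h : (size (Bs s) * count (predC (fun a => 4 * bad a <= size (Bs s))%N) (Bs s) <=
     4 * \sum_(a <- Bs s) bad a)%N.
    rewrite -sum1_count !big_distrr /= big_mkcond; apply: leq_sum => a _.
    by case: ifPn => //; rewrite -ltnNge muln1 => /ltnW.
  have h' : 4 * (b * (count (predC (fun a => 4 * bad a <= size (Bs s))%N) (Bs s))%:R) <= b * b.
    have : 4 * (4 * (\sum_(a <- Bs s) bad a)%N%:R) <= b * b :> R.
      by move: hbad; have := mulr_ge0 (ltW nk0) (ltW b0); rewrite expr2; lra.
    apply: le_trans; rewrite ler_pM2l // -!natrM ler_nat; exact: h.
  rewrite mulrCA ler_pM2l // in h'.
  have : b = (size B')%:R + (count (predC (fun a => 4 * bad a <= size (Bs s))%N) (Bs s))%:R.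
    by rewrite -natrD size_filter count_predC.
  by lra.
exists B'; split.
- by rewrite filter_uniq.
- by move=> a; rewrite !mem_filter => /and3P[].
- have := ler_wpM2l (ltW k0) sB'; lra.
pose Pop := [seq u <- dset B B | e <= (rep B B u)%:R].
have uPop : uniq Pop by rewrite filter_uniq ?undup_uniq.
have sPop : (size Pop)%:R * e <= n * n by rewrite size_filter; exact: popular_size.
have popI a y : a \in B -> y \in B -> ~~ unp a y -> a - y \in Pop.
  by move=> aB yB; rewrite -leNgt mem_filter => -> /=; exact: mem_dset.
have h3 w : w \in sset B' B' -> (size (Bs s) <= 2 * count (fun u => (w - s - u)%R \in Pop) Pop)%N.
  move=> /ssetP[a [c [aB' cB' ->]]].
  have [aB ba] : a \in B /\ (4 * bad a <= size (Bs s))%N.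
    by move: aB'; rewrite !mem_filter => /and3P[-> _ ->].
  have [cB bc] : c \in B /\ (4 * bad c <= size (Bs s))%N.
    by move: cB'; rewrite !mem_filter => /and3P[-> _ ->].
  have q1 : (count (fun y => ~~ unp a y && ~~ unp c (s - y)%R) (Bs s) <=
       count (fun u => (a + c - s - u)%R \in Pop) Pop)%N.
    apply: (count_inj (h := fun y => a - y)) => //.
      by move=> x y _ _ /addrI /oppr_inj.
    move=> y yB /andP[ua uc]; split.
      by apply: popI => //; move: yB; rewrite mem_filter => /andP[].
    have -> : a + c - s - (a - y) = c - (s - y) by qring.
    by apply: popI => //; move: (BsC yB); rewrite mem_filter => /andP[].
  have q2 : (count (fun y => unp c (s - y)%R) (Bs s) <= bad c)%N.
    apply: (count_inj (h := fun y => s - y)) => //.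
      by move=> x y _ _ /addrI /oppr_inj.
    by move=> y yB uc; split => //; exact: BsC.
  have q3 : (size (Bs s) <= count (fun y => ~~ unp a y && ~~ unp c (s - y)%R) (Bs s) +
      (bad a + count (fun y => unp c (s - y)%R) (Bs s)))%N.
    rewrite -(count_predC (fun y => ~~ unp a y && ~~ unp c (s - y)%R)) leq_add2l.
    rewrite -count_predUI; apply: leq_trans (leq_addr _ _).
    by apply: sub_count => y /=; rewrite negb_and !negbK.
  exact: bsg_arith q1 q2 q3 ba bc.
have h4 : ((size (sset B' B'))%:R * b <= 2 * (size Pop)%:R ^+ 2).
  rewrite -natrM -natrX -natrM ler_nat.
  apply: (@leq_trans (\sum_(w <- sset B' B') 2 * count (fun u => (w - s - u)%R \in Pop) Pop)).
    rewrite mulnC -[leqLHS]addn0 -iter_addn -(count_predT (sset B' B')) -big_const_seq.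
    exact: leq_sums.
  rewrite -big_distrr leq_mul2l /=.
  under eq_bigr => w _ do rewrite -sum1_count big_mkcond.
  rewrite exchange_big /= -mulnn; apply: sum_nat_leC => u _.
  rewrite -big_mkcond sum1_count -[leqRHS]count_predT.
  apply: (count_inj (h := fun w => w - s - u)); rewrite ?undup_uniq //.
  by move=> x y _ _ /addIr /addIr.
have h5 : (size Pop)%:R <= 64 * k * n.
  rewrite -(ler_pM2r e0); apply: le_trans sPop _.
  have -> : 64 * k * n * e = 64 * n * (e * k) by ring.
  by rewrite ek; lra.
have h6 : (size Pop)%:R ^+ 2 <= (64 * k * n) ^+ 2 by apply: ler_sqr2.
rewrite -(ler_pM2r b0); apply: le_trans h4 _.
apply: (@le_trans _ _ (2 * (64 * k * n) ^+ 2)); first by rewrite ler_pM2l.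
have -> : 2 * (64 * k * n) ^+ 2 = 2 ^+ 13 * k ^+ 2 * n * n by ring.
have -> : 2 ^+ 14 * k ^+ 3 * n * b = 2 ^+ 13 * k ^+ 2 * n * (2 * k * b) by ring.
apply: ler_wpM2l; last exact: ltW.
by apply: mulr_ge0; rewrite ?ltW // mulr_gt0 ?exprn_gt0.
Qed.

End BSG.

(** * Multiplicative energy *)

Definition mrep (U : seq quat) (x : quat) : nat := count (fun c => c * x \in U) U.
Definition lrep (U : seq quat) (g : quat) : nat := count (fun c => g * c \in U) U.
Definition rquo (U : seq quat) : seq quat := undup [seq c^-1 * c' | c <- U, c' <- U].
Definition lquo (U : seq quat) : seq quat := undup [seq c' * c^-1 | c <- U, c' <- U].
Definition menergy (U : seq quat) : R := \sum_(x <- rquo U) (mrep U x)%:R ^+ 2.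
Definition lenergy (U : seq quat) : R := \sum_(g <- lquo U) (lrep U g)%:R ^+ 2.
Definition pset (X Y : seq quat) : seq quat := undup [seq a * b | a <- X, b <- Y].

Lemma mem_pset X Y a b : a \in X -> b \in Y -> a * b \in pset X Y.
Proof. by move=> aX bY; rewrite mem_undup; apply: allpairs_f. Qed.

Lemma psetP X Y w : w \in pset X Y -> exists a b, [/\ a \in X, b \in Y & w = a * b].
Proof. by rewrite mem_undup => /allpairsP[[a b] /= [aX bY ->]]; exists a, b. Qed.

Lemma memn0 (U : seq quat) c : 0 \notin U -> c \in U -> c != 0.
Proof. by move=> U0 cU; apply: contraNneq U0 => <-. Qed.

Lemma qmulIl (a : quat) : a != 0 -> injective ( *%R a).
Proof. by move=> a0; exact: (@mulrI quat). Qed.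

Lemma qmulIr (a : quat) : a != 0 -> injective ( *%R^~ a).
Proof. by move=> a0; exact: (@mulIr quat). Qed.

Lemma mem_rquo U c x : 0 \notin U -> c \in U -> c * x \in U -> x \in rquo U.
Proof.
move=> U0 cU cxU; rewrite mem_undup; apply/allpairsP; exists (c, c * x) => /=; split => //.
by rewrite mulKr //; exact: memn0 cU.
Qed.

Lemma mem_lquo U c g : 0 \notin U -> c \in U -> g * c \in U -> g \in lquo U.
Proof.
move=> U0 cU cxU; rewrite mem_undup; apply/allpairsP; exists (c, g * c) => /=; split => //.
by rewrite mulrK //; exact: memn0 cU.
Qed.

Lemma lrep_neq0 U g : 0 \notin U -> lrep U g != 0%N -> g \in lquo U.
Proof.
move=> U0; rewrite -lt0n -has_count => /hasP[c cU gU]; exact: mem_lquo U0 cU gU.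
Qed.

Lemma menergy_ge0 U : 0 <= menergy U.
Proof. by apply: sumr_ge0 => x _; exact: sqr_ge0. Qed.

Lemma size_sqr_pairs (T U : eqType) (s : seq T) (I : seq U) (P : T -> pred U) :
  (\sum_(x <- s) count (P x) I ^ 2)%N = size [seq (x, e) | x <- s,
     e <- [seq (c, d) | c <- [seq c <- I | P x c], d <- [seq d <- I | P x d]]].
Proof.
by rewrite size_pairs; apply: eq_bigr => x _; rewrite size_allpairs size_filter mulnn.
Qed.

(** A quadruple with [g c = c1] and [g d = d1] also satisfies [c x = d] and [c1 x = d1] for
    [x = c^-1 d]. So what is counted through left quotients is counted through right quotients as
    well. *)
Lemma lenergy_le U : uniq U -> 0 \notin U -> lenergy U <= menergy U.
Proof.
move=> uU U0; rewrite /lenergy /menergy.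
under eq_bigr do rewrite -natrX; under [leRHS]eq_bigr do rewrite -natrX.
rewrite -!natr_sum ler_nat !size_sqr_pairs.
set L := [seq (x, e) | x <- _, e <- _].
have uf (P : pred quat) : uniq (filter P U) by rewrite filter_uniq.
have uL : uniq L.
  by apply: uniq_pairs => [|? _]; [exact: undup_uniq | apply: uniq_pairs].
pose h (t : quat * (quat * quat)) := (t.2.1^-1 * t.2.2, (t.2.1, t.1 * t.2.1)).
rewrite -(size_map h); apply: uniq_leq_size.
  rewrite map_inj_in_uniq // => -[g [c d]] [g' [c' d']].
  rewrite !mem_pairs !mem_filter /= => /and3P[_ /andP[_ cU] _] _ e.
  have e1 : c^-1 * d = c'^-1 * d' := congr1 fst e.
  have e2 : c = c' := congr1 (fun t => t.2.1) e.
  have e3 : g * c = g' * c' := congr1 (fun t => t.2.2) e.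
  have c0 := memn0 U0 cU; rewrite -e2 in e1 e3 *.
  have ci : c^-1 != 0 by rewrite qinv_eq0.
  by rewrite (qmulIl ci e1) (qmulIr c0 e3).
move=> w /mapP[[g [c d]]]; rewrite !mem_pairs !mem_filter /=.
move=> /and3P[_ /andP[gc cU] /andP[gd dU]] ->.
rewrite /h /= !mem_pairs !mem_filter cU gc /= mulVKr ?dU /=; last exact: memn0 cU.
rewrite mulrA mulrK; last exact: memn0 cU.
by rewrite gd !andbT; apply: (mem_rquo U0 cU); rewrite mulVKr //; exact: memn0 cU.
Qed.

Definition pwt (A B : seq quat) (p : quat) : nat := count (fun a => a^-1 * p \in B) A.

Lemma sum_mul (A B : seq quat) (F : quat -> R) : uniq B -> 0 \notin A ->
  \sum_(a <- A) \sum_(b <- B) F (a * b) = \sum_(p <- pset A B) (pwt A B p)%:R * F p.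
Proof.
move=> uB A0; under [RHS]eq_bigr => u _ do rewrite count_sum mulr_suml.
rewrite [RHS]exchange_big; apply: eq_sums => a aA /=; have a0 := memn0 A0 aA.
rewrite (sum_fiber (I := pset A B) (h := fun b => a * b)) ?undup_uniq //; last first.
  by move=> b bB; apply: mem_pset.
apply: eq_sums => p _.
transitivity (\sum_(b <- B) (a^-1 * p == b)%:R * F (a * b)).
  apply: eq_bigr => b _; congr (_%:R * _); congr nat_of_bool.
  by apply/eqP/eqP => [<-|<-]; rewrite ?mulKr // mulVKr.
by rewrite (sum_delta (a^-1 * p) (fun b => F (a * b))) // mulVKr.
Qed.

(** [a b = a' b'] means [a'^-1 a = b' b^-1], one kind of quotient in [A] and the other kind in [B].
    Cauchy-Schwarz separates the two, and [lenergy_le] brings them to the same side. *)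
Lemma pwt_energy (A B : seq quat) : uniq A -> uniq B -> 0 \notin A -> 0 \notin B ->
  (\sum_(p <- pset A B) (pwt A B p)%:R ^+ 2) ^+ 2 <= menergy A * menergy B :> R.
Proof.
move=> uA uB A0 B0.
have h1 : \sum_(p <- pset A B) (pwt A B p)%:R ^+ 2 <=
   \sum_(g <- rquo A) (mrep A g)%:R * (lrep B g)%:R :> R.
  have -> : \sum_(g <- rquo A) (mrep A g)%:R * (lrep B g)%:R =
      \sum_(a' <- A) \sum_(a <- A) (lrep B (a'^-1 * a))%:R :> R.
    under eq_bigr => g _ do rewrite count_sum mulr_suml.
    rewrite exchange_big; apply: eq_sums => a' aA /=; have a0 := memn0 A0 aA.
    rewrite [RHS](sum_fiber (I := rquo A) (h := fun a => a'^-1 * a)) ?undup_uniq //; last first.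
      by move=> a aA'; apply: (mem_rquo A0 aA); rewrite mulVKr.
    apply: eq_sums => g _; rewrite -(sum_delta (a' * g) (fun=> (lrep B g)%:R)) //.
    apply: eq_bigr => a _; case: (eqVneq (a' * g) a) => [<-|ne]; first by rewrite mulKr // eqxx.
    case: eqP => [e|_]; last by rewrite !mul0r.
    by move: ne; rewrite -e mulVKr // eqxx.
  under eq_bigr do rewrite expr2 count_sum big_distrlr /=.
  rewrite exchange_big; apply: ler_sums => a' aA'; rewrite exchange_big; apply: ler_sums => a aA /=.
  have a0 := memn0 A0 aA; have a0' := memn0 A0 aA'.
  under eq_bigr => z _ do rewrite -natrM mulnb.
  rewrite -count_sum ler_nat; apply: (count_inj (h := fun p => a^-1 * p)); rewrite ?undup_uniq //.
    by move=> x y _ _ /qmulIl; apply; rewrite qinv_eq0.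
  by move=> p _ /andP[pa' pa]; split => //; rewrite -mulrA mulVKr.
apply: le_trans (ler_sqr2 _ h1) _; first by apply: sumr_ge0 => p _; exact: sqr_ge0.
apply: le_trans (cauchy_schwarz _ _ _) _.
rewrite ler_wpM2l ?menergy_ge0 //; apply: le_trans (lenergy_le uB B0).
apply: (sum_inj (F := fun g => (lrep B g)%:R ^+ 2) (h := id)); rewrite ?undup_uniq //.
  by move=> z _; exact: sqr_ge0.
by move=> x _; rewrite sqrf_eq0 pnatr_eq0; exact: lrep_neq0.
Qed.

Lemma sum_pwt (A B : seq quat) : uniq B -> 0 \notin A ->
  \sum_(p <- pset A B) (pwt A B p)%:R = (size A)%:R * (size B)%:R :> R.
Proof.
move=> uB A0; have := sum_mul (fun=> 1) uB A0; under [RHS]eq_bigr do rewrite mulr1.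
by move=> <-; rewrite sum_const sum_const mulr1.
Qed.

Lemma pset_lower (A B : seq quat) : uniq A -> uniq B -> 0 \notin A -> 0 \notin B ->
  ((size A)%:R * (size B)%:R) ^+ 4 <= (size (pset A B))%:R ^+ 2 * (menergy A * menergy B).
Proof.
move=> uA uB A0 B0.
apply: le_trans (ler_wpM2l (sqr_ge0 _) (pwt_energy uA uB A0 B0)).
rewrite -exprMn [_ ^+ 4](exprM _ 2 2) -(sum_pwt uB A0); apply: ler_sqr2 (sqr_ge0 _) _.
exact: sqr_sum_le.
Qed.

Lemma sset_size_ge (U : seq quat) : uniq U -> (size U <= size (sset U U))%N.
Proof.
move=> uU; case eU: U => [//|c0 U']; rewrite -{}eU in uU *.
case: U uU => [//|c0' U0] uU.
rewrite -(size_map (fun c => c0' + c)); apply: uniq_leq_size.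
  by rewrite map_inj_uniq // => x y /addrI.
by move=> w /mapP[c cU ->]; rewrite mem_sset ?mem_head.
Qed.

Lemma mrep_le U x : (mrep U x <= size U)%N. Proof. exact: count_size. Qed.

(** Solymosi's bound on the dominant dyadic level of slopes; [5000 = 4 * 1250], the 4 being that of
    [dyadic]. *)
Lemma menergy_le (U : seq quat) (L : nat) : uniq U -> acute U -> (0 < L)%N ->
  (size U < 2 ^ L)%N -> menergy U <= 5000 * L%:R * (size (sset U U))%:R ^+ 2.
Proof.
move=> uU aU L0 UL; have U0 : 0 \notin U by case: aU.
have [x _|j jL] := @dyadic _ (rquo U) (mrep U) L 2 isT L0.
  exact: leq_ltn_trans (mrep_le _ _) UL.
move=> /le_trans; apply; rewrite [leRHS](_ : _ =
   L%:R * (2 ^+ 2 * (1250 * (size (sset U U))%:R ^+ 2))); last by ring.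
rewrite ler_wpM2l // -mulrA; apply: ler_wpM2l; first by rewrite exprn_ge0.
set S := [seq x <- rquo U | (2 ^ j <= mrep U x < 2 ^ j.+1)%N].
rewrite -size_filter -/S -!natrX -!natrM ler_nat mulnC.
have uS : uniq S by rewrite filter_uniq ?undup_uniq.
have tauS x : x \in S -> (2 ^ j <= size [seq c <- U | (c * x)%R \in U])%N.
  by rewrite mem_filter size_filter => /andP[/andP[]].
have [S1|S1] := ltnP 1 (size S).
  rewrite -mulnn; apply: (solymosi (U := U) (Bf := fun x => [seq c <- U | c * x \in U])) => //;
    rewrite ?undup_uniq // => x.
  - by move=> _ c; rewrite mem_filter => /andP[].
  - by rewrite filter_uniq.
  - move=> y c d _ _; rewrite !mem_filter => /andP[cx cU] /andP[dy dU].
    by rewrite !mem_sset.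
(* [solymosi] needs two slopes; for a single one the trivial bound [|U| <= |U + U|] suffices. *)
case eS : S S1 => [|x [|//]] _; first by rewrite mul0n.
rewrite mul1n; apply: (@leq_trans (size (sset U U) ^ 2)); last by rewrite leq_pmull.
rewrite leq_exp2r //; apply: leq_trans (sset_size_ge uU).
have xS : x \in S by rewrite eS mem_head.
by apply: leq_trans (tauS x xS) _; rewrite size_filter count_size.
Qed.

(** * Logarithms *)

Definition lg (x : R) : R := Rpower.ln x.

Lemma lgM (x y : R) : 0 < x -> 0 < y -> lg (x * y) = lg x + lg y.
Proof. by move=> /RltP x0 /RltP y0; rewrite /lg -RmultE Rpower.ln_mult // RplusE. Qed.

Lemma lg1 : lg 1 = 0. Proof. by rewrite /lg -R1E Rpower.ln_1. Qed.

Lemma lgX (x : R) n : 0 < x -> lg (x ^+ n) = n%:R * lg x.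
Proof.
move=> x0; elim: n => [|n IH]; first by rewrite expr0 lg1 mul0r.
by rewrite exprS lgM ?exprn_gt0 // IH -natr1 mulrDl mul1r addrC.
Qed.

Lemma lg_lt (x y : R) : 0 < x -> x < y -> lg x < lg y.
Proof. by move=> /RltP x0 /RltP xy; apply/RltP; apply: Rpower.ln_increasing. Qed.

Lemma lg_le (x y : R) : 0 < x -> x <= y -> lg x <= lg y.
Proof. by move=> x0; rewrite le_eqVlt => /orP[/eqP -> //|/(lg_lt x0)/ltW]. Qed.

Lemma lg_leV (x y : R) : 0 < y -> lg x <= lg y -> x <= y.
Proof. by move=> y0; apply: contraTT; rewrite -!ltNge; exact: lg_lt. Qed.

Lemma some_smallest (a b c : nat) : (0 < ((a <= b) && (a <= c)) +
  ((b <= a) && (b <= c)) + ((c <= b) && (c <= a)))%N.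
Proof.
case: (boolP (a <= b)%N); case: (boolP (a <= c)%N); case: (boolP (b <= a)%N);
case: (boolP (b <= c)%N); case: (boolP (c <= a)%N); case: (boolP (c <= b)%N) => //=; lia.
Qed.

(** * Triangles and near rings *)

Section Triangles.
Variables (Y : seq quat).
Hypothesis uY : uniq Y.
Local Notation Z := (dset Y Y).
Local Notation r := (rep Y Y).
Local Notation N := ((size Y)%:R : R).

Lemma repN u : r (- u) = r u.
Proof.
apply/eqP; rewrite eqn_leq; apply/andP; split.
  apply: (count_inj (h := fun d => d - u)) => // [x y _ _ /addIr //|d dY h].
  by rewrite subrK.
apply: (count_inj (h := fun d => d + u)) => // [x y _ _ /addIr //|d dY h].
by rewrite addrK.
Qed.

Lemma repB x y : r (x - y) = r (y - x). Proof. by rewrite -repN opprB. Qed.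

Lemma rep_pos x y : x \in Y -> y \in Y -> (0 < r (x - y))%N.
Proof.
move=> xY yY; rewrite -has_count; apply/hasP; exists y => //.
by rewrite addrC subrK.
Qed.

Let A z x : R := (x - z \in Y)%:R.

Let repA x y : x \in Y -> y \in Y -> (r (x - y))%:R = \sum_(z <- Z) A z x * A z y.
Proof.
move=> xY yY; under eq_bigr do rewrite /A -natrM mulnb.
rewrite -count_sum; congr (_%:R); apply/eqP; rewrite eqn_leq; apply/andP; split.
  apply: (count_inj (h := fun d => y - d)); rewrite ?undup_uniq //.
    by move=> a b _ _ /addrI /oppr_inj.
  move=> d dY h; rewrite subKr; split; first exact: mem_dset.
  by rewrite dY andbT (_ : x - (y - d) = d + (x - y)) //; qring.
apply: (count_inj (h := fun z => y - z)); rewrite ?undup_uniq //.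
  by move=> a b _ _ /addrI /oppr_inj.
move=> d dY /andP[h1 h2]; split => //.
by rewrite (_ : y - d + (x - y) = x - d) //; qring.
Qed.

Definition triangles : R := \sum_(x <- Y) \sum_(y <- Y) \sum_(w <- Y)
  (r (x - y))%:R * (r (y - w))%:R * (r (x - w))%:R.

(* The matrix r(x - y) is a Gram matrix, hence positive semidefinite: the trace of
   its cube is at least the cube of its average row sum. *)
Lemma triangles_lower : energy Y ^+ 3 <= N ^+ 3 * triangles.
Proof.
(* In matrix terms, let [R] be the matrix of [r (x - y)], that is, [A] transposed times [A]. Then
   [F = R 1], [g = A F] and [h = A 1], so that [|F|^2] is the inner product of [g] and [h], [|h|^2]
   is the energy, and [|g|^2 = |A R 1|^2] is at most [N] times the trace of [R^3]. *)
pose F y : R := \sum_(x <- Y) (r (x - y))%:R.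
have F0 y : 0 <= F y by apply: sumr_ge0.
have EF : energy Y = \sum_(y <- Y) F y by exact: energyE.
pose g z : R := \sum_(y <- Y) F y * A z y.
pose h z : R := \sum_(x <- Y) A z x.
have Eh : \sum_(z <- Z) h z ^+ 2 = energy Y.
  under eq_bigr do rewrite expr2 big_distrlr /=.
  rewrite exchange_big EF; apply: eq_sums => y yY; rewrite [LHS]exchange_big /=; apply: eq_sums => x xY /=.
  by rewrite repB repA.
have F2E : \sum_(y <- Y) F y ^+ 2 = \sum_(z <- Z) g z * h z.
  under [RHS]eq_bigr do rewrite /g /h big_distrlr /=.
  rewrite [RHS]exchange_big /=; apply: eq_sums => y yY; rewrite [RHS]exchange_big /=.
  rewrite expr2 [X in _ * X]/F mulr_sumr; apply: eq_sums => x xY; rewrite repB repA // mulr_sumr.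
  by apply: eq_bigr => z _; rewrite mulrA.
have F3 : \sum_(z <- Z) g z ^+ 2 <= N * triangles.
  have -> : triangles = \sum_(z <- Z) \sum_(y <- Y) (\sum_(x <- Y) A z x * (r (x - y))%:R) ^+ 2.
    under [RHS]eq_bigr do under eq_bigr do rewrite expr2 big_distrlr /=.
    rewrite exchange_big /= /triangles exchange_big /=; apply: eq_sums => y yY /=.
    rewrite [RHS]exchange_big /=; apply: eq_sums => x xY /=.
    rewrite [RHS]exchange_big /=; apply: eq_sums => w wY /=.
    rewrite (repB y w) (repA xY wY) mulr_sumr; apply: eq_bigr => z _; ring.
  rewrite mulr_sumr; apply: ler_sums => z _.
  apply: le_trans (sqr_sum_le _ _).
  rewrite exchange_big /= le_eqVlt; apply/orP; left; apply/eqP; congr (_ ^+ 2).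
  apply: eq_sums => x xY; rewrite -mulr_sumr mulrC; congr (_ * _).
  by apply: eq_bigr => y _; rewrite repB.
have E0 : 0 <= energy Y by rewrite EF; apply: sumr_ge0.
have T0 : 0 <= triangles.
  by do 3 (apply: sumr_ge0 => ? _); rewrite !mulr_ge0.
have [->|Ene] := eqVneq (energy Y) 0; first by rewrite expr0n /= mulr_ge0 ?exprn_ge0.
have Ep : 0 < energy Y by rewrite lt0r Ene.
have h1 : energy Y ^+ 2 <= N * \sum_(y <- Y) F y ^+ 2 by rewrite EF; exact: sqr_sum_le.
have h2 : (\sum_(y <- Y) F y ^+ 2) ^+ 2 <= N * triangles * energy Y.
  rewrite F2E; apply: le_trans (cauchy_schwarz _ _ _) _; rewrite Eh.
  by rewrite ler_wpM2r.
rewrite -(ler_pM2r Ep) -exprSr [energy Y ^+ 4](exprM _ 2 2).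
apply: le_trans (ler_sqr2 (sqr_ge0 _) h1) _.
have -> : N ^+ 3 * triangles * energy Y = N ^+ 2 * (N * triangles * energy Y) by ring.
by rewrite exprMn ler_wpM2l // sqr_ge0.
Qed.

Definition smallest x y w := (r (x - w) <= r (x - y))%N && (r (x - w) <= r (y - w))%N.

(** Some edge has the fewest representations, and the sum is symmetric in the edges. The restriction
    pays off because triangles with two given edge vectors are later bounded by the representations
    of the third edge. *)
Lemma triangles_smallest : triangles <= 3 * \sum_(x <- Y) \sum_(y <- Y) \sum_(w <- Y)
  (smallest x y w)%:R * ((r (x - y))%:R * (r (y - w))%:R * (r (x - w))%:R).
Proof.
set T1 := \sum_(x <- Y) _.
have e2 : T1 = \sum_(x <- Y) \sum_(y <- Y) \sum_(w <- Y)
  (smallest x w y)%:R * ((r (x - y))%:R * (r (y - w))%:R * (r (x - w))%:R) :> R.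
  apply: eq_bigr => x _; rewrite exchange_big /=; apply: eq_bigr => y _; apply: eq_bigr => w _.
  by rewrite (repB w y); congr (_ * _); ring.
have e3 : T1 = \sum_(x <- Y) \sum_(y <- Y) \sum_(w <- Y)
  (smallest y x w)%:R * ((r (x - y))%:R * (r (y - w))%:R * (r (x - w))%:R) :> R.
  rewrite /T1 exchange_big /=; apply: eq_bigr => x _; apply: eq_bigr => y _; apply: eq_bigr => w _.
  by rewrite (repB y x); congr (_ * _); ring.
have -> : 3 * T1 = T1 + T1 + T1 by ring.
rewrite {2}e2 {2}e3 /T1 -!big_split /triangles /=; apply: ler_sum => x _.
rewrite -!big_split; apply: ler_sum => y _; rewrite -!big_split; apply: ler_sum => w _ /=.
rewrite -!mulrDl ler_peMl ?mulr_ge0 //.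
rewrite -!natrD ler1n /smallest (repB w y) (repB y x).
exact: some_smallest.
Qed.

End Triangles.

Lemma leq_sqr_self (n : nat) : (n <= n ^ 2)%N.
Proof. by case: n => // n; rewrite -{1}[n.+1]expn1 leq_pexp2l. Qed.

Definition level (Y D : seq quat) (j : nat) : seq quat :=
  [seq w <- dset Y D | (2 ^ j <= rep Y D w < 2 ^ j.+1)%N].

Definition denergy (Y D : seq quat) : R := \sum_(w <- dset Y D) (rep Y D w)%:R ^+ 2.

Section NearRingBound.
Variables (Y C : seq quat) (K q : R) (L : nat).
Hypotheses (uY : uniq Y) (uC : uniq C) (C0 : 0 \notin C).
Hypotheses (K6 : 10 ^+ 6 <= K) (q1 : 1 <= q).
Hypotheses (L0 : (0 < L)%N) (LK : L%:R <= K).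
Hypothesis YL : (size Y ^ 2 < 2 ^ L)%N.
Hypothesis hY : (size Y)%:R <= K * q ^+ 4.
Hypothesis hC : q ^+ 4 <= K * (size C)%:R.
Hypothesis hYC : (size (pset Y C))%:R <= K * q ^+ 4.
Hypothesis hE : q ^+ 10 <= K * energy Y.

Let K0 : 0 < K. Proof. by apply: lt_le_trans K6; rewrite exprn_gt0. Qed.
Let q0 : 0 < q. Proof. exact: lt_le_trans q1. Qed.

(** Each [w] in the level and [c] in [C] give the line sending [x] to [(x + w) c], which carries at
    least [2 ^ j] points of [D] into [YC]; [rich_lines] then bounds [|W| |C|]. The case [j = 0] is
    excluded because a line needs two points. *)
Lemma level_rich (D : seq quat) (j : nat) : uniq D -> (0 < j)%N ->
  (size (level Y D j))%:R * (2 ^+ j) ^+ 3 <= K ^+ 6 * (size D)%:R ^+ 2 * q ^+ 4.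
Proof.
move=> uD j0; set W := level Y D j.
have uW : uniq W by rewrite filter_uniq ?undup_uniq.
have k2 : (2 <= 2 ^ j)%N by rewrite -{1}[2%N]/(2 ^ 1)%N leq_exp2l.
have LamP l : l \in [seq (w, c) | w <- W, c <- C] -> l.2 != 0 /\
     (2 ^ j <= count (fun x => ((x + l.1) * l.2)%R \in pset Y C) D)%N.
  case: l => [w c]; rewrite mem_pairs mem_filter /= => /andP[/andP[/andP[wj _] _] cC].
  split; first exact: memn0 cC.
  by apply: leq_trans wj _; apply: sub_count => x /= xw; apply: mem_pset.
have := rich_lines uD (undup_uniq _) (uniq_pairs uW (fun _ _ => uC)) k2 LamP.
rewrite size_allpairs -(ler_nat R) !(natrM, natrX) => h.
have qn0 : 0 < q ^+ 4 by rewrite exprn_gt0.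
have Cn : 0 < (size C)%:R :> R by rewrite -(pmulr_rgt0 _ K0); apply: lt_le_trans hC.
rewrite -(ler_pM2r Cn); apply: le_trans (_ : 2 * (2504 * (size D)%:R) ^+ 2 * (2504 * (K * q ^+ 4)) ^+ 2 <= _).
  apply: le_trans (_ : 2 * (2504 * (size D)%:R) ^+ 2 * (2504 * (size (pset Y C))%:R) ^+ 2 <= _).
    by move: h; rewrite mulrAC.
  apply: ler_wpM2l; first by rewrite mulr_ge0 ?sqr_ge0.
  by apply: ler_sqr2; [rewrite mulr_ge0 | rewrite ler_wpM2l].
have -> : 2 * (2504 * (size D)%:R) ^+ 2 * (2504 * (K * q ^+ 4)) ^+ 2 =
  (2 * 2504 ^+ 4) * (K ^+ 2 * (size D)%:R ^+ 2 * q ^+ 4) * q ^+ 4 by ring.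
have -> : K ^+ 6 * (size D)%:R ^+ 2 * q ^+ 4 * (size C)%:R =
  K ^+ 3 * (K ^+ 2 * (size D)%:R ^+ 2 * q ^+ 4) * (K * (size C)%:R) by ring.
apply: ler_pM => //; first by rewrite !mulr_ge0 ?exprn_ge0 // ltW.
  by rewrite ltW.
apply: ler_wpM2r; first by rewrite !mulr_ge0 ?exprn_ge0 // ltW.
have : (10 ^+ 6) ^+ 3 <= K ^+ 3 by rewrite ler_pXn2r ?nnegrE ?exprn_ge0 // ltW.
by apply: le_trans; lra.
Qed.

Lemma level_pairs (D : seq quat) (j : nat) :
  (size (level Y D j))%:R * 2 ^+ j <= K * q ^+ 4 * (size D)%:R.
Proof.
apply: (@le_trans _ _ ((size Y)%:R * (size D)%:R)); last by rewrite ler_wpM2r.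
apply: le_trans (popular_size D (2 ^+ j) uY); rewrite ler_wpM2r ?exprn_ge0 // ler_nat.
rewrite /level size_filter; apply: sub_count => w /= /andP[h _].
by rewrite -natrX ler_nat.
Qed.

Lemma levelY (j : nat) : (size (level Y Y j))%:R * (2 ^+ j) ^+ 3 <= K ^+ 8 * q ^+ 12.
Proof.
case: j => [|j].
  rewrite !expr0 expr1n mulr1; have := level_pairs Y 0; rewrite expr0 mulr1 => /le_trans; apply.
  apply: le_trans (_ : K * q ^+ 4 * (K * q ^+ 4) <= _).
    by rewrite ler_wpM2l // mulr_ge0 ?exprn_ge0 // ltW.
  have -> : K * q ^+ 4 * (K * q ^+ 4) = K ^+ 2 * q ^+ 8 by ring.
  apply: ler_pM; rewrite ?exprn_ge0 ?(ltW K0) ?(ltW q0) //.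
    by rewrite ler_weXn2l //; apply: le_trans K6; lra.
  by rewrite ler_weXn2l.
apply: le_trans (@level_rich Y j.+1 uY isT) _.
apply: le_trans (_ : K ^+ 6 * (K * q ^+ 4) ^+ 2 * q ^+ 4 <= _); last first.
  by rewrite le_eqVlt; apply/orP; left; apply/eqP; ring.
apply: ler_wpM2r; first by rewrite exprn_ge0 // ltW.
by apply: ler_wpM2l; [rewrite exprn_ge0 // ltW | apply: ler_sqr2].
Qed.

Definition energy3 : R := \sum_(u <- dset Y Y) (rep Y Y u)%:R ^+ 3.

Let repL D w : uniq D -> (rep Y D w < 2 ^ L)%N.
Proof.
move=> uD; apply: leq_ltn_trans YL; apply: (@leq_trans (size Y)).
  rewrite -(count_predT Y); apply: (count_inj (h := fun d => d + w)) => //.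
  by move=> x y _ _ /addIr.
exact: leq_sqr_self.
Qed.

Lemma energy3_le : energy3 <= K ^+ 11 * q ^+ 12.
Proof.
have [x _|j _] := @dyadic _ (dset Y Y) (rep Y Y) L 3 isT L0; first exact: repL.
move=> /le_trans; apply; rewrite -size_filter -/(level Y Y j).
have -> : K ^+ 11 * q ^+ 12 = K * (K ^+ 2 * (K ^+ 8 * q ^+ 12)) by ring.
apply: ler_pM => //; first by rewrite mulr_ge0 // mulr_ge0 ?exprn_ge0 // exprn_ge0.
rewrite -mulrA; apply: ler_pM; rewrite ?exprn_ge0 ?mulr_ge0 ?exprn_ge0 //.
  have : 10 ^+ 6 * 10 ^+ 6 <= K ^+ 2 by rewrite expr2 ler_pM ?exprn_ge0.
  lra.
by rewrite mulrC levelY.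
Qed.

(** Interpolation between the trivial count of pairs and [level_rich]:
    [(|W| 4^j)^2 = (|W| 2^j) (|W| 8^j)]. *)
Lemma denergy_le (D : seq quat) : uniq D ->
  denergy Y D ^+ 2 <= K ^+ 12 * q ^+ 8 * (size D)%:R ^+ 3.
Proof.
move=> uD.
have [x _|j _] := @dyadic _ (dset Y D) (rep Y D) L 2 isT L0; first exact: repL.
rewrite -size_filter -/(level Y D j) -/(denergy Y D).
set W : R := (size (level Y D j))%:R => h.
have h2 : ((2 ^+ j) ^+ 2 * W) ^+ 2 <= K ^+ 7 * q ^+ 8 * (size D)%:R ^+ 3.
  have -> : ((2 ^+ j) ^+ 2 * W) ^+ 2 = (W * 2 ^+ j) * (W * (2 ^+ j) ^+ 3) :> R by ring.
  have W0 : 0 <= W by [].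
  have e0 : K ^+ 7 * q ^+ 8 * (size D)%:R ^+ 3 =
    (K * q ^+ 4 * (size D)%:R) * (K ^+ 6 * (size D)%:R ^+ 2 * q ^+ 4) by ring.
  rewrite e0; apply: ler_pM; rewrite ?mulr_ge0 ?exprn_ge0 //; first exact: level_pairs.
  have [e|/(level_rich uD)] := posnP j; last exact.
  have := level_pairs D j; rewrite -/W e !expr0 expr1n !mulr1 => /le_trans; apply.
  rewrite [leRHS](_ : _ = K ^+ 6 * q ^+ 4 * (size D)%:R ^+ 2); last by ring.
  apply: ler_pM; rewrite ?mulr_ge0 ?exprn_ge0 ?(ltW K0) ?(ltW q0) //.
    rewrite ler_wpM2r ?exprn_ge0 ?(ltW q0) // -{1}[K]expr1 ler_weXn2l //.
    by apply: le_trans K6; lra.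
  by rewrite -natrX ler_nat leq_sqr_self.
have d0 : 0 <= denergy Y D by apply: sumr_ge0 => w _; exact: sqr_ge0.
apply: le_trans (ler_sqr2 d0 h) _.
have -> : (L%:R * (2 ^+ 2 * (2 ^+ j) ^+ 2 * W)) ^+ 2 =
  L%:R ^+ 2 * (16 * ((2 ^+ j) ^+ 2 * W) ^+ 2) :> R by ring.
apply: le_trans (_ : K ^+ 2 * (K * (K ^+ 7 * q ^+ 8 * (size D)%:R ^+ 3)) <= _).
  apply: ler_pM; first exact: sqr_ge0; first by apply: mulr_ge0 => //; exact: sqr_ge0.
    exact: (ler_sqr2 (ler0n _ _) LK).
  apply: ler_pM; rewrite ?sqr_ge0 //; first by apply: le_trans K6; lra.
set e := (size D)%:R ^+ 3.
have e0 : 0 <= q ^+ 8 * e by rewrite mulr_ge0 ?exprn_ge0 // ltW.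
have -> : K ^+ 2 * (K * (K ^+ 7 * q ^+ 8 * e)) = K ^+ 10 * (q ^+ 8 * e) by ring.
rewrite -[leRHS]mulrA; apply: ler_wpM2r => //.
by rewrite ler_weXn2l //; apply: le_trans K6; lra.
Qed.

Definition common (u v : quat) : nat := count (fun y => (y + u \in Y) && (y + v \in Y)) Y.

Lemma common_rep u v : (common u v <= rep Y Y (u - v))%N.
Proof.
apply: (count_inj (h := fun y => y + v)) => // [x y _ _ /addIr //|y yY /andP[yu yv]].
by split => //; rewrite (_ : y + v + (u - v) = y + u) //; qring.
Qed.

(** The left side counts [(y, y', u, v)] with [y + u], [y + v], [y' + u], [y' + v] all in [Y]. For
    fixed [y], [y'] there are at most [rep Y Y (y - y')] choices each for [u] and [v], and summing
    the square over pairs gives the third moment. *)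
Lemma sum_common : \sum_(u <- dset Y Y) \sum_(v <- dset Y Y) (common u v)%:R ^+ 2 <= energy3.
Proof.
have h (y y' : quat) : y \in Y -> y' \in Y ->
   (count (fun u => ((y + u)%R \in Y) && ((y' + u)%R \in Y)) (dset Y Y) <= rep Y Y (y - y'))%N.
  move=> yY yY'; apply: (count_inj (h := fun u => y' + u)); rewrite ?undup_uniq //.
    by move=> a b _ _ /addrI.
  by move=> u _ /andP[h1 h2]; split => //; rewrite (_ : y' + u + (y - y') = y + u) //; qring.
have -> : energy3 = \sum_(y <- Y) \sum_(y' <- Y) (rep Y Y (y' - y))%:R * (rep Y Y (y' - y))%:R.
  rewrite (sum_diff Y (fun u => (rep Y Y u)%:R * (rep Y Y u)%:R) uY).
  by apply: eq_bigr => u _; rewrite exprS expr2.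
have -> : \sum_(u <- dset Y Y) \sum_(v <- dset Y Y) (common u v)%:R ^+ 2 =
   \sum_(y <- Y) \sum_(y' <- Y)
   (count (fun u => (y' + u \in Y) && (y + u \in Y)) (dset Y Y))%:R *
   (count (fun u => (y' + u \in Y) && (y + u \in Y)) (dset Y Y))%:R :> R.
  under eq_bigr do under eq_bigr do rewrite expr2 count_sum big_distrlr /=.
  under eq_bigr do rewrite exchange_big /=.
  rewrite exchange_big /=; apply: eq_bigr => y _.
  under eq_bigr do rewrite exchange_big /=.
  rewrite exchange_big /=; apply: eq_bigr => y' _.
  rewrite count_sum big_distrlr /=; apply: eq_bigr => u _; apply: eq_bigr => v _.
  rewrite -!natrM !mulnb; congr (nat_of_bool _)%:R.
  by rewrite andbACA [(y + u \in Y) && _]andbC [(y + v \in Y) && _]andbC.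
apply: ler_sums => y yY; apply: ler_sums => y' yY'.
by rewrite -!natrM ler_nat leq_mul // h.
Qed.

(** For [z] in [Y], having [z + (u - v)] in [Y] reads: [v + w] and [u + w] are in [Y], where
    [w = z - v]. Then Cauchy-Schwarz over [w]. *)
Lemma sum_rep_dset (D1 D2 : seq quat) : uniq D1 -> uniq D2 ->
  (\sum_(u <- D1) \sum_(v <- D2) (rep Y Y (u - v))%:R) ^+ 2 <= denergy Y D1 * denergy Y D2.
Proof.
move=> u1 u2.
have -> : \sum_(u <- D1) \sum_(v <- D2) (rep Y Y (u - v))%:R =
   \sum_(w <- dset Y D2) (rep Y D2 w)%:R * (rep Y D1 w)%:R :> R.
  rewrite [RHS](eq_bigr (fun w => \sum_(u <- D1) (rep Y D2 w)%:R * (u + w \in Y)%:R)); last first.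
    by move=> w _; rewrite [(rep Y D1 w)%:R]count_sum mulr_sumr.
  rewrite [RHS]exchange_big /=; apply: eq_bigr => u _.
  rewrite -(sum_diff D2 (fun w => (u + w \in Y)%:R) uY).
  apply: eq_bigr => v _; rewrite /rep count_sum; apply: eq_bigr => z _.
  by rewrite (_ : z + (u - v) = u + (z - v)) //; qring.
apply: le_trans (cauchy_schwarz _ _ _) _; rewrite mulrC ler_wpM2r //.
  by apply: sumr_ge0 => w _; exact: sqr_ge0.
apply: (sum_inj (F := fun w => (rep Y D1 w)%:R ^+ 2) (h := id)); rewrite ?undup_uniq //.
  by move=> w _; exact: sqr_ge0.
by move=> w _; rewrite sqrf_eq0 pnatr_eq0; exact: rep_gt0.
Qed.

Lemma near_ring_bound : q <= K ^+ 200.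
Proof.
pose L' := L.-1; have eL : L = L'.+1 by rewrite prednK.
pose r := rep Y Y.
have rB a b : r (a - b) = r (b - a) := repB uY a b.
pose lev n : 'I_L'.+1 := inord (trunc_log 2 n).
have levP n : (0 < n)%N -> (n < 2 ^ L)%N -> (2 ^ lev n <= n < 2 ^ (lev n).+1)%N.
  move=> n0 nL; rewrite inordK; first exact: trunc_log_bounds.
  by rewrite -eL; exact: trunc_log_lt.
pose key (t : quat * (quat * quat)) := (lev (r (t.1 - t.2.1)), lev (r (t.2.2 - t.2.1)),
  lev (r (t.1 - t.2.2))).
pose F (t : quat * (quat * quat)) : R :=
  (r (t.1 - t.2.1))%:R * (r (t.2.1 - t.2.2))%:R * (r (t.1 - t.2.2))%:R.
pose YY := [seq (y, w) | y <- Y, w <- Y].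
pose TL := [seq t <- [seq (x, p) | x <- Y, p <- YY] | smallest Y t.1 t.2.1 t.2.2].
have uTL : uniq TL by rewrite filter_uniq // uniq_pairs // => _ _; exact: uniq_pairs.
have TLP t : t \in TL -> [/\ t.1 \in Y, t.2.1 \in Y, t.2.2 \in Y & smallest Y t.1 t.2.1 t.2.2].
  by case: t => x [y w]; rewrite mem_filter !mem_pairs => /and3P[? ? /andP[]].
have hT : triangles Y <= 3 * \sum_(t <- TL) F t.
  apply: le_trans (triangles_smallest uY) _; rewrite ler_wpM2l //.
  rewrite big_filter [leRHS]big_mkcond big_allpairs_dep; apply: ler_sum => x _.
  rewrite [leRHS]big_allpairs_dep; apply: ler_sum => y _; apply: ler_sum => w _ /=.
  by case: ifP => _; rewrite ?mul1r ?mul0r.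
have [|j hj] := @pigeonhole _ _ TL key F; first by rewrite !card_prod !card_ord.
rewrite !card_prod !card_ord in hj.
case: j hj => [[j1 j2] j3]; rewrite -[X in _ <= _ * X]big_filter; set S3 := filter _ _ => hj.
have uS3 : uniq S3 by exact: filter_uniq.
have S3P t : t \in S3 -> [/\ t \in TL, lev (r (t.1 - t.2.1)) = j1,
    lev (r (t.2.2 - t.2.1)) = j2 & lev (r (t.1 - t.2.2)) = j3].
  rewrite mem_filter => /andP[/eqP e tT]; split => //; first exact: (congr1 (fun p : 'I_L'.+1 * 'I_L'.+1 * 'I_L'.+1 => p.1.1) e).
    exact: (congr1 (fun p : 'I_L'.+1 * 'I_L'.+1 * 'I_L'.+1 => p.1.2) e).
  exact: (congr1 (fun p : 'I_L'.+1 * 'I_L'.+1 * 'I_L'.+1 => p.2) e).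
pose D1 := level Y Y j1; pose D2 := level Y Y j2; pose D3 := level Y Y j3.
have uD i : uniq (level Y Y i) by rewrite filter_uniq ?undup_uniq.
have levD x y : x \in Y -> y \in Y -> x - y \in level Y Y (lev (r (x - y))).
  by move=> xY yY; rewrite mem_filter mem_dset // levP // ?rep_pos // repL.
(* A triangle [(x, y, w)] is recorded by the vertex [y] and the edges [u = x - y], [v = w - y]; the
   third edge is then [x - w = u - v]. *)
pose Qs := [seq (u, v) | u <- D1, v <- [seq v <- D2 | u - v \in D3]].
have uQ : uniq Qs.
  by apply: uniq_pairs => [|u _]; rewrite ?(filter_uniq _ (uD _)) ?uD.
have QP p : p \in Qs -> [/\ p.1 \in D1, p.2 \in D2 & p.1 - p.2 \in D3].
  case: p => u v; rewrite mem_pairs => /andP[u1].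
  by rewrite (mem_filter (fun v => u - v \in D3)) => /andP[].
have cnt : (size S3 <= \sum_(p <- Qs) common p.1 p.2)%N.
  pose X := [seq (p, y) | p <- Qs, y <- [seq y <- Y | (y + p.1 \in Y) && (y + p.2 \in Y)]].
  apply: (@leq_trans (size X)); last first.
    by rewrite size_pairs; apply: leq_sums => p _; rewrite size_filter.
  pose h (t : quat * (quat * quat)) := ((t.1 - t.2.1, t.2.2 - t.2.1), t.2.1).
  rewrite -(size_map h); apply: uniq_leq_size.
    rewrite map_inj_uniq // => -[x [y w]] [x' [y' w']] e.
    have e1 : y = y' := congr1 snd e; rewrite e1 in e *.
    have /addIr -> : x - y' = x' - y' := congr1 (fun p => p.1.1) e.
    by have /addIr -> : w - y' = w' - y' := congr1 (fun p => p.1.2) e.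
  move=> z /mapP[[x [y w]]] /S3P[/TLP[/= xY yY wY _] e1 e2 e3] ->.
  have d1 : x - y \in D1 by rewrite /D1 -e1; exact: levD.
  have d2 : w - y \in D2 by rewrite /D2 -e2; exact: levD.
  have d3 : x - y - (w - y) \in D3.
    rewrite (_ : x - y - (w - y) = x - w); last by rewrite opprB addrA subrK.
    by rewrite /D3 -e3; exact: levD.
  have pQ : (x - y, w - y) \in Qs.
    by rewrite mem_pairs d1 (mem_filter (fun v => x - y - v \in D3)) d3.
  by rewrite mem_pairs pQ mem_filter /= yY andbT ![y + _]addrC !subrK xY.
have [T0|T0] := leP (triangles Y) 0.
  have := triangles_lower uY; rewrite leNgt; case/negP.
  apply: le_lt_trans (_ : 0 < _); first by rewrite mulr_ge0_le0 ?exprn_ge0.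
  by rewrite exprn_gt0 // -(pmulr_rgt0 _ K0); apply: lt_le_trans hE; rewrite exprn_gt0.
have Fb t : t \in S3 -> F t <= 8 * (2 ^+ j1 * 2 ^+ j2 * 2 ^+ j3).
  case: t => x [y w] /S3P[/TLP[/= xY yY wY _] e1 e2 e3]; rewrite /F /= (rB y w).
  have b a b : a \in Y -> b \in Y -> (r (a - b))%:R <= 2 * 2 ^+ lev (r (a - b)) :> R.
    move=> aY bY; rewrite -exprS -natrX ler_nat ltnW //.
    by have /andP[] := levP (r (a - b)) (rep_pos aY bY) (repL _ uY).
  have -> : 8 * (2 ^+ j1 * 2 ^+ j2 * 2 ^+ j3) =
     (2 * 2 ^+ j1) * (2 * 2 ^+ j2) * (2 * 2 ^+ j3) :> R by ring.
  by rewrite -e1 -e2 -e3 !ler_pM ?mulr_ge0 ?b.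
have hS : triangles Y <= 3 * (L%:R ^+ 3 * ((size S3)%:R * (8 * (2 ^+ j1 * 2 ^+ j2 * 2 ^+ j3)))).
  apply: le_trans hT _; rewrite ler_wpM2l //; apply: le_trans hj _.
  have -> : (L'.+1 * L'.+1 * L'.+1)%:R = L%:R ^+ 3 :> R by rewrite -eL !natrM; ring.
  by rewrite ler_wpM2l ?exprn_ge0 //; apply: sum_leC.
have S3n : (0 < size S3)%N.
  by case: (size S3) hS => //; rewrite mul0r !mulr0 leNgt T0.
have j31 : (j3 <= j1)%N /\ (j3 <= j2)%N.
  case eS : S3 S3n => [//|t S] _; have := mem_head t S; rewrite -eS.
  case: t eS => x [y w] _ /S3P[/TLP[/= xY yY wY /andP[s1 s2]] e1 e2 e3].
  rewrite -/(r (y - w)) rB in s2.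
  have b a b : a \in Y -> b \in Y -> (2 ^ lev (r (a - b)%R) <= r (a - b)%R < 2 ^ (lev (r (a - b)%R)).+1)%N.
    by move=> aY bY; apply: levP; [exact: rep_pos | exact: repL].
  have /andP[b1 _] := b _ _ xY wY; have /andP[_ b2] := b _ _ xY yY.
  have /andP[_ b3] := b _ _ wY yY.
  rewrite e1 in b2; rewrite e2 in b3; rewrite e3 in b1; split; rewrite -ltnS.
    by rewrite -(ltn_exp2l _ _ (isT : (1 < 2)%N)); apply: leq_ltn_trans b2; apply: leq_trans s1.
  by rewrite -(ltn_exp2l _ _ (isT : (1 < 2)%N)); apply: leq_ltn_trans b3; apply: leq_trans s2.
have hb' : (size S3)%:R <= (size Qs)%:R * (2 * 2 ^+ j3) :> R.
  rewrite -exprS -natrX -natrM ler_nat; apply: leq_trans cnt _; apply: sum_nat_leC => p.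
  move=> /QP[_ _]; rewrite mem_filter => /andP[/andP[_ h] _].
  by apply: ltnW; apply: leq_ltn_trans h; exact: common_rep.
have Qn : (0 < size Qs)%N.
  by case: (posnP (size Qs)) => // e; move: hb'; rewrite e mul0r lern0 eqn0Ngt S3n.
have hb : (size S3)%:R ^+ 2 <= (size Qs)%:R * energy3 :> R.
  apply: (@le_trans _ _ ((\sum_(p <- Qs) (common p.1 p.2)%:R) ^+ 2)).
    by apply: ler_sqr2 => //; rewrite -natr_sum ler_nat.
  apply: le_trans (sqr_sum_le _ _) _; rewrite ler_wpM2l //.
  apply: le_trans sum_common.
  have -> : \sum_(u <- dset Y Y) \sum_(v <- dset Y Y) (common u v)%:R ^+ 2 =
      \sum_(p <- [seq (u, v) | u <- dset Y Y, v <- dset Y Y]) (common p.1 p.2)%:R ^+ 2 :> R.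
    by rewrite big_allpairs_dep.
  apply: (sum_inj (F := fun p => (common p.1 p.2)%:R ^+ 2) (h := id)) => //.
  - by apply: uniq_pairs => [|? _]; exact: undup_uniq.
  - by move=> p _; exact: sqr_ge0.
  by move=> [u v] /QP[/=]; rewrite !mem_filter mem_pairs => /andP[_ ->] /andP[_ ->].
have hc : (2 ^+ j3 * (size Qs)%:R) ^+ 2 <= denergy Y D1 * denergy Y D2.
  apply: le_trans (sum_rep_dset (uD _) (uD _)); apply: ler_sqr2.
    by rewrite mulr_ge0 // exprn_ge0.
  apply: (@le_trans _ _ (\sum_(p <- Qs) (r (p.1 - p.2))%:R)).
    rewrite mulrC; apply: sum_geC => p /QP[_ _]; rewrite mem_filter => /andP[/andP[h _] _].
    by rewrite -natrX ler_nat.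
  rewrite big_allpairs_dep; apply: ler_sums => u _; rewrite big_filter [leLHS]big_mkcond.
  by apply: ler_sums => v _; case: ifP.
have hd : (size Qs)%:R <= (size D1)%:R * (size D2)%:R :> R.
  rewrite -natrM ler_nat size_pairs; apply: sum_nat_leC => u _.
  by rewrite size_filter count_size.
have D12 : 0 < (size D1)%:R * (size D2)%:R :> R by apply: lt_le_trans hd; rewrite ltr0n.
have D1n : 0 < (size D1)%:R :> R.
  by rewrite lt0r ler0n andbT; apply: contraTneq D12 => ->; rewrite mul0r ltxx.
have D2n : 0 < (size D2)%:R :> R by rewrite -(pmulr_rgt0 _ D1n).
have E0 : 0 < energy Y.
  by rewrite -(pmulr_rgt0 _ K0); apply: lt_le_trans hE; rewrite exprn_gt0.
have N0 : 0 < (size Y)%:R :> R.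
  rewrite lt0r ler0n andbT; apply: contraTneq E0 => e; rewrite -leNgt energyE //.
  by move/eqP: e; rewrite pnatr_eq0 => /nilP ->; rewrite big_nil.
have Pn : 0 < denergy Y D1 * denergy Y D2.
  by apply: lt_le_trans hc; rewrite exprn_gt0 // mulr_gt0 ?exprn_gt0 // ltr0n.
have P2 : (denergy Y D1 * denergy Y D2) ^+ 2 <=
   K ^+ 24 * q ^+ 16 * ((size D1)%:R * (size D2)%:R) ^+ 3.
  rewrite exprMn; apply: le_trans (ler_pM (sqr_ge0 _) (sqr_ge0 _)
    (denergy_le (uD _)) (denergy_le (uD _))) _.
  by rewrite le_eqVlt; apply/orP; left; apply/eqP; ring.
move: hc Pn P2; set P := denergy Y D1 * denergy Y D2 => hc Pn P2.
have S3r : 0 < (size S3)%:R :> R by rewrite ltr0n.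
have Qr : 0 < (size Qs)%:R :> R by rewrite ltr0n.
have e3 : 0 < energy3.
  by rewrite -(pmulr_rgt0 _ Qr); apply: lt_le_trans hb; rewrite exprn_gt0.
have two n : 0 < 2 ^+ n :> R by rewrite exprn_gt0.
have Kn n : 0 < K ^+ n by rewrite exprn_gt0.
have qn n : 0 < q ^+ n by rewrite exprn_gt0.
have Lr : 0 < L%:R :> R by rewrite ltr0n.
have l31 : lg (2 ^+ j3) <= lg (2 ^+ j1).
  by apply: lg_le => //; rewrite ler_weXn2l ?ler1n //; case: j31.
have l32 : lg (2 ^+ j3) <= lg (2 ^+ j2).
  by apply: lg_le => //; rewrite ler_weXn2l ?ler1n //; case: j31.
have pos := (mulr_gt0, exprn_gt0, K0, q0, N0, T0, E0, e3, S3r, Qr, Lr, D1n, D2n, two, Pn).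
have lK : 0 <= lg K by rewrite -lg1; apply: lg_le => //; apply: le_trans K6; lra.
have l24 : lg 24 <= lg K by apply: lg_le => //; apply: le_trans K6; lra.
have lL := lg_le Lr LK.
have := lg_le (qn _) hE; rewrite (lgX 10 q0) (lgM K0 E0) => a1.
have := lg_le N0 hY; rewrite (lgM K0 (qn 4)) (lgX 4 q0) => a2.
have := lg_le (exprn_gt0 3 E0) (triangles_lower uY).
rewrite (lgM (exprn_gt0 3 N0) T0) (lgX 3 E0) (lgX 3 N0) => a3.
have hS' : triangles Y <= 24 * (L%:R ^+ 3 * ((size S3)%:R * (2 ^+ j1 * (2 ^+ j2 * 2 ^+ j3)))).
  by apply: le_trans hS _; rewrite le_eqVlt; apply/orP; left; apply/eqP; ring.
have h24 : 0 < 24 :> R by [].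
have p23 := mulr_gt0 (two j2) (two j3); have p123 := mulr_gt0 (two j1) p23.
have pS := mulr_gt0 S3r p123; have pL := exprn_gt0 3 Lr.
have := lg_le T0 hS'; rewrite (lgM h24 (mulr_gt0 pL pS)) (lgM pL pS) (lgX 3 Lr).
rewrite (lgM S3r p123) (lgM (two j1) p23) (lgM (two j2) (two j3)) => a4.
have h2 : 0 < 2 :> R by [].
have := lg_le S3r hb'; rewrite (lgM Qr (mulr_gt0 h2 (two j3))) (lgM h2 (two j3)) => a5.
have := lg_le (exprn_gt0 2 S3r) hb; rewrite (lgX 2 S3r) (lgM Qr e3) => a6.
have := lg_le e3 energy3_le; rewrite (lgM (Kn 11) (qn 12)) (lgX 11 K0) (lgX 12 q0) => a7.
have c2 := mulr_gt0 (two j3) Qr.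
have := lg_le (exprn_gt0 2 c2) hc; rewrite (lgX 2 c2) (lgM (two j3) Qr) => a8.
have := lg_le (exprn_gt0 2 Pn) P2; rewrite (lgX 2 Pn).
rewrite (lgM (mulr_gt0 (Kn 24) (qn 16)) (exprn_gt0 3 D12)) (lgM (Kn 24) (qn 16)).
rewrite (lgX 24 K0) (lgX 16 q0) (lgX 3 D12) (lgM D1n D2n) => a9.
have := lg_le Qr hd; rewrite (lgM D1n D2n) => a10.
have c4 i : 0 < (size (level Y Y i))%:R :> R -> lg (size (level Y Y i))%:R + 3 * lg (2 ^+ i) <=
    8 * lg K + 12 * lg q.
  move=> li; have := lg_le (mulr_gt0 li (exprn_gt0 3 (two i))) (levelY i).
  by rewrite (lgM li (exprn_gt0 3 (two i))) (lgX 3 (two i)) (lgM (Kn 8) (qn 12)) (lgX 8 K0) (lgX 12 q0).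
have a11 := c4 _ D1n; have a12 := c4 _ D2n; rewrite -/D1 in a11; rewrite -/D2 in a12.
have l2 : lg 2 <= lg K by apply: lg_le => //; apply: le_trans K6; lra.
(* Up to powers of [K], let [T] be [triangles Y] and [m = 2^(j1 + j2)], so that [2^j3 <= m^(1/2)].
   The lower bound is [T >= q^18]. From [hb'], [hd] and [levelY] one gets [T <= q^24 / m]; from
   [hb], [energy3_le], [hc], [P2] and [levelY] one gets [T <= q^17 m^(1/8)]. Eliminating [m] yields
   [T^9 <= q^160], so that [q^2] is at most a power of [K]. *)
apply: (lg_leV (Kn 200)); rewrite (lgX 200 K0).
move: lK l24 lL l2 l31 l32 a1 a2 a3 a4 a5 a6 a7 a8 a9 a10 a11 a12; clear.
by move: (lg K) (lg q) (lg L%:R) (lg 24) (lg 2) (lg (2 ^+ j1)) (lg (2 ^+ j2)) (lg (2 ^+ j3))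
  (lg (energy Y)) (lg (triangles Y)) (lg energy3) (lg P) (lg (size Y)%:R) (lg (size S3)%:R)
  (lg (size Qs)%:R) (lg (size D1)%:R) (lg (size D2)%:R) => *; lra.
Qed.

End NearRingBound.

(** * Fibres with additive structure *)

Definition fibre (A : seq quat) (x : quat) : seq quat := [seq c <- A | c * x \in A].

(** The extremal sizes up to [K]: [|B|] and [|B + B|] are about [q^2], the multiplicative energy is
    nearly the least possible for such a set, and [AB] fills a large part of [AA]. *)
Record good_fibre (A : seq quat) (K q : R) (x : quat) (B : seq quat) : Prop := GoodFibre {
  gf_uniq : uniq B;
  gf_sub : {subset B <= fibre A x};
  gf_lo : q ^+ 2 <= K * (size B)%:R;
  gf_hi : (size B)%:R <= K * q ^+ 2;
  gf_sum : (size (sset B B))%:R <= K * q ^+ 2;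
  gf_energy : menergy B <= K * q ^+ 4;
  gf_prod : q ^+ 4 <= K * (size (pset A B))%:R }.

Lemma sum_mrep (A : seq quat) : uniq A -> 0 \notin A ->
  \sum_(x <- rquo A) (mrep A x)%:R <= (size A)%:R ^+ 2 :> R.
Proof.
move=> uA A0; under eq_bigr do rewrite count_sum.
rewrite exchange_big expr2; apply: sum_leC => c cA /=; rewrite -count_sum ler_nat -(count_predT A).
apply: (count_inj (h := fun x => c * x)); rewrite ?undup_uniq //.
by move=> x y _ _; apply: qmulIl; exact: memn0 cA.
Qed.

Lemma acute_sub (A B : seq quat) : acute A -> {subset B <= A} -> acute B.
Proof.
move=> [A0 AP] BA; split; first by apply: contra A0; exact: BA.
by move=> u v /BA uA /BA vA; exact: AP.
Qed.

Lemma half_compl (s g b : nat) : (g + b = s)%N -> (2 * g < s)%N -> (s <= 2 * b)%N.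
Proof. by lia. Qed.

Lemma half_pos (s b : nat) : (0 < s)%N -> (s <= 2 * b)%N -> (0 < b)%N.
Proof. by lia. Qed.

Section StructuredFibres.
Variables (A : seq quat) (K q : R) (L : nat).
Hypotheses (uA : uniq A) (aA : acute A).
Hypotheses (K6 : 10 ^+ 6 <= K) (q1 : 1 <= q).
Hypotheses (L0 : (0 < L)%N) (LK : L%:R <= K).
Hypothesis AL : (size A < 2 ^ L)%N.
Hypothesis hA : (size A)%:R = q ^+ 3.
Hypothesis hAA : (size (sset A A))%:R <= K * q ^+ 4.
Hypothesis hP : (size (pset A A))%:R <= K * q ^+ 4.

Let K0 : 0 < K. Proof. by apply: lt_le_trans K6; rewrite exprn_gt0. Qed.
Let q0 : 0 < q. Proof. exact: lt_le_trans q1. Qed.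
Let A0 : 0 \notin A. Proof. by case: aA. Qed.
Let Kn n : 0 < K ^+ n. Proof. by rewrite exprn_gt0. Qed.
Let qn n : 0 < q ^+ n. Proof. by rewrite exprn_gt0. Qed.
Let n0 : 0 < (size A)%:R :> R. Proof. by rewrite hA. Qed.

Lemma menergy_sub (B : seq quat) : uniq B -> {subset B <= A} ->
  menergy B <= K ^+ 2 * (size (sset B B))%:R ^+ 2.
Proof.
move=> uB BA; apply: le_trans (menergy_le uB (acute_sub aA BA) L0 _) _.
  by apply: leq_ltn_trans AL; exact: uniq_leq_size.
rewrite ler_wpM2r ?sqr_ge0 // expr2; apply: ler_pM => //.
by apply: le_trans K6; lra.
Qed.

Lemma menergyA_le : menergy A <= K ^+ 4 * q ^+ 8.
Proof.
apply: le_trans (menergy_sub uA (fun _ => id)) _.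
have -> : K ^+ 4 * q ^+ 8 = K ^+ 2 * (K * q ^+ 4) ^+ 2 by ring.
by rewrite ler_wpM2l ?(ltW (Kn 2)) //; apply: ler_sqr2.
Qed.

Let l2K : 2 * lg 2 <= lg K.
Proof.
rewrite -(lgX 2) //; apply: lg_le; first by rewrite exprn_gt0.
by apply: le_trans K6; lra.
Qed.
Let l2 : 0 < lg 2. Proof. by rewrite -lg1; apply: lg_lt => //; rewrite ltr1n. Qed.
Let lA : lg (size A)%:R = 3 * lg q. Proof. by rewrite hA (lgX 3 q0). Qed.
Let lKb (x : R) : 0 < x -> x <= 10 ^+ 6 -> lg x <= lg K.
Proof. by move=> x0 x6; apply: lg_le => //; apply: le_trans K6. Qed.

(** As [|AA| <= K q^4], the multiplicative energy of [A] is at least about [q^8]; one dyadic level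
    carries it, which bounds [|S| t^2] from below. With the trivial [|S| t <= q^6] this forces [t]
    to be at least about [q^2]. *)
Let popular_slopes : exists j, let t : R := 2 ^+ j in
  let S := [seq x <- rquo A | (2 ^ j <= mrep A x < 2 ^ j.+1)%N] in
  [/\ (0 < size S)%N, 8 * lg q - 3 * lg K <= lg (size S)%:R + 2 * lg t,
      2 * lg q - 3 * lg K <= lg t & lg t <= 3 * lg q].
Proof.
have [x _|j _] := @dyadic _ (rquo A) (mrep A) L 2 isT L0.
  by apply: leq_ltn_trans AL; exact: mrep_le.
rewrite -/(menergy A) -size_filter; set S := filter _ _ => hS.
have low := pset_lower uA uA A0 A0.
have P0 : 0 < (size (pset A A))%:R ^+ 2 * (menergy A * menergy A) :> R.
  by apply: lt_le_trans low; rewrite !exprn_gt0 // mulr_gt0.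
have me0 : 0 < menergy A.
  rewrite lt0r menergy_ge0 andbT; apply: contraTneq P0 => ->.
  by rewrite mul0r mulr0 ltxx.
have PA : 0 < (size (pset A A))%:R :> R.
  by rewrite lt0r ler0n andbT; apply: contraTneq P0 => ->; rewrite expr0n mul0r ltxx.
have t0 : 0 < 2 ^+ j :> R by rewrite exprn_gt0.
have L0r : 0 < L%:R :> R by rewrite ltr0n.
have S0 : 0 < (size S)%:R :> R.
  rewrite lt0r ler0n andbT; apply: contraTneq me0 => e; rewrite -leNgt.
  by move: hS; rewrite e !mulr0.
have hS1 : (size S)%:R * 2 ^+ j <= (size A)%:R ^+ 2 :> R.
  apply: le_trans (sum_mrep uA A0); rewrite size_filter count_sum mulr_suml.
  apply: ler_sums => x _; case: (boolP (_ <= _ < _)%N) => [/andP[h _]|_]; last by rewrite mul0r.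
  by rewrite mul1r -natrX ler_nat.
exists j; rewrite /= -/S; have t1 : lg (2 ^+ j) <= 3 * lg q.
  rewrite -lA; apply: lg_le => //; rewrite -natrX ler_nat.
  rewrite ltr0n in S0; case eS : S S0 => [//|x S'] _.
  have : x \in S by rewrite eS mem_head.
  by rewrite mem_filter => /andP[/andP[h _] _]; apply: leq_trans h (mrep_le _ _).
have nn := mulr_gt0 n0 n0; have mm := mulr_gt0 me0 me0.
have := lg_le (exprn_gt0 4 nn) low; rewrite (lgX 4 nn) (lgM n0 n0) (lgM (exprn_gt0 2 PA) mm).
rewrite (lgX 2 PA) (lgM me0 me0) lA => b1.
have := lg_le PA hP; rewrite (lgM K0 (qn 4)) (lgX 4 q0) => b2.
have four : 0 < 2 ^+ 2 :> R by rewrite exprn_gt0.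
have tt := exprn_gt0 2 t0; have ft := mulr_gt0 four tt.
have := lg_le me0 hS; rewrite (lgM L0r (mulr_gt0 ft S0)) (lgM ft S0) (lgM four tt) (lgX 2 t0) => b3.
have b4 := lg_le L0r LK; have b5 := lKb four ltac:(lra).
have := lg_le (mulr_gt0 S0 t0) hS1; rewrite (lgM S0 t0) (lgX 2 n0) lA => b6.
split; [by rewrite -(ltr0n R) | | | exact: t1]; lra.
Qed.

Hypothesis Kq : K ^+ 1300 <= q.

Let lKq : 1300 * lg K <= lg q.
Proof. by rewrite -(lgX 1300 K0); apply: lg_le. Qed.

Let lK0 : 0 < lg K. Proof. by have := l2; have := l2K; lra. Qed.

Let fibre_sub x : {subset fibre A x <= A}.
Proof. by move=> c; rewrite mem_filter => /andP[]. Qed.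

Let ufibre x : uniq (fibre A x). Proof. by rewrite filter_uniq. Qed.

Let sfibre x : size (fibre A x) = mrep A x. Proof. by rewrite size_filter. Qed.

(** Otherwise [cluster_energy] applies to a majority of slopes with fibres of low energy, and the
    gain over Solymosi's bound contradicts [|A + A| <= K q^4]. *)
Let half_structured (j : nat) (S : seq quat) :
  uniq S -> (forall x, x \in S -> (2 ^ j <= mrep A x < 2 ^ j.+1)%N) -> (0 < size S)%N ->
  8 * lg q - 3 * lg K <= lg (size S)%:R + 2 * lg (2 ^+ j) -> lg (2 ^+ j) <= 3 * lg q ->
  (size S <= 2 * count (fun x => ((2 ^+ j) ^+ 3 <= K ^+ 72 * energy (fibre A x))%R) S)%N.
Proof.
move=> uS SP S0 hS ht; set G := fun x : quat => _; rewrite leqNgt; apply/negP => hG.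
set t : R := 2 ^+ j in hS ht G hG *.
have t0 : 0 < t by rewrite exprn_gt0.
pose S' := [seq x <- S | ~~ G x].
have sS' : (size S <= 2 * size S')%N.
  by rewrite size_filter; apply: half_compl hG; exact: (count_predC G S).
have S0' : 0 < (size S')%:R :> R by rewrite ltr0n; exact: half_pos S0 sS'.
have Sr : 0 < (size S)%:R :> R by rewrite ltr0n.
have h2 : 0 < 2 :> R by [].
have lS' : lg (size S)%:R <= lg 2 + lg (size S')%:R.
  by rewrite -(lgM h2 S0'); apply: lg_le => //; rewrite -natrM ler_nat.
(* A gain of [K^7] beats the loss of [K^3] in [|S| t^2] together with the [K^2] coming from
   [|A + A|^2]. *)
pose M := (Num.truncn (K ^+ 7)).+1.
have /andP[M1 M2] := truncn_itv (ltW (Kn 7)).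
have K1 : 1 <= K by apply: le_trans K6; lra.
have K71 : 1 <= K ^+ 7 by rewrite exprn_ege1.
have M3 : (M.+1)%:R <= K ^+ 8 :> R.
  have -> : M.+1 = (Num.truncn (K ^+ 7) + 2)%N by rewrite addn2.
  rewrite natrD; apply: le_trans (_ : K ^+ 7 + 2 <= _); first by rewrite lerD2r.
  rewrite exprS; apply: le_trans (_ : 10 ^+ 6 * K ^+ 7 <= _); first by lra.
  by rewrite ler_wpM2r // ltW.
have M4 : M%:R <= K ^+ 8 :> R by apply: le_trans M3; rewrite ler_nat.
have M5 : K ^+ 7 <= M%:R :> R by rewrite ltW.
have M0 : 0 < M%:R :> R by rewrite ltr0n.
have MS : (M < size S')%N.
  rewrite -(ltr_nat R); apply: le_lt_trans M4 _; rewrite ltNge; apply/negP.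
  by move=> /(lg_le S0'); rewrite (lgX 8 K0); have := l2K; have := lKq; have := lK0; lra.
(* Small enough for [M.+1 * M * theta <= t^2 / 2], as [M.+1 <= K^8]. The exponent [72 = 4 * 18] in
   the energy bound comes from [theta^4], and the extra factor [K] in [theta] pays for the [2^5] in
   [(2 t)^5]. *)
pose theta := K * t ^+ 2 / K ^+ 18.
have th0 : 0 <= theta by rewrite divr_ge0 ?mulr_ge0 ?exprn_ge0 // ltW.
have := @cluster_energy A S' (sset A A) (sset A A) (fibre A) (2 ^ j) aA
  (filter_uniq _ uS) (undup_uniq _) (undup_uniq _) (fun x _ => @fibre_sub x)
  (fun x _ => ufibre x) _ _ M (2 * t) (t ^+ 3 / K ^+ 72) theta _ _ _ th0 MS.
have w1 x y c d : x \in S' -> y \in S' -> c \in fibre A x -> d \in fibre A y ->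
    c + d \in sset A A /\ c * x + d * y \in sset A A.
  move=> _ _; rewrite !mem_filter => /andP[cx cA] /andP[dy dA].
  by split; exact: mem_sset.
have w2 x : x \in S' -> (2 ^ j <= size (fibre A x))%N.
  by rewrite mem_filter sfibre => /andP[_ /SP /andP[]].
have w3 x : x \in S' -> (size (fibre A x))%:R <= 2 * t.
  rewrite mem_filter sfibre => /andP[_ /SP /andP[_ /ltnW h]].
  by rewrite /t -exprS -natrX ler_nat.
have w4 x : x \in S' -> energy (fibre A x) <= t ^+ 3 / K ^+ 72.
  rewrite mem_filter /G -ltNge ler_pdivlMr // mulrC => /andP[h _]; exact: ltW.
have w5 : (2 * t) ^+ 5 * (t ^+ 3 / K ^+ 72) <= theta ^+ 4.
  have -> : (2 * t) ^+ 5 * (t ^+ 3 / K ^+ 72) = 32 * (t ^+ 8 / K ^+ 72).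
    by field; exact: lt0r_neq0.
  have -> : theta ^+ 4 = K ^+ 4 * (t ^+ 8 / K ^+ 72).
    by rewrite /theta; field; exact: lt0r_neq0.
  rewrite ler_wpM2r ?divr_ge0 ?exprn_ge0 ?(ltW t0) ?(ltW K0) //.
  apply: le_trans (_ : K ^+ 1 <= _); first by rewrite expr1; apply: le_trans K6; lra.
  by rewrite ler_weXn2l.
move=> /(_ w1 w2 w3 w4 w5).
rewrite !natrM natrX -/t => hcl.
have th1 : M.+1%:R * M%:R * theta <= t ^+ 2 / 2.
  apply: le_trans (_ : K ^+ 8 * K ^+ 8 * theta <= _).
    by rewrite ler_wpM2r //; apply: ler_pM.
  have -> : K ^+ 8 * K ^+ 8 * theta = t ^+ 2 / K by rewrite /theta; field; exact: lt0r_neq0.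
  rewrite ler_wpM2l ?exprn_ge0 ?(ltW t0) // lef_pV2 ?posrE //.
  by apply: le_trans K6; lra.
have hcl2 : (size S')%:R * M%:R * t ^+ 2 <= 2500 * (size (sset A A))%:R ^+ 2.
  have : (size S')%:R * M%:R * (M.+1%:R * M%:R) * theta <=
      (size S')%:R * M%:R * (t ^+ 2 / 2).
    by rewrite -mulrA ler_wpM2l // mulr_ge0.
  by move: hcl; rewrite expr2; lra.
have AA0 : 0 < (size (sset A A))%:R :> R.
  by rewrite ltr0n; apply: leq_trans (sset_size_ge uA); rewrite -(ltr0n R).
have SM := mulr_gt0 S0' M0; have h25 : 0 < 2500 :> R by [].
have := lg_le (mulr_gt0 SM (exprn_gt0 2 t0)) hcl2.
rewrite (lgM SM (exprn_gt0 2 t0)) (lgM S0' M0) (lgX 2 t0) (lgM h25 (exprn_gt0 2 AA0)) (lgX 2 AA0).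
have := lg_le AA0 hAA; rewrite (lgM K0 (qn 4)) (lgX 4 q0).
have := lg_le (Kn 7) M5; rewrite (lgX 7 K0).
have := lKb h25 ltac:(lra); have := l2K; have := lK0; lra.
Qed.

(** [B] comes from [bsg_add] with [k = K^73]. Small [|B + B|] makes the multiplicative energy of [B]
    small, hence [AB] large; as [AB] lies in [AA], this also yields the upper bound for [t]. *)
Let extract (j : nat) (x : quat) : (2 ^ j <= mrep A x < 2 ^ j.+1)%N ->
  (2 ^+ j) ^+ 3 <= K ^+ 72 * energy (fibre A x) ->
  2 * lg q - 3 * lg K <= lg (2 ^+ j) ->
  (exists B, good_fibre A (K ^+ 1300) q x B) /\ lg (2 ^+ j) <= 2 * lg q + 373 * lg K.
Proof.
move=> /andP[jx xj] hE ht; set t : R := 2 ^+ j in hE ht *.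
have t0 : 0 < t by rewrite exprn_gt0.
set F := fibre A x in hE *.
have tF : t <= (size F)%:R by rewrite /F sfibre /t -natrX ler_nat.
have Ft : (size F)%:R <= 2 * t by rewrite /F sfibre /t -exprS -natrX ler_nat ltnW.
have F0 : F != [::].
  by rewrite -size_eq0 -(pnatr_eq0 R) lt0r_neq0 //; apply: lt_le_trans tF.
have hE' : (size F)%:R ^+ 3 <= K ^+ 73 * energy F.
  apply: le_trans (_ : (2 * t) ^+ 3 <= _); first by rewrite ler_pXn2r ?nnegrE ?mulr_ge0 // ltW.
  have -> : (2 * t) ^+ 3 = 8 * t ^+ 3 by ring.
  rewrite (exprS K 72) -mulrA; apply: ler_pM => //; first by rewrite exprn_ge0 // ltW.
  by apply: le_trans K6; lra.
have [B [uB BF sB sBB]] := bsg_add (ufibre x) F0 (Kn 73) hE'.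
have BA : {subset B <= A} by move=> c /BF; exact: fibre_sub.
have B0 : 0 < (size B)%:R :> R.
  rewrite lt0r ler0n andbT; apply: contraTneq t0 => e; rewrite -leNgt.
  by apply: le_trans tF _; apply: le_trans sB _; rewrite e mulr0.
have BB0 : 0 < (size (sset B B))%:R :> R.
  by rewrite ltr0n; apply: leq_trans (sset_size_ge uB); rewrite -(ltr0n R).
have nB0 : 0 \notin B by apply: contra A0; exact: BA.
have meB := menergy_sub uB BA.
have low := pset_lower uA uB A0 nB0.
have low2 : ((size A)%:R * (size B)%:R) ^+ 4 <= (size (pset A B))%:R ^+ 2 *
    ((K ^+ 4 * q ^+ 8) * (K ^+ 2 * (size (sset B B))%:R ^+ 2)).
  apply: le_trans low _; rewrite ler_wpM2l ?sqr_ge0 //.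
  by apply: ler_pM; rewrite ?menergy_ge0 // menergyA_le.
have AB0 : 0 < (size (pset A B))%:R :> R.
  rewrite lt0r ler0n andbT; apply: contraTneq low2 => ->.
  by rewrite expr0n mul0r -ltNge exprn_gt0 // mulr_gt0.
have PB : (size (pset A B))%:R <= K * q ^+ 4.
  apply: le_trans hP; rewrite ler_nat; apply: uniq_leq_size; first exact: undup_uniq.
  by move=> z /psetP[a [b [aA' /BA bA ->]]]; exact: mem_pset.
have h4 : 0 < 4 :> R by []. have h2 : 0 < 2 :> R by [].
have := lg_le t0 (le_trans tF sB).
rewrite (lgM (mulr_gt0 h4 (Kn 73)) B0) (lgM h4 (Kn 73)) (lgX 73 K0) => c1.
have c2 := lKb h4 ltac:(lra).
have Bt : (size B)%:R <= 2 * t.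
  by apply: le_trans Ft; rewrite ler_nat; exact: uniq_leq_size.
have := lg_le B0 Bt; rewrite (lgM h2 t0) => c3.
have p15 : 0 < 2 ^+ 15 :> R by rewrite exprn_gt0.
have sBB2 : (size (sset B B))%:R <= 2 ^+ 15 * (K ^+ 219 * t).
  apply: le_trans sBB _.
  have -> : 2 ^+ 15 * (K ^+ 219 * t) = 2 ^+ 14 * (K ^+ 73) ^+ 3 * (2 * t) by ring.
  by rewrite ler_wpM2l // mulr_ge0 ?exprn_ge0 // ltW.
have := lg_le BB0 sBB2.
rewrite (lgM p15 (mulr_gt0 (Kn 219) t0)) (lgM (Kn 219) t0) (lgX 219 K0) => c4.
have c5 := lKb p15 ltac:(lra).
have KQ := mulr_gt0 (Kn 4) (qn 8); have KB := mulr_gt0 (Kn 2) (exprn_gt0 2 BB0).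
have nB := mulr_gt0 n0 B0.
have := lg_le (exprn_gt0 4 nB) low2.
rewrite (lgX 4 nB) (lgM n0 B0) (lgM (exprn_gt0 2 AB0) (mulr_gt0 KQ KB)) (lgM KQ KB).
rewrite (lgM (Kn 4) (qn 8)) (lgM (Kn 2) (exprn_gt0 2 BB0)) (lgX 2 AB0) (lgX 2 BB0).
rewrite (lgX 4 K0) (lgX 2 K0) (lgX 8 q0) lA => c6.
have := lg_le AB0 PB; rewrite (lgM K0 (qn 4)) (lgX 4 q0) => c7.
have := l2K; have := lK0; have := l2 => d1 d2 d3.
split; last by lra.
(* The worst loss is in [menergy B] and stays below [K^1200]. *)
have k1300 := lgX 1300 K0; have H0 := Kn 1300; move: (K ^+ 1300) k1300 H0 => H k1300 H0.
have pH z : 0 < z -> 0 < H * z by move=> z0; rewrite mulr_gt0.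
exists B; split => //.
- by apply: (lg_leV (pH _ B0)); rewrite (lgM H0 B0) k1300 (lgX 2 q0); lra.
- by apply: (lg_leV (pH _ (qn 2))); rewrite (lgM H0 (qn 2)) k1300 (lgX 2 q0); lra.
- by apply: (lg_leV (pH _ (qn 2))); rewrite (lgM H0 (qn 2)) k1300 (lgX 2 q0); lra.
- apply: le_trans meB _; apply: (lg_leV (pH _ (qn 4))).
  rewrite (lgM H0 (qn 4)) k1300 (lgX 4 q0) (lgM (Kn 2) (exprn_gt0 2 BB0)).
  by rewrite (lgX 2 K0) (lgX 2 BB0); lra.
by apply: (lg_leV (pH _ AB0)); rewrite (lgM H0 AB0) k1300 (lgX 4 q0); lra.
Qed.

Lemma structure : exists G : seq quat, [/\ uniq G, q ^+ 4 <= K ^+ 1300 * (size G)%:R &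
  forall x, x \in G -> exists B, good_fibre A (K ^+ 1300) q x B].
Proof.
have [j] := popular_slopes; set S := filter _ _ => -[S0 hS ht ht2].
have uS : uniq S by rewrite filter_uniq ?undup_uniq.
have SP x : x \in S -> (2 ^ j <= mrep A x < 2 ^ j.+1)%N by rewrite mem_filter => /andP[].
have hG := half_structured uS SP S0 hS ht2.
set P := fun x : quat => _ in hG.
exists [seq x <- S | P x]; split; first exact: filter_uniq.
  rewrite size_filter; set g := count _ _ in hG *.
  have g0 : (0 < g)%N by exact: half_pos S0 hG.
  have /hasP[x xS Px] : has P S by rewrite has_count.
  have [_ tu] := extract (SP x xS) Px ht.
  have Sr : 0 < (size S)%:R :> R by rewrite ltr0n.
  have gr : 0 < g%:R :> R by rewrite ltr0n.
  have h2 : 0 < 2 :> R by [].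
  have : (size S)%:R <= 2 * g%:R :> R by rewrite -natrM ler_nat.
  move=> /(lg_le Sr); rewrite (lgM h2 gr) => c1.
  apply: (lg_leV (mulr_gt0 (Kn 1300) gr)).
  rewrite (lgM (Kn 1300) gr) (lgX 1300 K0) (lgX 4 q0).
  by have := l2K; have := lK0; lra.
by move=> x; rewrite mem_filter => /andP[Px xS]; have [] := extract (SP x xS) Px ht.
Qed.

End StructuredFibres.

(** * A near ring inside AA *)

Lemma sum_quo (A : seq quat) (F : quat -> R) : uniq A -> 0 \notin A ->
  \sum_(a' <- A) \sum_(a <- A) F (a'^-1 * a) = \sum_(g <- rquo A) (mrep A g)%:R * F g.
Proof.
move=> uA A0; under [RHS]eq_bigr => g _ do rewrite count_sum mulr_suml.
rewrite [RHS]exchange_big; apply: eq_sums => a' aA /=; have a0 := memn0 A0 aA.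
rewrite (sum_fiber (I := rquo A) (h := fun a => a'^-1 * a)) ?undup_uniq //; last first.
  by move=> a aA'; apply: (mem_rquo A0 aA); rewrite mulVKr.
apply: eq_sums => g _; rewrite -(sum_delta (a' * g) (fun=> F g)) //.
apply: eq_bigr => a _; case: (eqVneq (a' * g) a) => [<-|ne]; first by rewrite mulKr // eqxx.
case: eqP => [e|_]; last by rewrite !mul0r.
by move: ne; rewrite -e mulVKr // eqxx.
Qed.

Lemma sum_fibre_sqr (T U : eqType) (s : seq T) (f : T -> U) :
  (size s)%:R ^+ 2 <= (size (undup (map f s)))%:R *
    \sum_(t <- s) (count (fun t' => f t' == f t) s)%:R :> R.
Proof.
set D := undup _; have fD t : t \in s -> f t \in D by move=> ts; rewrite mem_undup map_f.
have -> : (size s)%:R = \sum_(d <- D) (count (fun t => f t == d) s)%:R :> R.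
  by rewrite -natr_sum -count_fiber // undup_uniq.
apply: le_trans (sqr_sum_le _ _) _; rewrite ler_wpM2l //.
rewrite (sum_fiber (I := D) (h := f)) ?undup_uniq //; apply: ler_sums => d _.
rewrite expr2 [X in X * _]count_sum mulr_suml; apply: ler_sums => t ts.
by case: eqP => [->|_]; rewrite ?mul0r.
Qed.

Lemma sum_sset_sqr (Y : seq quat) : uniq Y ->
  \sum_(s <- sset Y Y) (count (fun a => s - a \in Y) Y)%:R ^+ 2 = energy Y.
Proof.
move=> uY; rewrite energyE // exchange_big.
under [RHS]eq_bigr do under eq_bigr do rewrite -[_%:R]mulr1.
rewrite -(sum_Bs uY (fun _ _ => 1)); apply: eq_bigr => s _.
by rewrite !sum_const mulr1 expr2 size_filter.
Qed.

(** * Additive energy of a set rich in dilates *)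

Section Tiles.
Variables (Y B Rr : seq quat).
Hypotheses (uY : uniq Y) (uB : uniq B) (uR : uniq Rr).
Hypotheses (B0 : 0 \notin B) (R0 : 0 \notin Rr).

Let Br (r : quat) := [seq b <- B | b * r \in Y].
Let TR := [seq (r, e) | r <- Rr, e <- [seq (b, b') | b <- Br r, b' <- Br r]].
Let f (t : quat * (quat * quat)) := (t.2.1 * t.1, t.2.2 * t.1).

Let TRP r b1 b2 : (r, (b1, b2)) \in TR ->
  [/\ r \in Rr, b1 \in B, b2 \in B, b1 * r \in Y & b2 * r \in Y].
Proof. by rewrite !mem_pairs !mem_filter => /and3P[-> /andP[-> ->] /andP[-> ->]]. Qed.

Let uTR : uniq TR.
Proof.
by apply: uniq_pairs => // r _; apply: uniq_pairs => [|_ _]; exact: filter_uniq.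
Qed.

(** If [b1 r = c1 r1] and [b2 r = c2 r1], then [c1] determines the rest: [r1 = c1^-1 b1 r] and
    [c2 = b2 (c1^-1 b1)^-1]. For given [r], the condition that this last element lies in [B] is
    counted by the multiplicative energy of [B]. *)
Lemma tiles_coll : \sum_(t <- TR) (count (fun t' => f t' == f t) TR)%:R <=
  (size Rr)%:R * menergy B :> R.
Proof.
have h t : t \in TR -> (count (fun t' => f t' == f t) TR <=
    count (fun b' => (t.2.2 / (b'^-1 * t.2.1))%R \in B) B)%N.
  case: t => r [b1 b2] /TRP[rR b1B b2B _ _] /=.
  have r0 := memn0 R0 rR; have b10 := memn0 B0 b1B.
  apply: (count_inj (h := fun t' : quat * (quat * quat) => t'.2.1)) => //.
    move=> [r1 [c1 c2]] [r2 [c1' c2']]; rewrite !inE => /andP[/TRP[rR1 cB1 _ _ _] /eqP e1].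
    move=> /andP[/TRP[rR2 cB1' _ _ _] /eqP e2] /= ec.
    have ef := etrans e1 (esym e2).
    have e11 : c1 * r1 = c1' * r2 := congr1 fst ef.
    have e12 : c2 * r1 = c2' * r2 := congr1 snd ef.
    rewrite -ec in e11 *; have er := qmulIl (memn0 B0 cB1) e11; rewrite -er in e12 *.
    by rewrite (qmulIr (memn0 R0 rR1) e12).
  move=> [r1 [c1 c2]] /TRP[rR1 cB1 cB2 _ _] /eqP e /=; split => //.
  have e1 : c1 * r1 = b1 * r := congr1 fst e.
  have e2 : c2 * r1 = b2 * r := congr1 snd e.
  have c0 := memn0 B0 cB1.
  have -> : b2 / (c1^-1 * b1) = c2; last by [].
  have rE : r1 = c1^-1 * b1 * r by rewrite -mulrA -e1 mulKr.
  apply: (qmulIr (a := c1^-1 * b1 * r)).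
    by rewrite !qmulf_eq0 qinv_eq0 !negb_or c0 b10 r0.
  rewrite -{2}rE e2 mulrA divrK // qunitE qmulf_eq0 qinv_eq0 negb_or c0 b10 //.
apply: (@le_trans _ _ (\sum_(t <- TR) (count (fun b' => t.2.2 / (b'^-1 * t.2.1) \in B) B)%:R)).
  by apply: ler_sums => t /h; rewrite ler_nat.
rewrite big_allpairs_dep; apply: sum_leC => r _; rewrite big_allpairs_dep /=.
apply: (@le_trans _ _ (\sum_(b1 <- B) \sum_(b2 <- B)
   (count (fun b' => b2 / (b'^-1 * b1) \in B) B)%:R)).
  rewrite /Br big_filter big_mkcond; apply: ler_sums => b1 _.
  case: ifP => _; last by apply: sumr_ge0.
  by rewrite big_filter big_mkcond; apply: ler_sums => b2 _; case: ifP.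
rewrite /menergy; under [leRHS]eq_bigr do rewrite expr2.
rewrite -(sum_quo (fun x => (mrep B x)%:R)) // exchange_big /=.
under eq_bigr do under eq_bigr do rewrite count_sum.
rewrite [leRHS]exchange_big /=.
rewrite exchange_big /=; apply: ler_sums => b1 b1B.
rewrite exchange_big /=; apply: ler_sums => b' bB'.
rewrite -count_sum ler_nat.
have x0 : b'^-1 * b1 != 0.
  by rewrite qmulf_eq0 qinv_eq0 negb_or (memn0 B0 bB') (memn0 B0 b1B).
apply: (count_inj (h := fun b2 => b2 / (b'^-1 * b1))) => //.
  by move=> x y _ _ /qmulIr; apply; rewrite qinv_eq0.
by move=> b2 b2B h2; split => //; rewrite divrK.
Qed.

(** [TR] counts pairs inside a common dilate [B r]; by [tiles_coll] they give many distinct pairs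
    [D] in [Y]. The sums [(b + b') r] of these pairs take few values because [B + B] is small, and
    many pairs with few sums force additive energy. At the sizes in question the outcome is
    [q^10]. *)
Lemma tiles_energy : (\sum_(r <- Rr) count (fun b => (b * r)%R \in Y) B)%N%:R ^+ 8 <=
  (size Rr)%:R ^+ 7 * menergy B ^+ 2 * (size (sset B B))%:R * energy Y.
Proof.
set T := (\sum_(r <- Rr) _)%N.
pose D := undup (map f TR).
have h1 : T%:R ^+ 2 <= (size Rr)%:R * (size TR)%:R :> R.
  rewrite natr_sum; apply: le_trans (sqr_sum_le _ _) _; rewrite ler_wpM2l //.
  rewrite size_pairs natr_sum; apply: ler_sums => r _.
  by rewrite size_allpairs natrM size_filter expr2.
have h2 : (size TR)%:R ^+ 2 <= (size D)%:R * ((size Rr)%:R * menergy B) :> R.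
  apply: le_trans (sum_fibre_sqr TR f) _; rewrite ler_wpM2l //; exact: tiles_coll.
pose SS := undup [seq d.1 + d.2 | d <- D].
have DP d : d \in D -> exists r b1 b2, [/\ r \in Rr, b1 \in B & b2 \in B] /\
   [/\ d = (b1 * r, b2 * r), b1 * r \in Y & b2 * r \in Y].
  rewrite mem_undup => /mapP[[r [b1 b2]] /TRP[rR b1B b2B y1 y2] ->].
  by exists r, b1, b2.
have h3 : (size D)%:R ^+ 2 <= (size SS)%:R * energy Y :> R.
  apply: (@le_trans _ _ ((\sum_(s <- SS) (count (fun a => s - a \in Y) Y)%:R) ^+ 2)).
    apply: ler_sqr2 => //; rewrite -natr_sum ler_nat.
    rewrite (count_fiber (I := SS) (h := fun d => d.1 + d.2)) ?undup_uniq //; last first.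
      by move=> d dD; rewrite mem_undup; apply/mapP; exists d.
    apply: leq_sums => s _; apply: (count_inj (h := fst)); rewrite ?undup_uniq //.
      move=> [d1 d2] [d1' d2']; rewrite !inE => /andP[_ /eqP e1] /andP[_ /eqP e2] /= e.
      by move: e1; rewrite -e2 /= e => /addrI ->.
    move=> d /DP[r [b1 [b2 [_ [-> y1 y2]]]]] /eqP <- /=; split => //.
    by rewrite addrC addKr.
  apply: le_trans (sqr_sum_le _ _) _; rewrite ler_wpM2l // -(sum_sset_sqr uY).
  apply: (sum_inj (F := fun s => (count (fun a => s - a \in Y) Y)%:R ^+ 2) (h := id));
    rewrite ?undup_uniq //; first by move=> s _; exact: sqr_ge0.
  move=> s; rewrite mem_undup => /mapP[d /DP[r [b1 [b2 [_ [-> y1 y2]]]]] ->] _ /=.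
  exact: mem_sset.
have h4 : (size SS)%:R <= (size (sset B B))%:R * (size Rr)%:R :> R.
  rewrite -natrM ler_nat -(size_allpairs (fun x y => x * y)); apply: uniq_leq_size.
    exact: undup_uniq.
  move=> s; rewrite mem_undup => /mapP[d /DP[r [b1 [b2 [[rR b1B b2B] [-> _ _]]]]] ->] /=.
  by rewrite -mulrDl allpairs_f // mem_sset.
have E0 : 0 <= energy Y by apply: sumr_ge0 => u _; exact: sqr_ge0.
have M0 := menergy_ge0 B.
have t4 : T%:R ^+ 4 <= (size Rr)%:R ^+ 2 * ((size D)%:R * ((size Rr)%:R * menergy B)) :> R.
  rewrite [_ ^+ 4](exprM _ 2 2); apply: le_trans (ler_sqr2 (sqr_ge0 _) h1) _.
  by rewrite exprMn ler_wpM2l // exprn_ge0.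
rewrite [_ ^+ 8](exprM _ 4 2).
apply: le_trans (ler_sqr2 _ t4) _; first by rewrite exprn_ge0.
have -> : ((size Rr)%:R ^+ 2 * ((size D)%:R * ((size Rr)%:R * menergy B))) ^+ 2 =
   ((size Rr)%:R ^+ 6 * menergy B ^+ 2) * (size D)%:R ^+ 2 by ring.
have -> : (size Rr)%:R ^+ 7 * menergy B ^+ 2 * (size (sset B B))%:R * energy Y =
   ((size Rr)%:R ^+ 6 * menergy B ^+ 2) * ((size (sset B B))%:R * (size Rr)%:R * energy Y) by ring.
rewrite ler_wpM2l ?mulr_ge0 ?exprn_ge0 //; apply: le_trans h3 _.
by rewrite ler_wpM2r.
Qed.

End Tiles.

Lemma sum_lrep (P : seq quat) : uniq P -> 0 \notin P ->
  \sum_(g <- lquo P) (lrep P g)%:R <= (size P)%:R ^+ 2 :> R.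
Proof.
move=> uP P0; under eq_bigr do rewrite count_sum.
rewrite exchange_big expr2; apply: sum_leC => c cP /=; rewrite -count_sum ler_nat -(count_predT P).
apply: (count_inj (h := fun g => g * c)); rewrite ?undup_uniq //.
by move=> x y _ _; apply: qmulIr; exact: memn0 cP.
Qed.

Lemma count_split (T : Type) (a b : pred T) (s : seq T) :
  (count a s = count (fun x => a x && b x) s + count (fun x => a x && ~~ b x) s)%N.
Proof.
elim: s => //= x s ->; case: (a x); case: (b x) => /=; rewrite ?addnS ?add0n //.
Qed.

(** * Multiplicative Balog-Szemeredi-Gowers *)

Definition popular (P : seq quat) (e : R) : seq quat :=
  [seq g <- lquo P | e <= (lrep P g)%:R].

Lemma size_popular (P : seq quat) (e : R) : uniq P -> 0 \notin P ->
  (size (popular P e))%:R * e <= (size P)%:R ^+ 2.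
Proof.
move=> uP P0; apply: le_trans (sum_lrep uP P0).
rewrite size_filter count_sum mulr_suml; apply: ler_sums => u _.
by case: (boolP (e <= _)) => h; rewrite ?mul1r // mul0r.
Qed.

Lemma mem_popular (P : seq quat) (e : R) g : 0 \notin P -> 0 < e ->
  (g \in popular P e) = (e <= (lrep P g)%:R).
Proof.
move=> P0 e0; rewrite mem_filter andbC; case: (boolP (e <= _)) => h; rewrite ?andbF // andbT.
by apply: lrep_neq0 => //; rewrite -(pnatr_eq0 R) lt0r_neq0 //; apply: lt_le_trans h.
Qed.

Lemma lquo_neq0 P g : 0 \notin P -> g \in lquo P -> g != 0.
Proof.
move=> P0; rewrite mem_undup => /allpairsP[[a b] /= [aP bP ->]].
by rewrite qmulf_eq0 qinv_eq0 negb_or (memn0 P0 aP) (memn0 P0 bP).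
Qed.

Lemma common_lrep (P I : seq quat) p p' : uniq I -> uniq P -> 0 \notin P -> p' != 0 ->
  (count (fun x => ((p * x)%R \in P) && ((p' * x)%R \in P)) I <= lrep P (p / p'))%N.
Proof.
move=> uI uP P0 p0; apply: (count_inj (h := fun x => p' * x)) => //.
  by move=> x y _ _; exact: qmulIl.
by move=> x _ /andP[h1 h2]; split => //; rewrite mulrA divrK.
Qed.

(* Y consists of the popular h with h p in P, for a suitable p, that have few bad
   partners h'; p is chosen by averaging so that much of the given family g survives. *)
Lemma prune (T : eqType) (P : seq quat) (TL : seq T) (g : T -> quat) (e e' z : R) :
  uniq P -> 0 \notin P -> P != [::] -> 0 < e -> 0 < e' -> 0 < z ->
  (forall t, t \in TL -> g t \in popular P e) ->
  (size (popular P e))%:R * e' <= z * e / 2 ->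
  exists Y : seq quat, [/\ uniq Y, {subset Y <= popular P e},
    e * (size TL)%:R <= 2 * (size P)%:R * (count (fun t => g t \in Y) TL)%:R &
    3 * z <= (size Y)%:R ->
    (size (pset Y (map (fun y => y^-1) Y)))%:R * z <= (size (popular P e'))%:R ^+ 2].
Proof.
move=> uP P0 Pne e0 e'0 z0 gP hpop; set Pop := popular P e in gP hpop *.
have uPop : uniq Pop by rewrite filter_uniq ?undup_uniq.
have Pop0 h : h \in Pop -> h != 0 by rewrite mem_filter => /andP[_]; exact: lquo_neq0.
pose Pp p := [seq h <- Pop | h * p \in P].
pose bad h h' := (count (fun p => (h * p \in P) && (h' * p \in P)) P)%:R < e'.
pose Y p := [seq h <- Pp p | (count (bad h) (Pp p))%:R <= z].
have uPp p : uniq (Pp p) by rewrite filter_uniq.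
have YP p h : (h \in Y p) = [&& (count (bad h) (Pp p))%:R <= z, h * p \in P & h \in Pop].
  by rewrite /Y mem_filter /Pp mem_filter.
(* A bad partner shares fewer than [e'] of the [p] with [h], so [h] has more than [z] bad partners
   for at most [|Pop| e' / z <= e / 2] values of [p]. *)
have key h : h \in Pop -> e / 2 <= (count (fun p => h \in Y p) P)%:R.
  move=> hP; pose N := count (fun p => (h * p \in P) && ~~ ((count (bad h) (Pp p))%:R <= z)) P.
  have e1 : (lrep P h = count (fun p => h \in Y p) P + N)%N.
    rewrite /lrep (count_split _ (fun p => (count (bad h) (Pp p))%:R <= z)); congr (_ + _)%N.
    by apply: eq_count => p /=; rewrite YP hP andbT andbC.
  have e2 : N%:R * z <= (size Pop)%:R * e'.
    apply: (@le_trans _ _ (\sum_(p <- P) (h * p \in P)%:R * (count (bad h) (Pp p))%:R)).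
      rewrite [N%:R]count_sum mulr_suml; apply: ler_sums => p _.
      case: (h * p \in P) => /=; last by rewrite !mul0r.
      by rewrite mul1r -ltNge; case: ltP => hz; rewrite ?mul1r ?mul0r // ltW.
    apply: (@le_trans _ _ (\sum_(h' <- Pop) (bad h h')%:R *
       (count (fun p => (h * p \in P) && (h' * p \in P)) P)%:R)); last first.
      apply: sum_leC => h' _; rewrite /bad; case: (ltP _ e') => hb; rewrite ?mul1r ?mul0r ltW //.
    rewrite le_eqVlt; apply/orP; left; apply/eqP.
    under [RHS]eq_bigr do rewrite count_sum mulr_sumr.
    rewrite [RHS]exchange_big /=; apply: eq_bigr => p _.
    rewrite count_sum big_filter mulr_sumr big_mkcond /=; apply: eq_bigr => h' _.
    by case: (h * p \in P); case: (h' * p \in P); rewrite /= ?mul0r ?mulr0 ?mul1r ?mulr1.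
  have e3 : N%:R <= e / 2.
    by rewrite -(ler_pM2r z0); apply: le_trans e2 _; move: hpop; rewrite mulrC; lra.
  move: hP; rewrite mem_filter => /andP[+ _]; rewrite e1 natrD => e4; lra.
have [p pP pM] := seq_argmax (fun p => (count (fun t => g t \in Y p) TL)%:R) Pne.
exists (Y p); split.
- exact: filter_uniq.
- by move=> h; rewrite YP => /and3P[].
- have h1 : e / 2 * (size TL)%:R <= \sum_(p <- P) (count (fun t => g t \in Y p) TL)%:R.
    under eq_bigr do rewrite count_sum.
    rewrite exchange_big /= mulrC; apply: sum_geC => t tTL; rewrite -count_sum.
    exact: key (gP t tTL).
  have h2 := sum_leC pM; lra.
move=> hY; set W := pset _ _.
(* [y / y' = (y / v) (v / y')] for every [v] in [Pp p]. There are at least [3 z] such [v], at most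
   [2 z] of them bad for [y] or [y'], so every quotient has at least [z] factorisations into
   [e']-popular factors. *)
have key2 w : w \in W -> z <= (count (fun h => h^-1 * w \in popular P e') (popular P e'))%:R.
  move=> /psetP[y [y1 [yY /mapP[y' yY' ->] ->]]].
  have [yb yPop] : (count (bad y) (Pp p))%:R <= z /\ y \in Pop.
    by move: yY; rewrite YP => /and3P[-> _ ->].
  have [yb' yPop'] : (count (bad y') (Pp p))%:R <= z /\ y' \in Pop.
    by move: yY'; rewrite YP => /and3P[-> _ ->].
  have h1 : (size (Pp p) <= count (fun w => ~~ bad y w && ~~ bad y' w) (Pp p) +
      (count (bad y) (Pp p) + count (bad y') (Pp p)))%N.
    rewrite -(count_predC (fun w => ~~ bad y w && ~~ bad y' w)) leq_add2l.
    rewrite -count_predUI; apply: leq_trans (leq_addr _ _).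
    by apply: sub_count => x /=; rewrite negb_and !negbK.
  have h2 : (size (Y p) <= size (Pp p))%N by rewrite size_filter count_size.
  have h3 : (count (fun w => ~~ bad y w && ~~ bad y' w) (Pp p) <=
     count (fun h => (h^-1 * (y / y'))%R \in popular P e') (popular P e'))%N.
    apply: (count_inj (h := fun w => y / w)); rewrite ?filter_uniq ?undup_uniq //.
      move=> a b _ _ /(qmulIl (Pop0 _ yPop)) /invr_inj //.
    move=> v; rewrite mem_filter => /andP[_ vPop]; rewrite /bad -!leNgt => /andP[b1 b2].
    have v0 := Pop0 _ vPop.
    rewrite !mem_popular //; split.
      by apply: le_trans b1 _; rewrite ler_nat common_lrep.
    have -> : (y / v)^-1 * (y / y') = v / y'.
      rewrite invrM ?invrK ?unitrV ?qunitE ?qinv_eq0 ?Pop0 //.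
      by rewrite -mulrA mulKr // qunitE Pop0.
    apply: le_trans b2 _; rewrite ler_nat.
    apply: (leq_trans _ (@common_lrep P P v y' uP uP P0 (Pop0 _ yPop'))).
    by apply: sub_count => x /=; rewrite andbC.
  have h4 : (size (Y p))%:R <= (count (fun h => h^-1 * (y / y') \in popular P e') (popular P e'))%:R +
      ((count (bad y) (Pp p))%:R + (count (bad y') (Pp p))%:R) :> R.
    rewrite -!natrD ler_nat; apply: leq_trans h2 _; apply: leq_trans h1 _.
    by rewrite leq_add2r.
  move: hY h4 yb yb'; lra.
apply: le_trans (sum_geC key2) _; under eq_bigr do rewrite count_sum.
rewrite exchange_big expr2; apply: sum_leC => h hp /=.
rewrite -count_sum ler_nat -(count_predT (popular P e')).
apply: (count_inj (h := fun w => h^-1 * w)); rewrite ?filter_uniq ?undup_uniq //.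
move=> a b _ _; apply: qmulIl; rewrite qinv_eq0.
by move: hp; rewrite mem_filter => /andP[_]; exact: lquo_neq0.
Qed.

Section NearRing.
Variables (A G : seq quat) (K q : R).
Hypotheses (uA : uniq A) (A0 : 0 \notin A) (uG : uniq G).
Hypotheses (K6 : 10 ^+ 6 <= K) (q1 : 1 <= q).
Hypothesis hA : (size A)%:R = q ^+ 3.
Local Notation P := (pset A A).
Hypothesis hP : (size P)%:R <= K * q ^+ 4.
Hypothesis hE : menergy A <= K * q ^+ 8.
Hypothesis hG : q ^+ 4 <= K * (size G)%:R.
Hypothesis gG : forall x, x \in G -> exists B, good_fibre A K q x B.

Let K0 : 0 < K. Proof. by apply: lt_le_trans K6; rewrite exprn_gt0. Qed.
Let q0 : 0 < q. Proof. exact: lt_le_trans q1. Qed.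
Let Kn n : 0 < K ^+ n. Proof. by rewrite exprn_gt0. Qed.
Let qn n : 0 < q ^+ n. Proof. by rewrite exprn_gt0. Qed.
Let uP : uniq P. Proof. exact: undup_uniq. Qed.
Let P0 : 0 \notin P.
Proof.
apply/negP => /psetP[a [b [aA bA /esym/eqP]]].
by rewrite qmulf_eq0 (negPf (memn0 A0 aA)) (negPf (memn0 A0 bA)).
Qed.
Let n0 : 0 < (size A)%:R :> R. Proof. by rewrite hA. Qed.
Let G0 : 0 < (size G)%:R :> R.
Proof. by rewrite -(pmulr_rgt0 _ K0); apply: lt_le_trans hG. Qed.
Let Pn : 0 < (size P)%:R :> R.
Proof.
rewrite ltr0n; case eA : A n0 => [|a A']; first by rewrite ltxx.
rewrite -eA => _; have : a * a \in P by rewrite mem_pset // eA mem_head.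
by case: (P).
Qed.

(** The factor [K^10] makes bad pairs rare enough for [choose_a]. Below, [z] must be at most a third
    of [|Y|], which is at least [q^4 / K^13], and [e'] must satisfy [|Pop| e' <= z e / 2], where
    [|Pop| <= K^12 q^4]. *)
Let e := q ^+ 4 / K ^+ 10.
Let e' := q ^+ 4 / K ^+ 38.
Let z := q ^+ 4 / K ^+ 15.
Let e0 : 0 < e. Proof. by rewrite divr_gt0. Qed.
Let e'0 : 0 < e'. Proof. by rewrite divr_gt0. Qed.
Let z0 : 0 < z. Proof. by rewrite divr_gt0. Qed.
Let bad (p p' : quat) := (lrep P (p / p'))%:R < e.
Let Px x := [seq p <- P | p * x \in P].
Let f x : R := \sum_(p <- Px x) \sum_(p' <- Px x) (bad p p')%:R.

(** By [common_lrep] a bad pair [(p, p')] lies in [Px x] for fewer than [e] slopes [x]; average over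
    [G]. *)
Let choose_x : exists2 x, x \in G & f x * (size G)%:R <= (size P)%:R ^+ 2 * e.
Proof.
have [|x xG xP] := @seq_argmin _ G f; first by rewrite -size_eq0 -(pnatr_eq0 R) lt0r_neq0.
exists x => //; rewrite mulrC; apply: le_trans (sum_geC xP) _.
apply: (@le_trans _ _ (\sum_(x <- G) \sum_(p <- P) \sum_(p' <- P)
    ((p * x \in P) && (p' * x \in P))%:R * (bad p p')%:R)).
  apply: ler_sums => y _; rewrite /f big_filter big_mkcond; apply: ler_sums => p _.
  case: ifP => h; last by apply: sumr_ge0 => p' _; rewrite mulr_ge0.
  rewrite big_filter big_mkcond; apply: ler_sums => p' _.
  by case: ifP => h'; rewrite ?mul1r ?mul0r.
rewrite exchange_big expr2 -mulrA; apply: sum_leC => p pP /=.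
rewrite exchange_big; apply: sum_leC => p' pP' /=; rewrite -mulr_suml -count_sum.
rewrite /bad; case: (ltP _ e) => h; rewrite ?mulr1 ?mulr0 ?(ltW e0) //.
by apply: le_trans (ltW h); rewrite ler_nat; apply: common_lrep => //; exact: memn0 P0 pP'.
Qed.

Let lpop (c : nat) : (size (popular P (q ^+ 4 / K ^+ c)))%:R <= K ^+ (c + 2) * q ^+ 4.
Proof.
have d0 : 0 < q ^+ 4 / K ^+ c by rewrite divr_gt0.
rewrite -(ler_pM2r d0); apply: le_trans (size_popular _ uP P0) _.
have -> : K ^+ (c + 2) * q ^+ 4 * (q ^+ 4 / K ^+ c) = (K * q ^+ 4) ^+ 2.
  by rewrite exprD; field; exact: lt0r_neq0.
exact: ler_sqr2.
Qed.

Let l2 : 0 < lg 2. Proof. by rewrite -lg1; apply: lg_lt => //; rewrite ltr1n. Qed.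
Let l4K : 4 * lg 2 <= lg K.
Proof.
rewrite -(lgX 4) //; apply: lg_le; first by rewrite exprn_gt0.
by apply: le_trans K6; lra.
Qed.

(** As [AB] lies in [Px x], it spans few bad pairs, but its elements may be represented very
    unevenly as products. Cauchy-Schwarz with [pwt_energy] controls this: at most half of the
    triples [(a, b, v)] are bad, and one averages over [a]. *)
Let choose_a x B : good_fibre A K q x B -> f x * (size G)%:R <= (size P)%:R ^+ 2 * e ->
  exists2 a, a \in A & (size B)%:R * (size (pset A B))%:R <=
    2 * (\sum_(b <- B) count (fun v => ~~ bad (a * b) v) (pset A B))%N%:R :> R.
Proof.
case=> uB BF Blo Bhi BB meB Vlo hf; set V := pset A B in Vlo *.
have BA : {subset B <= A} by move=> b /BF; rewrite mem_filter => /andP[].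
have B0 : 0 \notin B by apply: contra A0; exact: BA.
have VP : {subset V <= P} by move=> w /psetP[a [b [aA /BA bA ->]]]; exact: mem_pset.
have VPx : {subset V <= Px x}.
  move=> w wV; rewrite mem_filter VP // andbT; move: wV => /psetP[a [b [aA bB ->]]].
  by move/BF: bB; rewrite mem_filter -mulrA => /andP[h _]; exact: mem_pset.
have uV : uniq V by exact: undup_uniq.
have Br : 0 < (size B)%:R :> R by rewrite -(pmulr_rgt0 _ K0); apply: lt_le_trans Blo.
have Vr : 0 < (size V)%:R :> R by rewrite -(pmulr_rgt0 _ K0); apply: lt_le_trans Vlo.
pose Bd p : R := \sum_(v <- V) (bad p v)%:R.
have Bd0 p : 0 <= Bd p by apply: sumr_ge0.
pose W : R := \sum_(a <- A) \sum_(b <- B) Bd (a * b).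
have W0 : 0 <= W by do 2 (apply: sumr_ge0 => ? _).
have W4 : W ^+ 4 <= menergy A * menergy B * ((size V)%:R * f x) ^+ 2.
  have h1 : W ^+ 2 <= (\sum_(p <- V) (pwt A B p)%:R ^+ 2) * \sum_(p <- V) Bd p ^+ 2.
    by rewrite /W sum_mul //; exact: cauchy_schwarz.
  have h2 : \sum_(p <- V) Bd p ^+ 2 <= (size V)%:R * f x.
    apply: (@le_trans _ _ ((size V)%:R * \sum_(p <- V) Bd p)).
      rewrite mulr_sumr; apply: ler_sums => p _; rewrite expr2 ler_wpM2r // -[leRHS]mulr1.
      by apply: sum_leC => v _; case: (bad p v).
    rewrite ler_wpM2l //; apply: (@le_trans _ _ (\sum_(p <- V) \sum_(p' <- Px x) (bad p p')%:R)).
      apply: ler_sums => p _; apply: (sum_inj (F := fun v => (bad p v)%:R) (h := id)) => //.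
        exact: filter_uniq.
      by move=> v vV _; exact: VPx.
    apply: (sum_inj (F := fun p => \sum_(p' <- Px x) (bad p p')%:R) (h := id)) => //.
    - exact: filter_uniq.
    - by move=> v _; apply: sumr_ge0.
    by move=> v vV _; exact: VPx.
  rewrite [_ ^+ 4](exprM _ 2 2); apply: le_trans (ler_sqr2 (sqr_ge0 _) h1) _.
  rewrite exprMn; apply: ler_pM; rewrite ?sqr_ge0 //; first exact: pwt_energy.
  by apply: ler_sqr2 => //; apply: sumr_ge0 => p _; exact: sqr_ge0.
have hW : 2 * W <= (size A)%:R * (size B)%:R * (size V)%:R.
  rewrite leNgt; apply/negP => hlt.
  have h2 : 0 < 2 :> R by [].
  have nB := mulr_gt0 n0 Br; have nBV := mulr_gt0 nB Vr.
  have Wp : 0 < W by rewrite -(pmulr_rgt0 _ h2); apply: lt_trans hlt.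
  have W4' : W ^+ 4 <= (K * q ^+ 8) * (K * q ^+ 4) * ((size V)%:R * f x) ^+ 2.
    apply: le_trans W4 _; rewrite ler_wpM2r ?sqr_ge0 //.
    by apply: ler_pM => //; exact: menergy_ge0.
  have fp : 0 < f x.
    rewrite lt0r; apply/andP; split; last by do 2 (apply: sumr_ge0 => ? _).
    apply: contraTneq W4' => ->; rewrite mulr0 expr0n mulr0 -ltNge exprn_gt0 //.
  have := lg_lt nBV hlt; rewrite (lgM h2 Wp) (lgM nB Vr) (lgM n0 Br) hA (lgX 3 q0) => c1.
  have KQ8 := mulr_gt0 K0 (qn 8); have KQ4 := mulr_gt0 K0 (qn 4); have Vf := mulr_gt0 Vr fp.
  have := lg_le (exprn_gt0 4 Wp) W4'; rewrite (lgX 4 Wp).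
  rewrite (lgM (mulr_gt0 KQ8 KQ4) (exprn_gt0 2 Vf)) (lgM KQ8 KQ4) (lgX 2 Vf) (lgM Vr fp).
  rewrite (lgM K0 (qn 8)) (lgM K0 (qn 4)) (lgX 8 q0) (lgX 4 q0) => c2.
  have := lg_le (mulr_gt0 fp G0) hf.
  rewrite (lgM fp G0) (lgM (exprn_gt0 2 Pn) e0) (lgX 2 Pn) => c3.
  have := lgM e0 (Kn 10); rewrite divfK ?lt0r_neq0 // (lgX 4 q0) (lgX 10 K0) => c4.
  have := lg_le Pn hP; rewrite (lgM K0 (qn 4)) (lgX 4 q0) => c5.
  have := lg_le (qn 4) hG; rewrite (lgM K0 G0) (lgX 4 q0) => c6.
  have := lg_le (qn 4) Vlo; rewrite (lgM K0 Vr) (lgX 4 q0) => c7.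
  have := lg_le (qn 2) Blo; rewrite (lgM K0 Br) (lgX 2 q0) => c8.
  have VPn : (size V)%:R <= (size P)%:R :> R by rewrite ler_nat; exact: uniq_leq_size.
  have c9 := lg_le Vr VPn.
  by have := l4K; have := l2; lra.
have [|a aA aP] := @seq_argmax _ A (fun a =>
   (\sum_(b <- B) count (fun v => ~~ bad (a * b) v) V)%N%:R).
  by rewrite -size_eq0 -(pnatr_eq0 R) lt0r_neq0.
exists a => //.
have := sum_leC aP.
have -> : \sum_(a <- A) (\sum_(b <- B) count (fun v => ~~ bad (a * b) v) V)%N%:R =
    (size A)%:R * ((size B)%:R * (size V)%:R) - W.
  rewrite -[(size A)%:R * _]sum_const /W -sumrB; apply: eq_bigr => a' _.
  rewrite -[(size B)%:R * _]sum_const -sumrB natr_sum; apply: eq_bigr => b _.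
  rewrite -(count_predC (fun v => ~~ bad (a' * b) v) V) natrD /Bd -count_sum.
  by rewrite (eq_count (a1 := predC _) (a2 := bad (a' * b))) ?addrK // => v /=; rewrite negbK.
move=> h; rewrite -(ler_pM2l n0); move: h hW; rewrite !mulrA; lra.
Qed.

(** [prune] is applied to the quotients [a b / v]. Multiplying by [a^-1] turns them into [b v^-1],
    so [Y1], which is [a^-1 Y], is rich in dilates [B r] with [r = v^-1]; the left factor does not
    enlarge the product with [C], the set of inverses of [Y]. *)
Lemma near_ring : exists Y C : seq quat, [/\ uniq Y, uniq C & 0 \notin C] /\
  [/\ (size Y)%:R <= K ^+ 108 * q ^+ 4, q ^+ 4 <= K ^+ 108 * (size C)%:R,
      (size (pset Y C))%:R <= K ^+ 108 * q ^+ 4 & q ^+ 10 <= K ^+ 108 * energy Y].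
Proof.
have [x xG hf] := choose_x; have [B gB] := gG xG.
have [a aA ha] := choose_a gB hf.
case: gB => uB BF Blo Bhi BB meB Vlo; set V := pset A B in ha Vlo.
have BA : {subset B <= A} by move=> b /BF; rewrite mem_filter => /andP[].
have B0 : 0 \notin B by apply: contra A0; exact: BA.
have VP : {subset V <= P} by move=> w /psetP[a' [b [aA' /BA bA ->]]]; exact: mem_pset.
have uV : uniq V by exact: undup_uniq.
have V0 : 0 \notin V by apply: contra P0; exact: VP.
have a0 := memn0 A0 aA.
have Br : 0 < (size B)%:R :> R by rewrite -(pmulr_rgt0 _ K0); apply: lt_le_trans Blo.
have Vr : 0 < (size V)%:R :> R by rewrite -(pmulr_rgt0 _ K0); apply: lt_le_trans Vlo.
pose TL := [seq (b, v) | b <- B, v <- [seq v <- V | ~~ bad (a * b) v]].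
pose g (t : quat * quat) := a * t.1 / t.2.
have gP t : t \in TL -> g t \in popular P e.
  case: t => b v; rewrite mem_pairs mem_filter /bad -leNgt => /and3P[_ h _].
  by rewrite mem_popular.
have hpop : (size (popular P e))%:R * e' <= z * e / 2.
  apply: le_trans (_ : K ^+ 12 * q ^+ 4 * e' <= _); first by rewrite ler_wpM2r ?(ltW e'0) ?lpop.
  have -> : K ^+ 12 * q ^+ 4 * e' = q ^+ 8 / K ^+ 25 * K^-1.
    by rewrite /e'; field; exact: lt0r_neq0.
  have -> : z * e / 2 = q ^+ 8 / K ^+ 25 * 2^-1.
    by rewrite /z /e; field; exact: lt0r_neq0.
  rewrite ler_wpM2l ?divr_ge0 ?(ltW (qn 8)) ?(ltW (Kn 25)) // lef_pV2 ?posrE //.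
  by apply: le_trans K6; lra.
have Pne : P != [::] by rewrite -size_eq0 -(pnatr_eq0 R) lt0r_neq0.
have [Y [uY YP hT hYY]] := prune uP P0 Pne e0 e'0 z0 gP hpop.
set T := count _ TL in hT.
have Y0 y : y \in Y -> y != 0 by move=> /YP; rewrite mem_filter => /andP[_]; exact: lquo_neq0.
have TY : T%:R <= (size B)%:R * (size Y)%:R :> R.
  rewrite count_sum big_allpairs_dep; apply: sum_leC => b bB.
  rewrite -count_sum ler_nat -(count_predT Y) count_filter.
  apply: (count_inj (h := fun v => g (b, v))) => //.
    move=> v w; rewrite !inE => _ _ /= ev.
    have ab : a * b != 0 by rewrite qmulf_eq0 negb_or a0 (memn0 B0 bB).
    exact: invr_inj (qmulIl ab ev).
  by move=> v vV /andP[].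
have hTL : (size B)%:R * (size V)%:R <= 2 * (size TL)%:R :> R.
  by rewrite size_pairs; under eq_bigr do rewrite size_filter.
pose Y1 := map (fun y => a^-1 * y) Y; pose C := map (fun y => y^-1) Y.
pose Rr := map (fun v => v^-1) V.
have ai : a^-1 != 0 by rewrite qinv_eq0.
have uY1 : uniq Y1 by rewrite map_inj_uniq //; exact: qmulIl.
have uC : uniq C by rewrite map_inj_uniq //; exact: invr_inj.
have uR : uniq Rr by rewrite map_inj_uniq //; exact: invr_inj.
have C0 : 0 \notin C.
  by apply/negP => /mapP[y /Y0 y0 /esym/eqP]; rewrite qinv_eq0 (negPf y0).
have R0 : 0 \notin Rr.
  by apply/negP => /mapP[y /(memn0 V0) y0 /esym/eqP]; rewrite qinv_eq0 (negPf y0).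
have hTiles : T%:R <= (\sum_(r <- Rr) count (fun b => (b * r)%R \in Y1) B)%N%:R :> R.
  rewrite big_map natr_sum; under [leRHS]eq_bigr do rewrite count_sum.
  rewrite exchange_big count_sum big_allpairs_dep; apply: ler_sums => b _ /=.
  rewrite big_filter big_mkcond; apply: ler_sums => v _; case: ifP => // _.
  case: (boolP (g (b, v) \in Y)) => // h.
  have -> : b / v = a^-1 * g (b, v) by rewrite /g /= -mulrA mulKr.
  by rewrite map_f.
have h2 : 0 < 2 :> R by [].
have TLr : 0 < (size TL)%:R :> R.
  by rewrite -(pmulr_rgt0 _ h2); apply: lt_le_trans hTL; rewrite mulr_gt0.
have Tr : 0 < T%:R :> R.
  rewrite -(pmulr_rgt0 _ (mulr_gt0 h2 Pn)); apply: lt_le_trans hT.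
  by rewrite mulr_gt0.
have Yr : 0 < (size Y)%:R :> R by rewrite -(pmulr_rgt0 _ Br); apply: lt_le_trans TY.
have := lg_le (mulr_gt0 e0 TLr) hT.
rewrite (lgM e0 TLr) (lgM (mulr_gt0 h2 Pn) Tr) (lgM h2 Pn) => c1.
have := lgM e0 (Kn 10); rewrite divfK ?lt0r_neq0 // (lgX 4 q0) (lgX 10 K0) => c2.
have := lg_le (mulr_gt0 Br Vr) hTL; rewrite (lgM Br Vr) (lgM h2 TLr) => c3.
have := lg_le Pn hP; rewrite (lgM K0 (qn 4)) (lgX 4 q0) => c4.
have := lg_le Tr TY; rewrite (lgM Br Yr) => c5.
have := lg_le (qn 4) Vlo; rewrite (lgM K0 Vr) (lgX 4 q0) => c6.
have := lg_le (qn 2) Blo; rewrite (lgM K0 Br) (lgX 2 q0) => c7.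
have d1 := l2; have d2 := l4K.
have k1 : lg 3 <= lg K by apply: lg_le => //; apply: le_trans K6; lra.
have h3 : 0 < 3 :> R by [].
have hz : 3 * z <= (size Y)%:R.
  apply: (lg_leV Yr); rewrite (lgM h3 z0).
  have := lgM z0 (Kn 15); rewrite divfK ?lt0r_neq0 // (lgX 4 q0) (lgX 15 K0); lra.
have K1 : 1 <= K by apply: le_trans K6; lra.
have KK n (m : R) : (n <= 108)%N -> K ^+ n * q ^+ 4 <= K ^+ 108 * q ^+ 4.
  by move=> n108; rewrite ler_wpM2r ?(ltW (qn 4)) // ler_weXn2l.
have hpset : (size (pset Y1 C))%:R <= K ^+ 108 * q ^+ 4.
  apply: (@le_trans _ _ (size (pset Y C))%:R).
    rewrite ler_nat -(size_map (fun y => a^-1 * y) (pset Y C)); apply: uniq_leq_size; first exact: undup_uniq.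
    move=> w /psetP[y1 [c [/mapP[y yY ->] cC ->]]]; rewrite -mulrA map_f //.
    exact: mem_pset.
  apply: le_trans (KK 95%N 0 isT); rewrite -(ler_pM2r z0); apply: le_trans (hYY hz) _.
  have -> : K ^+ 95 * q ^+ 4 * z = (K ^+ 40 * q ^+ 4) ^+ 2.
    by rewrite /z; field; exact: lt0r_neq0.
  by apply: ler_sqr2 => //; exact: (lpop 38).
have tE := tiles_energy uY1 uB uR B0 R0.
have hE1 : T%:R ^+ 8 <= (size V)%:R ^+ 7 * (K * q ^+ 4) ^+ 2 * (K * q ^+ 2) * energy Y1.
  apply: le_trans (_ : _ <= (size Rr)%:R ^+ 7 * menergy B ^+ 2 * (size (sset B B))%:R * energy Y1) _.
    by apply: le_trans tE; rewrite ler_pXn2r // nnegrE.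
  have E1 : 0 <= energy Y1 by apply: sumr_ge0 => u _; exact: sqr_ge0.
  rewrite size_map ler_wpM2r //; apply: ler_pM => //.
    by rewrite mulr_ge0 ?exprn_ge0 // menergy_ge0.
  by rewrite ler_wpM2l ?exprn_ge0 //; apply: ler_sqr2 => //; exact: menergy_ge0.
have E1 : 0 < energy Y1.
  rewrite lt0r; apply/andP; split; last by apply: sumr_ge0 => u _; exact: sqr_ge0.
  by apply: contraTneq hE1 => ->; rewrite mulr0 -ltNge exprn_gt0.
have KQ4 := mulr_gt0 K0 (qn 4); have KQ2 := mulr_gt0 K0 (qn 2).
have V7 := exprn_gt0 7 Vr; have KQ42 := exprn_gt0 2 KQ4.
have := lg_le (exprn_gt0 8 Tr) hE1; rewrite (lgX 8 Tr).
rewrite (lgM (mulr_gt0 (mulr_gt0 V7 KQ42) KQ2) E1) (lgM (mulr_gt0 V7 KQ42) KQ2) (lgM V7 KQ42).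
rewrite (lgX 7 Vr) (lgX 2 KQ4) (lgM K0 (qn 4)) (lgM K0 (qn 2)) (lgX 4 q0) (lgX 2 q0) => c8.
exists Y1, C; split; first by split.
(* The largest loss, about [K^104], is in the energy, because [tiles_energy] involves the eighth
   power of [T]. *)
have H0 := Kn 108; have lH := lgX 108 K0.
split => //.
- apply: le_trans (KK 12%N 0 isT); apply: le_trans (lpop 10).
  by rewrite size_map ler_nat; apply: uniq_leq_size.
- by rewrite size_map; apply: (lg_leV (mulr_gt0 H0 Yr)); rewrite (lgM H0 Yr) lH (lgX 4 q0); lra.
by apply: (lg_leV (mulr_gt0 H0 E1)); rewrite (lgM H0 E1) lH (lgX 10 q0); lra.
Qed.

End NearRing.

(** * Exponents *)

(** By contradiction: a [q] beyond this power of [K] also exceeds the smaller powers that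
    [structure] and the estimate of [|Y|] require. *)
Lemma acute_bound (A : seq quat) (K q : R) (L : nat) :
  uniq A -> acute A -> 10 ^+ 6 <= K -> 1 <= q -> (0 < L)%N -> L%:R <= K ->
  q ^+ 10 < 2 ^+ L -> (size A)%:R = q ^+ 3 ->
  (size (sset A A))%:R <= K * q ^+ 4 -> (size (pset A A))%:R <= K * q ^+ 4 ->
  q <= ((K ^+ 1300) ^+ 108) ^+ 200.
Proof.
move=> uA aA K6 q1 L0 LK qL hA hAA hP.
have K1 : 1 <= K by apply: le_trans K6; lra.
have q0 : 0 < q by apply: lt_le_trans q1.
have KK : K <= K ^+ 1300 by rewrite -{1}[K]expr1; apply: ler_weXn2l.
have K4 : K ^+ 4 <= K ^+ 1300 by apply: ler_weXn2l.
have AL : (size A < 2 ^ L)%N.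
  by rewrite -(ltr_nat R) natrX hA; apply: le_lt_trans qL; apply: ler_weXn2l.
have struct := structure uA aA K6 q1 L0 LK AL hA hAA hP.
have meA := menergyA_le uA aA K6 L0 LK AL hAA.
move: (K ^+ 1300) KK K4 struct => H KK K4 struct.
have H6 : 10 ^+ 6 <= H by apply: le_trans KK.
have H1 : 1 <= H by apply: le_trans K1 KK.
have HH : H <= H ^+ 108 by rewrite -{1}[H]expr1; apply: ler_weXn2l.
rewrite leNgt; apply/negP => lt.
have H2q : H ^+ 108 <= q.
  apply: le_trans (ltW lt); rewrite -{1}[H ^+ 108]expr1; apply: ler_weXn2l => //.
  exact: le_trans HH.
have [G [uG hG gG]] := struct (le_trans HH H2q).
have A0 : 0 \notin A by case: aA.
have hP' : (size (pset A A))%:R <= H * q ^+ 4.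
  by apply: le_trans hP _; rewrite ler_wpM2r // exprn_ge0 // ltW.
have meA' : menergy A <= H * q ^+ 8.
  by apply: le_trans meA _; rewrite ler_wpM2r // exprn_ge0 // ltW.
have [Y [C [[uY uC C0] [hY hC hYC hE]]]] := near_ring uA A0 uG H6 q1 hA hP' meA' hG gG.
move: (H ^+ 108) HH H2q hY hC hYC hE lt => J HJ Jq hY hC hYC hE lt.
have J6 : 10 ^+ 6 <= J by apply: le_trans HJ.
have LJ : L%:R <= J by apply: le_trans LK _; apply: le_trans KK HJ.
(* [|Y| <= J q^4 <= q^5], which is why [2 ^+ L] is compared with [q ^+ 10]. *)
have YL : (size Y ^ 2 < 2 ^ L)%N.
  rewrite -(ltr_nat R) !natrX; apply: le_lt_trans qL; rewrite (exprM q 5 2).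
  apply: ler_sqr2 => //; apply: le_trans hY _.
  by rewrite (exprS q 4) ler_wpM2r // exprn_ge0 // ltW.
have := near_ring_bound uY uC C0 J6 q1 L0 LJ YL hY hC hYC hE.
by rewrite leNgt lt.
Qed.

(** The sign patterns of the four coordinates give 16 classes, within which inner products are sums
    of nonnegative terms; the [+ 1] accounts for the element 0. *)
Lemma orthant (A : seq quat) : uniq A -> exists B : seq quat,
  [/\ uniq B, {subset B <= A}, acute B & (size A <= 16 * size B + 1)%N].
Proof.
move=> uA; pose sg (x : quat) := (0 <= qre x, 0 <= qi x, 0 <= qj x, 0 <= qk x).
pose A1 := [seq x <- A | x != 0].
have [|s hs] := @pigeonhole _ _ A1 sg (fun=> 1); first by rewrite !card_prod !card_bool.
rewrite sum_const mulr1 !card_prod !card_bool -big_filter sum_const mulr1 in hs.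
exists [seq x <- A1 | sg x == s]; split.
- by rewrite !filter_uniq.
- by move=> x; rewrite !mem_filter => /and3P[].
- split; first by rewrite !mem_filter eqxx andbF.
  move=> u v; rewrite !mem_filter => /andP[/eqP su _] /andP[/eqP sv _].
  have := etrans su (esym sv); rewrite /sg => e.
  have e1 := congr1 (fun t => t.1.1.1) e; have e2 := congr1 (fun t => t.1.1.2) e.
  have e3 := congr1 (fun t => t.1.2) e; have e4 := congr1 snd e.
  rewrite /= in e1 e2 e3 e4.
  have pos (a b : R) : (0 <= a) = (0 <= b) -> 0 <= a * b.
    case: (leP 0 a) => ha /esym; first by move=> hb; rewrite mulr_ge0.
    by move=> /negbT; rewrite -ltNge => hb; rewrite mulr_le0 // ltW.
  by rewrite /qdot !addr_ge0 // pos.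
rewrite -natrM ler_nat in hs.
have : (size A <= size A1 + 1)%N.
  rewrite -(count_predC (fun x => x != 0) A) size_filter leq_add2l.
  rewrite (eq_count (a2 := pred1 0)) ?count_uniq_mem ?leq_b1 // => x /=.
  by rewrite negbK.
by move=> h; apply: leq_trans h _; rewrite leq_add2r.
Qed.

(** * Transfer to the lists and real powers of the statement *)

Lemma In_mem (x : quat) (s : seq quat) : In x s <-> x \in s.
Proof.
elim: s => [|a s IH] //=; rewrite inE; split.
  by case=> [->|/IH ->]; rewrite ?eqxx ?orbT.
by move=> /orP[/eqP ->|/IH]; [left | right].
Qed.

Lemma NoDup_uniq (s : seq quat) : NoDup s -> uniq s.
Proof.
elim=> [//|a l al _ IH] /=; rewrite IH andbT; apply/negP => /In_mem; exact: al.
Qed.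

Lemma qcard_ge (s l : seq quat) : uniq s -> {subset s <= l} -> (size s <= qcard l)%N.
Proof.
move=> us sl; apply: uniq_leq_size us _ => x /sl /In_mem xl.
by apply/In_mem; apply/nodup_In.
Qed.

Lemma qcard_sset (A B : seq quat) : {subset B <= A} ->
  (size (sset B B) <= qcard (sumset A A))%N.
Proof.
move=> BA; apply: qcard_ge; first exact: undup_uniq.
move=> w /ssetP[a [b [/BA aA /BA bA ->]]]; apply/In_mem/in_flat_map; exists a.
by split; [exact/In_mem | apply: in_map; exact/In_mem].
Qed.

Lemma qcard_pset (A B : seq quat) : {subset B <= A} ->
  (size (pset B B) <= qcard (prodset A A))%N.
Proof.
move=> BA; apply: qcard_ge; first exact: undup_uniq.
move=> w /psetP[a [b [/BA aA /BA bA ->]]]; apply/In_mem/in_flat_map; exists a.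
by split; [exact/In_mem | apply: in_map; exact/In_mem].
Qed.

Definition ex (x : R) : R := Rtrigo_def.exp x.

Lemma ex_gt0 x : 0 < ex x. Proof. by apply/RltP; exact: Exp_prop.exp_pos. Qed.
Lemma lg_ex x : lg (ex x) = x. Proof. exact: Rpower.ln_exp. Qed.
Lemma ex_lg x : 0 < x -> ex (lg x) = x.
Proof. by move=> /RltP; exact: Rpower.exp_ln. Qed.
Lemma ex_ge x : 1 + x <= ex x.
Proof. by apply/RleP; have := Rpower.exp_ineq1_le x; rewrite RplusE. Qed.
Lemma exD x y : ex (x + y) = ex x * ex y.
Proof. by rewrite /ex -RplusE Exp_prop.exp_plus RmultE. Qed.

Lemma lg2_ge : 1 / 2 <= lg 2.
Proof.
have h2 : 0 < 2 :> R by [].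
have := ex_ge (- (1 / 2)); set y := ex _ => hy.
have : 1 <= 2 * y by lra.
move=> /(lg_le ltr01); rewrite lg1 (lgM h2 (ex_gt0 _)) lg_ex; lra.
Qed.

(** With [K = |A|^eta] the bound of [acute_bound] reads [q <= |A|^(1/6)], whereas [q] is about
    [|A|^(1/3)]. *)
Definition eta : R := 1 / (6 * (1300 * (108 * 200))).
(** The terms ensure, in this order, that [8 lg |A| <= (eta lg |A| / 2)^2], which gives [L <= K];
    that [10^6 <= K]; and that [lg |A| > 2 lg 32], so that losing a factor 32 in passing to one
    orthant does not spoil the contradiction. *)
Definition threshold : R := 32 / eta ^+ 2 + lg (10 ^+ 6) / eta + 2 * lg 32 + 2.

Lemma eta_gt0 : 0 < eta. Proof. by rewrite /eta divr_gt0 // !mulr_gt0. Qed.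

Lemma lg0 : lg 0 = 0.
Proof.
rewrite /lg /Rpower.ln; case: Rlt_dec => // h.
by case: (RIneq.Rlt_irrefl _ h).
Qed.

Lemma lg_ge1 (x : R) : 1 <= x -> 0 <= lg x.
Proof. by move=> x1; rewrite -lg1; apply: lg_le. Qed.

Lemma threshold_ge : [/\ 32 / eta ^+ 2 <= threshold, lg (10 ^+ 6) / eta <= threshold,
  2 * lg 32 + 2 <= threshold & 2 <= threshold].
Proof.
have h0 := eta_gt0.
have h1 : 0 <= 32 / eta ^+ 2 by rewrite divr_ge0 // exprn_ge0 // ltW.
have h2 : 0 <= lg (10 ^+ 6) / eta.
  by rewrite divr_ge0 ?(ltW h0) // lg_ge1 // exprn_ege1 // ler1n.
have h3 : 0 <= lg 32 by rewrite lg_ge1 // ler1n.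
by rewrite /threshold; split; move: h1 h2 h3; lra.
Qed.

Lemma sum_product_large (A : seq quat) : uniq A -> threshold <= lg (size A)%:R ->
  exists2 B : seq quat, {subset B <= A} &
    ex (- (2 * threshold)) * ex ((4 / 3 + eta) * lg (size A)%:R) <=
    (size (sset B B))%:R + (size (pset B B))%:R.
Proof.
move=> uA hX; set a := lg _ in hX *.
have [t1 t2 t3 t4] := threshold_ge.
have e0 := eta_gt0.
have [B [uB BA aB hn]] := orthant uA; exists B => //.
have An : (1 < size A)%N.
  rewrite ltnNge; apply/negP => A1; have : a <= 0.
    rewrite /a -lg1; case: (posnP (size A)) => [->|A0]; last first.
      by apply: lg_le; rewrite ?ltr0n ?lern1.
    by rewrite lg0 lg1.
  lra.
have Ar : 0 < (size A)%:R :> R by rewrite ltr0n ltnW.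
have B0 : (0 < size B)%N by rewrite lt0n; apply: contraTneq hn => ->; rewrite -ltnNge.
have Br : 0 < (size B)%:R :> R by rewrite ltr0n.
have AB : (size A)%:R <= 32 * (size B)%:R :> R.
  rewrite -natrM ler_nat; apply: leq_trans hn _.
  by move: B0; move: (size B) => m; lia.
have h32 : 0 < 32 :> R by [].
set b := lg (size B)%:R.
have ab : a <= lg 32 + b by rewrite -(lgM h32 Br); exact: lg_le.
have ba : b <= a by apply: lg_le => //; rewrite ler_nat; exact: uniq_leq_size.
have b0 : 0 <= b by rewrite lg_ge1 // ler1n.
pose q := ex (b / 3); pose K := ex (eta * a).
have q0 : 0 < q by exact: ex_gt0.
have K0 : 0 < K by exact: ex_gt0.
have lq : lg q = b / 3 by exact: lg_ex.
have lK : lg K = eta * a by exact: lg_ex.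
have hq3 : (size B)%:R = q ^+ 3.
  rewrite -(ex_lg Br) -/b -(ex_lg (exprn_gt0 3 q0)) (lgX 3 q0) lq; congr ex; lra.
have q1 : 1 <= q by apply: (lg_leV q0); rewrite lg1 lq; lra.
have K6 : 10 ^+ 6 <= K.
  apply: (lg_leV K0); rewrite lK mulrC -ler_pdivrMr //; exact: le_trans t2 hX.
have l2 := lg2_ge.
have l20 : 0 < lg 2 by lra.
have a0 : 0 <= a by lra.
have h2 : 0 < 2 :> R by [].
have [L [L0 qL LK]] : exists L : nat, [/\ (0 < L)%N, q ^+ 10 < 2 ^+ L & L%:R <= K].
  set x := 10 * lg q / lg 2.
  have x0 : 0 <= x by rewrite divr_ge0 ?(ltW l20) // lq; lra.
  have l1 : x <= 20 / 3 * a.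
    by rewrite ler_pdivrMr // lq -mulrA; have := ler_wpM2l a0 l2; lra.
  have l8 : x + 1 <= 8 * a by lra.
  have /andP[L1 L2] := truncn_itv x0.
  exists (Num.truncn x).+1; split => //.
    rewrite ltNge; apply/negP => /(lg_le (exprn_gt0 _ h2)); rewrite (lgX _ h2) (lgX 10 q0).
    by rewrite leNgt -ltr_pdivrMr // L2.
  rewrite -natr1; apply: le_trans (_ : x + 1 <= _); first by rewrite lerD2r.
  (* The inequality [ex y >= y], squared at [y = lg K / 2], reduces the claim to
     [8 a <= (eta a)^2 / 4]. *)
  apply: le_trans l8 _; pose y := eta * a / 2.
  have -> : K = ex y ^+ 2 by rewrite expr2 -exD; congr ex; rewrite /y; field.
  have e32 : 32 <= eta ^+ 2 * a.
    by rewrite mulrC -ler_pdivrMr ?exprn_gt0 //; exact: le_trans t1 hX.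
  have y0 : 0 <= y by rewrite divr_ge0 // mulr_ge0 ?(ltW e0).
  have yy : y <= ex y by apply: le_trans (ex_ge y); rewrite lerDr.
  apply: le_trans (ler_sqr2 y0 yy).
  have -> : y ^+ 2 = eta ^+ 2 * a * a / 4 by rewrite /y; field.
  have := ler_wpM2r a0 e32; move: (eta ^+ 2 * a * a) a0 => w; lra.
have hD : 1300 * (108 * 200) * (eta * a) = a / 6 by rewrite /eta; field.
have goal : ex (- (2 * threshold)) * ex ((4 / 3 + eta) * a) <= K * q ^+ 4.
  rewrite -exD; apply: (lg_leV (mulr_gt0 K0 (exprn_gt0 4 q0))).
  rewrite lg_ex (lgM K0 (exprn_gt0 4 q0)) (lgX 4 q0) lq lK; lra.
have [hs|hs] := leP (size (sset B B))%:R (K * q ^+ 4); last first.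
  by apply: le_trans goal (le_trans (ltW hs) _); rewrite lerDl.
have [hp|hp] := leP (size (pset B B))%:R (K * q ^+ 4); last first.
  by apply: le_trans goal (le_trans (ltW hp) _); rewrite lerDr.
have := acute_bound uB aB K6 q1 L0 LK qL hq3 hs hp.
move=> /(lg_le q0).
have p1 := exprn_gt0 1300 K0; have p2 := exprn_gt0 108 p1.
rewrite (lgX 200 p2) (lgX 108 p1) (lgX 1300 K0) lq lK; lra.
Qed.

Lemma ex_le x y : x <= y -> ex x <= ex y.
Proof. by move=> xy; apply: (lg_leV (ex_gt0 _)); rewrite !lg_ex. Qed.

Lemma sum_product (A : seq quat) : NoDup A -> A <> nil ->
  ex (- (2 * threshold)) * ex ((4 / 3 + eta) * lg (size A)%:R) <=
  (qcard (sumset A A))%:R + (qcard (prodset A A))%:R.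
Proof.
move=> /NoDup_uniq uA Ane.
have [hX|hX] := leP threshold (lg (size A)%:R).
  have [B BA] := sum_product_large uA hX; move=> /le_trans; apply.
  by apply: lerD; rewrite ler_nat ?qcard_sset ?qcard_pset.
have A0 : (0 < size A)%N by case: (A) Ane.
(* Below the threshold the constant makes the left side at most 1, because [(4 / 3 + eta) lg |A| <=
   (5 / 3) threshold]. *)
apply: (@le_trans _ _ 1).
  rewrite -exD -[leRHS](ex_lg ltr01) lg1; apply: ex_le.
  have a0 : 0 <= lg (size A)%:R by rewrite lg_ge1 // ler1n.
  have e1 : eta <= 1 / 3.
    by rewrite /eta; lra.
  have [_ _ _ t4] := threshold_ge.
  have := ler_wpM2r a0 e1; rewrite mulrDl; move: hX a0 t4; lra.
apply: le_trans (_ : (qcard (sumset A A))%:R <= _); last by rewrite lerDl.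
rewrite ler1n; apply: leq_trans (qcard_sset (fun _ => id)).
by apply: leq_trans A0 _; exact: sset_size_ge.
Qed.

Definition density_constant : R := ex (- (2 * threshold)).

Bind Scope R_scope with Rdefinitions.R.
Open Scope R_scope.

(* A finite set A ⊂ H is a duplicate-free nonempty list; |A| = length A. *)
Theorem theorem1p1 :
  exists c : R, 0 < c /\
  exists C : R, 0 < C /\
  forall A : list quat, NoDup A -> A <> nil ->
    INR (qcard (sumset A A)) + INR (qcard (prodset A A))
      >= C * Rpower (INR (length A)) (4 / 3 + c).
Proof.
exists eta; split; first by apply/RltP; exact: eta_gt0.
exists density_constant; split; first by apply/RltP; exact: ex_gt0.
move=> A dA Ane; apply/Rle_ge/RleP; rewrite !RealsE.
(* [Rpower n y] is [exp (y * ln n)], hence convertible to the power written with [ex] and [lg]. *)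
exact: sum_product dA Ane.
Qed.
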